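(* Let $(M,\omega)$ be a compact K\''ahler manifold of complex dimension $n$ and let $\mathscr{J}$ be the space of almost complex structures compatible with $\omega$, with its (formal) infinite-dimensional K\''ahler structure $(\mathbb{J},\mathbb{G})$. The complex structure $\mathbb{J}$ and the curvature tensor of $\mathbb{G}$ are covariantly constant with respect to the Levi-Civita connection of $\mathbb{G}$. In particular, $\mathscr{J}$ is a formally symmetric infinite-dimensional K\''ahler manifold.
   Context: $\mathscr{J}$ is the set of almost complex structures $J$ on $M$ with $\omega(J\cdot,J\cdot)=\omega$ and $g_J=\omega(\cdot,J\cdot)>0$. It is viewed as the Fr\'echet manifold of smooth sections of a bundle over $M$ which in Darboux coordinates has fibre $\{J\in \mathrm{Sp}(2n):J^2=-1,\Omega_0J>0\}\cong \mathrm{Sp}(2n)/U(n)$. Its tangent space is $T_J\mathscr{J}=\{A\in\Gamma(\mathrm{End}(TM)): AJ+JA=0,\ g_J(A\cdot,\cdot)\text{ symmetric}\}$. The K\''ahler structure is $\mathbb{J}_J(A)=JA$, $\mathbb{G}_J(A,B)=\frac12\int_M\mathrm{Tr}(AB)\frac{\omega^n}{n!}$. The Levi-Civita connection of $\mathbb{G}$ is the unique torsion-free metric connection, characterised by the Koszul formula (it exists in this setting); its curvature tensor is $R(A,B)C$. ''Formally symmetric'' means that the curvature tensor is covariantly constant. *)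

(* Defs.v *)
From HB Require Import structures.
From mathcomp Require Import all_boot all_order all_algebra perm.
From mathcomp Require Import all_classical all_reals all_analysis.
Set Implicit Arguments.
Unset Strict Implicit.
Unset Printing Implicit Defensive.
Import Order.TTheory GRing.Theory Num.Theory.
Import numFieldNormedType.Exports.
Local Open Scope classical_set_scope.
Local Open Scope ring_scope.

Section FiniteDimensionalCalculus.
Context {R : realType}.

Section Smoothness.
Context {V W : normedModType R}.
Implicit Types (U : set V) (f : V -> W).

(* Class C^k on an open set U; the values of f off U are irrelevant. *)
Fixpoint Ck (k : nat) U f : Prop :=
  if k is k'.+1 then
    (forall x, U x -> differentiable f x) /\ (forall v, Ck k' U ('D_v f))
  else forall x, U x -> {for x, continuous f}.

Definition smooth U f : Prop := forall k, Ck k U f.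

Definition iter_derive (vs : seq V) f : V -> W :=
  foldr (fun v g => 'D_v g) f vs.

End Smoothness.

Definition jac {m k} (f : 'cV[R]_m -> 'cV[R]_k) (x : 'cV[R]_m) : 'M[R]_(k, m) :=
  \matrix_(a, b) 'D_(delta_mx b 0) f x a 0.

(* Iterated integral over R^m; on non-negative Borel functions this is the
   Lebesgue integral, by Tonelli's theorem. *)
Fixpoint cV_integral m : ('cV[R]_m -> \bar R) -> \bar R :=
  match m with
  | 0 => fun f => f 0
  | m'.+1 => fun f => (\int[@lebesgue_measure R]_x
      cV_integral (fun y : 'cV[R]_m' => f (col_mx (x%:M : 'cV[R]_1) y)))%E
  end.

End FiniteDimensionalCalculus.


Section DerivativeRules.
Context {R : realType}.
Implicit Types V W : normedModType R.

Lemma near_eq_differentiable V W (f g : V -> W) x :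
  {near x, f =1 g} -> differentiable f x -> differentiable g x.
Proof.
move=> fg df.
suff dh : differentiable (g - f) x.
  by rewrite -(subrK f g); exact: differentiableD.
have Eh : (g - f) \o shift x = cst ((g - f) x) + (0 : V -> W) +o_ 0 id.
  apply/eqaddoP => _/posnumP[e]; near=> y.
  have -> : ((g - f) \o shift x - (cst ((g - f) x) + (0 : V -> W))) y = 0.
    rewrite !fctE /= addr0 (nbhs_singleton fg) subrr subr0.
    have : f (y + x) = g (y + x).
      near: y; move: fg; rewrite (near_shift 0 x) subr0.
      by apply: filterS => y /=.
    by move=> ->; rewrite subrr.
  by rewrite normr0 mulr_ge0.
have c0 : continuous (\0 : {linear V -> W}) by move=> ?; exact: cvg_cst.
have E0 : 'd (g - f) x = (\0 : {linear V -> W}) :> (V -> W).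
  exact: diff_unique c0 Eh.
by apply/diff_locallyP; rewrite E0; split.
Unshelve. all: by end_near. Qed.

Lemma Ck_ext V W k (U : set V) (f g : V -> W) :
  open U -> (forall x, U x -> f x = g x) -> Ck k U f -> Ck k U g.
Proof.
move=> oU; elim: k f g => [|k IH] f g fg.
  move=> cf x Ux; have nU : {near x, f =1 g}.
    by apply: filterS (open_nbhs_nbhs (conj oU Ux)) => y /fg.
  have := cf x Ux; rewrite /prop_for /continuous_at -(fg x Ux).
  by apply: cvg_trans; apply: near_eq_cvg.
have nU x : U x -> {near x, f =1 g}.
  by move=> Ux; apply: filterS (open_nbhs_nbhs (conj oU Ux)) => y /fg.
move=> [df Df]; split=> [x Ux|v].
  exact: near_eq_differentiable (nU x Ux) (df x Ux).
by apply: IH (Df v) => x Ux; exact: near_eq_derive (nU x Ux).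
Qed.

Lemma Ck_cst V W k (U : set V) (a : W) : open U -> Ck k U (cst a).
Proof.
move=> oU; elim: k a => [|k IH] a; first by move=> x _; exact: cst_continuous.
split=> [x _|v]; first exact: differentiable_cst.
by apply: Ck_ext (IH 0) => // x _; rewrite deriveE ?diff_cst.
Qed.

Lemma Ck_lin V W k (U : set V) (f g : V -> W) (c : R) :
  open U -> Ck k U f -> Ck k U g -> Ck k U (c *: f + g).
Proof.
move=> oU; elim: k f g => [|k IH] f g.
  move=> cf cg x Ux; apply: continuousD (cg x Ux).
  exact: continuousZl_tmp (cf x Ux).
move=> [df Df] [dg Dg]; split=> [x Ux|v].
  by apply: differentiableD (dg x Ux); exact: differentiableZ (df x Ux).
apply: Ck_ext (IH _ _ (Df v) (Dg v)) => // x Ux.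
have dcf : differentiable (c *: f) x by exact: differentiableZ (df x Ux).
rewrite [RHS]deriveE; last exact: differentiableD dcf (dg x Ux).
rewrite diffD //; last exact: dg.
rewrite /= diffZ; last exact: df.
rewrite /= -(deriveE v (df x Ux)) -(deriveE v (dg x Ux)).
by [].
Qed.

Lemma smooth_derive V W (U : set V) (f : V -> W) v :
  smooth U f -> smooth U ('D_v f).
Proof. by move=> sf k; have [_ Df] := sf k.+1; exact: Df. Qed.

Lemma mulmx_is_bilinear m : bilinear_for
  (GRing.Scale.Law.clone _ _ *:%R _) (GRing.Scale.Law.clone _ _ *:%R _)
  (@mulmx R m m m).
Proof.
split=> [u|u] a x y /=; first by rewrite mulmxDl scalemxAl.
by rewrite mulmxDr scalemxAr.
Qed.
HB.instance Definition _ m := bilinear_isBilinear.Build R _ _ _ _ _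
  (@mulmx R m m m) (@mulmx_is_bilinear m).

Lemma mulmx_continuous m :
  continuous (fun p : 'M[R]_m * 'M[R]_m => p.1 *m p.2).
Proof.
have -> : (fun p : 'M[R]_m * 'M[R]_m => p.1 *m p.2) =
    (fun p => \sum_(i < m) \sum_(j < m) (\sum_(k < m) p.1 i k * p.2 k j) *:
      (delta_mx i j : 'M[R]_m)).
  apply/funext => p; rewrite {1}[p.1 *m p.2]matrix_sum_delta.
  by apply: eq_bigr => i _; apply: eq_bigr => j _; rewrite mxE.
move=> p; apply: cvg_big => [|i _]; first exact: add_continuous.
apply: cvg_big => [|j _]; first exact: add_continuous.
apply: cvgZr_tmp; apply: cvg_big => [|k _]; first exact: add_continuous.
apply: cvgM.
  apply: (@cvg_comp _ _ _ fst (fun A : 'M[R]_m => A i k)); first exact: cvg_fst.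
  exact: coord_continuous.
apply: (@cvg_comp _ _ _ snd (fun A : 'M[R]_m => A k j)); first exact: cvg_snd.
exact: coord_continuous.
Qed.

Lemma differentiable_mulmx V m (f g : V -> 'M[R]_m) x :
  differentiable f x -> differentiable g x ->
  differentiable (fun y => f y *m g y) x /\
  forall v, 'D_v (fun y => f y *m g y) x = f x *m 'D_v g x + 'D_v f x *m g x.
Proof.
move=> df dg.
have dp := differentiable_pair df dg.
have db := @differentiable_bilin _ _ _ _ (@mulmx R m m m) (f x, g x)
  (@mulmx_continuous m).
have dm := differentiable_comp dp db; split=> // v.
rewrite deriveE // (diff_comp dp db) /= diff_bilin //; last first.
  exact: mulmx_continuous.
by rewrite (diff_pair df dg) /= !deriveE.
Qed.

Lemma smooth_mulmx V m (U : set V) (f g : V -> 'M[R]_m) :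
  open U -> smooth U f -> smooth U g -> smooth U (fun y => f y *m g y).
Proof.
move=> oU sf sg k; elim: k f g sf sg => [|k IH] f g sf sg.
  move=> x Ux; apply: differentiable_continuous.
  by have [] := differentiable_mulmx ((sf 1).1 x Ux) ((sg 1).1 x Ux).
split=> [x Ux|v].
  by have [] := differentiable_mulmx ((sf 1).1 x Ux) ((sg 1).1 x Ux).
have H := Ck_lin 1 oU (IH _ _ sf (smooth_derive v sg))
  (IH _ _ (smooth_derive v sf) sg).
apply: Ck_ext H => // x Ux.
have [_ ->] := differentiable_mulmx ((sf 1).1 x Ux) ((sg 1).1 x Ux).
by rewrite !fctE scale1r.
Qed.

Lemma jacE m k (f : 'cV[R]_m -> 'cV[R]_k) x :
  differentiable f x -> forall v, jac f x *m v = 'd f x v.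
Proof.
move=> df v; rewrite {2}[v]matrix_sum_delta linear_sum.
apply/colP => a; rewrite mxE summxE; apply: eq_bigr => b _.
by rewrite big_ord1 linearZ !mxE deriveE // mulrC.
Qed.

Lemma diff_inverse V W (f : V -> W) (g : W -> V) x v :
  differentiable f x -> differentiable g (f x) ->
  {near x, g \o f =1 id} -> 'd g (f x) ('d f x v) = v.
Proof.
move=> df dg gf; have dgf := differentiable_comp df dg.
transitivity ('d (g \o f) x v); first by rewrite (diff_comp df dg).
rewrite -(deriveE v dgf) (near_eq_derive (g := id) _ gf).
have di := is_diff_id x.
by rewrite (deriveE v (ex_diff)) (@diff_val _ _ _ _ _ _ _ di).
Qed.

Lemma jac_inverse m (f g : 'cV[R]_m -> 'cV[R]_m) x :
  differentiable f x -> differentiable g (f x) ->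
  {near x, g \o f =1 id} -> jac g (f x) *m jac f x = 1%:M.
Proof.
move=> df dg gf.
have H (v : 'cV[R]_m) : jac g (f x) *m jac f x *m v = v.
  by rewrite -mulmxA (jacE df) (jacE dg); exact: diff_inverse.
apply/matrixP => a b.
have := H (delta_mx b 0) => /matrixP /(_ a 0).
by rewrite -colE !mxE eqxx andbT.
Qed.
End DerivativeRules.

(* Multiplication by i on C^n = R^n + iR^n, acting on columns (x, y). *)
Definition stdJ {R : realType} {n} : 'M[R]_(n + n) := block_mx 0 (- 1%:M) 1%:M 0.

(* A compact complex manifold, presented by a holomorphic atlas with values in
   C^n = R^(2n).  [coord i] is a chart with domain [dom i] and inverse
   [param i].  Holomorphy of the transition maps is the Cauchy-Riemann
   equation.  The preferred chart [chart_at p] around p serves to identify the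
   tangent space at p with R^(2n). *)
Record compactComplexManifold (R : realType) (n : nat) := CompactComplexManifold {
  carrier :> ptopologicalType;
  chart : Type;
  dom : chart -> set carrier;
  coord : chart -> carrier -> 'cV[R]_(n + n);
  param : chart -> 'cV[R]_(n + n) -> carrier;
  chart_at : carrier -> chart;
  carrier_compact : compact [set: carrier];
  carrier_hausdorff : hausdorff_space carrier;
  dom_open : forall i, open (dom i);
  coord_dom_open : forall i, open (coord i @` dom i);
  coordK : forall i p, dom i p -> param i (coord i p) = p;
  coord_continuous : forall i p, dom i p -> {for p, continuous (coord i)};
  param_continuous : forall i x,
    (coord i @` dom i) x -> {for x, continuous (param i)};
  transition_smooth : forall i j,
    smooth (coord i @` (dom i `&` dom j)) (coord j \o param i);
  transition_holomorphic : forall i j x, (coord i @` (dom i `&` dom j)) x ->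
    jac (coord j \o param i) x *m stdJ = stdJ *m jac (coord j \o param i) x;
  chart_at_dom : forall p, dom (chart_at p) p
}.

Section Tensors.
Context {R : realType} {n : nat} (M : compactComplexManifold R n).
Local Notation m := (n + n)%N.
Implicit Types (i j : chart M) (A : M -> 'M[R]_m) (x : 'cV[R]_m).

Definition chart_image i : set 'cV[R]_m := @coord _ _ M i @` @dom _ _ M i.

(* Matrix of the identification of T_pM, p = param i x, written in the
   coordinates of the chart i, with R^(2n). *)
Definition frame i x : 'M[R]_m :=
  jac (@coord _ _ M (chart_at (param i x)) \o @param _ _ M i) x.

(* A p is the matrix of an endomorphism of T_pM. *)
Definition local_end A i x : 'M[R]_m :=
  invmx (frame i x) *m A (param i x) *m frame i x.

(* w p is the matrix of a bilinear form on T_pM: w(u, v) = u^T (w p) v. *)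
Definition local_form (w : M -> 'M[R]_m) i x : 'M[R]_m :=
  (frame i x)^T *m w (param i x) *m frame i x.

Definition smooth_end A : Prop := forall i, smooth (chart_image i) (local_end A i).

Definition smooth_form (w : M -> 'M[R]_m) : Prop :=
  forall i, smooth (chart_image i) (local_form w i).

Definition closed_form (w : M -> 'M[R]_m) : Prop :=
  forall i x, chart_image i x -> forall a b c : 'I_m,
    let dw (a b c : 'I_m) := 'D_(delta_mx a 0) (local_form w i) x b c in
    dw a b c + dw b c a + dw c a b = 0.

Lemma frame_unit i x : chart_image i x -> frame i x \in unitmx.
Proof.
case=> q iq <-{x}; set x := coord i q.
have xq : param i x = q by exact: coordK.
pose c := chart_at q.
have cq : dom c q by exact: chart_at_dom.
pose f := @coord _ _ M c \o @param _ _ M i.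
pose g := @coord _ _ M i \o @param _ _ M c.
have fx : f x = coord c q by rewrite /f /= xq.
have df : differentiable f x.
  by apply: (@transition_smooth _ _ M i c 1).1; exists q.
have dg : differentiable g (f x).
  by rewrite fx; apply: (@transition_smooth _ _ M c i 1).1; exists q.
have gf : {near x, g \o f =1 id}.
  have ni : \forall y \near x, chart_image i y.
    by apply: open_nbhs_nbhs; split; [exact: coord_dom_open|exists q].
  have nc : \forall y \near x, dom c (param i y).
    have pc : {for x, continuous (@param _ _ M i)}.
      by apply: param_continuous; exists q.
    by apply: pc; rewrite xq; apply: open_nbhs_nbhs; split=> //; exact: dom_open.
  apply: filterS2 ni nc => y [r ir <-{y}].
  by rewrite /g /f /= (coordK ir) => cr; rewrite (coordK cr).
have := jac_inverse df dg gf => /mulmx1_unit[_].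
by rewrite /frame xq.
Qed.

Lemma local_end_lin (c : R) A B i :
  local_end (c *: A + B) i = c *: local_end A i + local_end B i.
Proof.
apply/funext => x; rewrite /local_end !fctE mulmxDr mulmxDl.
by rewrite -scalemxAr -scalemxAl.
Qed.

Lemma smooth_end_mul A B :
  smooth_end A -> smooth_end B -> smooth_end (fun p => A p *m B p).
Proof.
move=> sA sB i k.
have oU : open (chart_image i) by exact: coord_dom_open.
apply: Ck_ext (smooth_mulmx oU (sA i) (sB i) k) => // x /frame_unit Fu.
by rewrite /local_end !mulmxA mulmxK.
Qed.

Definition smooth_end_pred : {pred M -> 'M[R]_m} := fun A => `[< smooth_end A >].

Lemma smooth_end_submod : submod_closed smooth_end_pred.
Proof.
split=> [|c A B /asboolP sA /asboolP sB]; apply/asboolP=> i k.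
  have oU : open (chart_image i) by exact: coord_dom_open.
  apply: Ck_ext (Ck_cst k 0 oU) => // x _.
  by rewrite /local_end mulmx0 mul0mx.
by rewrite local_end_lin; apply: Ck_lin; [exact: coord_dom_open|exact: sA|exact: sB].
Qed.

HB.instance Definition _ :=
  GRing.isSubmodClosed.Build R (M -> 'M[R]_m) smooth_end_pred smooth_end_submod.

End Tensors.

(* The space Gamma(End TM) of smooth endomorphism fields. *)
Record endo (R : realType) (n : nat) (M : compactComplexManifold R n) := Endo {
  endo_val :> M -> 'M[R]_(n + n);
  _ : endo_val \in @smooth_end_pred R n M
}.

Section Endo.
Context {R : realType} {n : nat} (M : compactComplexManifold R n).
Local Notation m := (n + n)%N.
HB.instance Definition _ := [isSub for @endo_val R n M].
HB.instance Definition _ := [Choice of endo M by <:].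
HB.instance Definition _ := [SubChoice_isSubLmodule of endo M by <:].

Lemma endo_mul_subproof (A B : endo M) :
  (fun p => A p *m B p) \in @smooth_end_pred R n M.
Proof. by apply/asboolP/smooth_end_mul; apply/asboolP; [exact: (valP A)|exact: (valP B)]. Qed.

Definition endo_mul (A B : endo M) : endo M := Endo (endo_mul_subproof A B).

(* Sections B whose iterated derivatives along vs, in the chart i, are
   uniformly e-close on the compact set K to those of A. *)
Definition endo_ball (A : endo M) (i : chart M) (K : set 'cV[R]_m)
    (vs : seq 'cV[R]_m) (e : R) : set (endo M) :=
  [set B : endo M | forall x, K x ->
     `|iter_derive vs (local_end (B - A : endo M) i) x| < e].

Definition endo_subbase : set (set (endo M)) :=
  [set V | exists A i K vs e,
     [/\ compact K, K `<=` chart_image i & V = endo_ball A i K vs e]].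

(* The C^oo topology: uniform convergence of all derivatives on compact sets. *)
HB.instance Definition _ :=
  isSubBaseTopological.Build (endo M) endo_subbase id.
End Endo.

HB.saturate prod.

Section FrechetCalculus.
Context {R : realType}.

Definition has_dirderiv {E F : preTopologicalLmodType R}
    (f : E -> F) (x h : E) (l : F) : Prop :=
  (fun t : R => t^-1 *: (f (x + t *: h) - f x)) @ 0^' --> l.

(* Michal-Bastiani class C^k on the open set U: the differential (x, h) |->
   df(x; h) exists and is of class C^(k-1) on U * E, jointly in (x, h). *)
Fixpoint frechet_Ck (k : nat) {E F : preTopologicalLmodType R}
    (U : set E) (f : E -> F) : Prop :=
  (forall x, U x -> {for x, continuous f}) /\
  if k is k'.+1 then
    exists df : E * E -> F,
      (forall x h, U x -> has_dirderiv f x h (df (x, h))) /\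
      frechet_Ck k' (U `*` setT) df
  else True.

Definition frechet_smooth {E F : preTopologicalLmodType R}
    (U : set E) (f : E -> F) : Prop := forall k, frechet_Ck k U f.

End FrechetCalculus.

Section LinearCompatibility.
Context {R : realType} {m : nat}.
Implicit Types w J A : 'M[R]_m.

(* J^2 = -1, w(J., J.) = w and w(., J.) > 0. *)
Definition compatible_at w J : Prop :=
  [/\ J *m J = - 1%:M, J^T *m w *m J = w
    & forall u : 'cV[R]_m, u != 0 -> 0 < (u^T *m w *m J *m u) 0 0].

(* A J + J A = 0 and w(A., J.) is symmetric. *)
Definition tangent_at w J A : Prop :=
  A *m J + J *m A = 0 /\ (A^T *m w *m J)^T = A^T *m w *m J.

End LinearCompatibility.

Record compactKahlerManifold (R : realType) (n : nat) := CompactKahlerManifold {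
  complex_manifold :> compactComplexManifold R n;
  omega : complex_manifold -> 'M[R]_(n + n);
  omega_smooth : smooth_form omega;
  omega_skew : forall p, (omega p)^T = - omega p;
  omega_closed : closed_form omega;
  (* the charts being holomorphic, i acts on each T_pM as stdJ *)
  omega_kahler : forall p, compatible_at (omega p) stdJ
}.

Section Liouville.
Context {R : realType} {n : nat} (M : compactKahlerManifold R n).

(* Coefficient of the top-degree form w^n/n! in the coordinates of the chart i,
   i.e. its value on the frame (d/dx_1, d/dy_1, ..., d/dx_n, d/dy_n) which is
   positive for the complex orientation; the coordinates x_k, y_k have indices
   [lshift n k] and [rshift n k]. *)
Definition liouville_density (i : chart M) (x : 'cV[R]_(n + n)) : R :=
  (2 ^+ n * n`!%:R)^-1 * \sum_(s : 'S_(n + n)) (-1) ^+ s *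
    \prod_(k < n) local_form (@omega _ _ M) i x (s (lshift n k)) (s (rshift n k)).

(* mu is the Borel measure on M given by integration of w^n/n!. *)
Definition is_liouville
    (mu : {measure set (g_sigma_algebraType (@open M)) -> \bar R}) : Prop :=
  forall i (B : set M), (@open M).-sigma.-measurable B -> B `<=` @dom _ _ M i ->
    mu B = cV_integral (fun x =>
      (\1_(@coord _ _ M i @` B) x * liouville_density i x)%:E).

End Liouville.

(* The space of almost complex structures compatible with omega. *)
Definition acs (R : realType) (n : nat) (M : compactKahlerManifold R n) :=
  {J : endo M | forall p, compatible_at (omega p) (J p)}.

Section SpaceOfACS.
Context {R : realType} {n : nat} (M : compactKahlerManifold R n).
Implicit Types (J : acs M) (A B : endo M).

(* acs M as a submanifold of the Frechet space endo M: g is, near J, a smooth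
   extension of f to an open subset U of endo M. *)
Definition local_extension {F : preTopologicalLmodType R} (f : acs M -> F) J
    (U : set (endo M)) (g : endo M -> F) : Prop :=
  [/\ open U, U (sval J), frechet_smooth U g
    & forall J', U (sval J') -> g (sval J') = f J'].

Definition acs_smooth {F : preTopologicalLmodType R} (f : acs M -> F) : Prop :=
  forall J, exists U g, local_extension f J U g.

(* The differential of f at J applied to A; for f smooth and A tangent to acs M
   at J it does not depend on the extension. *)
Definition acs_diff {F : preTopologicalLmodType R} (f : acs M -> F) J A : F :=
  xget 0 [set l | exists U g,
    local_extension f J U g /\ has_dirderiv g (sval J) A l].

Definition tangent J A : Prop := forall p, tangent_at (omega p) (sval J p) (A p).

Definition field := acs M -> endo M.
Implicit Types X Y Z W : field.

Definition is_vfield X : Prop := acs_smooth X /\ forall J, tangent J (X J).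

Definition fieldJ X : field := fun J => endo_mul (sval J) (X J).

(* Derivative of the map f along X. *)
Definition along {F : preTopologicalLmodType R} X (f : acs M -> F) : acs M -> F :=
  fun J => acs_diff f J (X J).

Definition bracket X Y : field := fun J => along X Y J - along Y X J.

Variable mu : {measure set (g_sigma_algebraType (@open M)) -> \bar R}.

Definition metric A B : R := 2^-1 * \int[mu]_p \tr (A p *m B p).

Definition fieldG X Y : acs M -> R^o := fun J => metric (X J) (Y J).

Record levi_civita (nabla : field -> field -> field) : Prop := LeviCivita {
  nabla_field : forall X Y, is_vfield X -> is_vfield Y -> is_vfield (nabla X Y);
  nabla_linearl : forall (f : acs M -> R^o) X X' Y,
    acs_smooth f -> is_vfield X -> is_vfield X' -> is_vfield Y ->
    nabla (fun J => f J *: X J + X' J) Y =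
      (fun J => f J *: nabla X Y J + nabla X' Y J);
  nabla_addr : forall X Y Y', is_vfield X -> is_vfield Y -> is_vfield Y' ->
    nabla X (fun J => Y J + Y' J) = (fun J => nabla X Y J + nabla X Y' J);
  nabla_leibniz : forall (f : acs M -> R^o) X Y,
    acs_smooth f -> is_vfield X -> is_vfield Y ->
    nabla X (fun J => f J *: Y J) =
      (fun J => (along X f J : R) *: Y J + f J *: nabla X Y J);
  nabla_torsion_free : forall X Y, is_vfield X -> is_vfield Y ->
    (fun J => nabla X Y J - nabla Y X J) = bracket X Y;
  nabla_metric : forall X Y Z, is_vfield X -> is_vfield Y -> is_vfield Z ->
    along X (fieldG Y Z) =
      (fun J => fieldG (nabla X Y) Z J + fieldG Y (nabla X Z) J)
}.

Definition curvature (nabla : field -> field -> field) X Y Z : field :=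
  fun J => nabla X (nabla Y Z) J - nabla Y (nabla X Z) J
           - nabla (bracket X Y) Z J.

Definition complex_structure_parallel (nabla : field -> field -> field) : Prop :=
  forall X Y, is_vfield X -> is_vfield Y ->
    forall J, nabla X (fieldJ Y) J - fieldJ (nabla X Y) J = 0.

Definition curvature_parallel (nabla : field -> field -> field) : Prop :=
  forall W X Y Z, is_vfield W -> is_vfield X -> is_vfield Y -> is_vfield Z ->
    forall J,
      nabla W (curvature nabla X Y Z) J
      - curvature nabla (nabla W X) Y Z J
      - curvature nabla X (nabla W Y) Z J
      - curvature nabla X Y (nabla W Z) J = 0.

Definition kahler_form X Y : acs M -> R^o := fieldG (fieldJ X) Y.

Record formally_kahler : Prop := FormallyKahler {
  fk_fieldJ : forall X, is_vfield X -> is_vfield (fieldJ X);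
  fk_almost_complex : forall X, is_vfield X -> fieldJ (fieldJ X) = (fun J => - X J);
  fk_integrable : forall X Y, is_vfield X -> is_vfield Y ->
    forall J, bracket (fieldJ X) (fieldJ Y) J - fieldJ (bracket (fieldJ X) Y) J
              - fieldJ (bracket X (fieldJ Y)) J - bracket X Y J = 0;
  fk_smooth : forall X Y, is_vfield X -> is_vfield Y -> acs_smooth (fieldG X Y);
  fk_linear : forall J (c : R) A A' B, tangent J A -> tangent J A' -> tangent J B ->
    metric (c *: A + A') B = c * metric A B + metric A' B;
  fk_sym : forall J A B, tangent J A -> tangent J B -> metric A B = metric B A;
  fk_pos : forall J A, tangent J A -> A != 0 -> 0 < metric A A;
  fk_hermitian : forall J A B, tangent J A -> tangent J B ->
    metric (endo_mul (sval J) A) (endo_mul (sval J) B) = metric A B;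
  fk_closed : forall X Y Z, is_vfield X -> is_vfield Y -> is_vfield Z ->
    forall J, along X (kahler_form Y Z) J + along Y (kahler_form Z X) J
              + along Z (kahler_form X Y) J - kahler_form (bracket X Y) Z J
              - kahler_form (bracket Y Z) X J - kahler_form (bracket Z X) Y J = 0
}.

Definition formally_symmetric_kahler (nabla : field -> field -> field) : Prop :=
  formally_kahler /\ curvature_parallel nabla.

End SpaceOfACS.

(* Main.v *)
(** On maps [J |-> B J] with values in Gamma(End TM), the operator
    D_X B = dB(X) - [J X, B] / 2 is a derivation of the algebra, kills the
    tautological map [J |-> J] and preserves tangent fields.  As traces of
    commutators vanish it is a metric connection, and it is torsion-free because
    [J X, Y] = [J Y, X] when X and Y anticommute with J; by Koszul's argument it
    is the given Levi-Civita connection.  So the complex structure is parallel.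
    Symmetry of second derivatives gives R(X, Y) Z = - [[X, Y], Z] / 4, which is
    parallel since D_X is a derivation.

    The differential of a map on the space of compatible structures is well
    defined because every tangent vector A at J is the velocity of a curve of
    compatible structures, namely Q J Q^-1 = J + t A Q^-1 with
    Q = (1 + (1 - t B)^2) / 2 and B = - J A / 2.

    Koszul's argument needs the metric to be positive: tr (A^2) > 0 when A <> 0
    is selfadjoint for g_J, and the Liouville measure charges open sets because
    the Pfaffian of a form compatible with i is the determinant of a positive
    hermitian matrix. *)
From HB Require Import structures.
Require Import Defs.
From mathcomp Require Import all_boot all_order all_algebra.
From mathcomp Require Import finmap perm ssrAC spectral sesquilinear complex.
From mathcomp Require Import all_classical all_reals all_analysis.
From mathcomp Require Import measurable_realfun ring lra.
Set Implicit Arguments.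
Unset Strict Implicit.
Unset Printing Implicit Defensive.
Import Order.TTheory GRing.Theory Num.Theory.
Import numFieldNormedType.Exports.
Local Open Scope classical_set_scope.
Local Open Scope ring_scope.

(** * Uniform estimates on derivatives *)

Section MatrixNorm.
Context {R : realType}.

Lemma mxnorm_entry m k (A : 'M[R]_(m, k)) i j : `|A i j| <= `|A|.
Proof. by rewrite [leRHS]mx_normrE; apply/bigmax_geP; right => /=; exists (i, j). Qed.

Lemma mxnorm_le m k (A : 'M[R]_(m, k)) e :
  0 <= e -> (forall i j, `|A i j| <= e) -> `|A| <= e.
Proof.
by move=> e0 H; rewrite [leLHS]mx_normrE; apply/bigmax_leP; split=> // -[i j] _ /=.
Qed.

Lemma mxnorm_mul m (A B : 'M[R]_m) : `|A *m B| <= m%:R * (`|A| * `|B|).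
Proof.
apply: mxnorm_le => [|i j]; first by rewrite !mulr_ge0.
rewrite mxE (le_trans (ler_norm_sum _ _ _))//.
apply: (@le_trans _ _ (\sum_(k < m) `|A| * `|B|)).
  by apply: ler_sum => k _; rewrite normrM ler_pM ?mxnorm_entry.
by rewrite sumr_const card_ord mulr_natl.
Qed.

Lemma cV_closed_ball_compact m (x : 'cV[R]_m) (r : R) :
  compact [set y : 'cV[R]_m | forall i, `|y i 0 - x i 0| <= r].
Proof.
pose S := [set y : 'rV[R]_m | forall i, `[x i 0 - r, x i 0 + r]%classic (y 0 i)].
have cS : compact S.
  have H := @rV_compact R m (fun i => `[x i 0 - r, x i 0 + r]%classic).
  have := H (fun i => @segment_compact R (x i 0 - r) (x i 0 + r)).
  by [].
have ct : continuous (@trmx R 1 m).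
  move=> y A [P PA] PB.
  exists (fun i j => P j i) => [i j|z zP]; first by have := PA j i; rewrite mxE.
  by apply: PB => i j; have := zP j i; rewrite !mxE.
have -> : [set y : 'cV[R]_m | forall i, `|y i 0 - x i 0| <= r] = trmx @` S.
  apply/seteqP; split=> [y /= H|_ [y yS <-]] /=.
    exists y^T; last by rewrite trmxK.
    by move=> i; rewrite mxE /= in_itv /= -ler_distl.
  by move=> i; rewrite mxE; have := yS i; rewrite /= in_itv /= -ler_distl.
apply: continuous_compact => //.
exact: continuous_subspaceT.
Qed.

End MatrixNorm.

(* Families (F t) of maps V -> W indexed by t in a filter G, whose derivatives
   of order at most k are eventually bounded, respectively tend to 0, uniformly on K. *)
Section UniformFamilies.
Context {R : realType} {V W : normedModType R} {T : Type}.
Variables (G : set_system T) (K : set V).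
Implicit Types F : T -> V -> W.

Fixpoint bdd_on k F : Prop :=
  (exists C, \forall t \near G, forall x, K x -> `|F t x| <= C) /\
  if k is k'.+1 then forall v, bdd_on k' (fun t => 'D_v (F t)) else True.

Fixpoint null_on k F : Prop :=
  (forall e, 0 < e -> \forall t \near G, forall x, K x -> `|F t x| < e) /\
  if k is k'.+1 then forall v, null_on k' (fun t => 'D_v (F t)) else True.

End UniformFamilies.

Section UniformFamiliesTheory.
Context {R : realType} {V : normedModType R} {T : Type}.
Variables (G : set_system T) (K U : set V).
Hypotheses (FG : Filter G) (oU : open U) (KU : K `<=` U).

Lemma bdd_onW (W : normedModType R) k (F : T -> V -> W) :
  bdd_on G K k.+1 F -> bdd_on G K k F.
Proof.
elim: k F => [|k IH] F [H1 H2]; split=> // v; apply: IH; exact: H2.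
Qed.

Lemma null_onW (W : normedModType R) k (F : T -> V -> W) :
  null_on G K k.+1 F -> null_on G K k F.
Proof.
elim: k F => [|k IH] F [H1 H2]; split=> // v; apply: IH; exact: H2.
Qed.

Lemma null_bdd_on (W : normedModType R) k (F : T -> V -> W) :
  null_on G K k F -> bdd_on G K k F.
Proof.
elim: k F => [|k IH] F [H1 H2]; split.
- by exists 1; apply: filterS (H1 1 ltr01) => t H x /H /ltW.
- by [].
- by exists 1; apply: filterS (H1 1 ltr01) => t H x /H /ltW.
- by move=> v; apply: IH; exact: H2.
Qed.

Lemma derive_ext (W : normedModType R) (f g : V -> W) v :
  (forall x, U x -> f x = g x) -> forall x, U x -> 'D_v f x = 'D_v g x.
Proof.
move=> fg x Ux; apply: near_eq_derive.
by apply: filterS (open_nbhs_nbhs (conj oU Ux)) => y /fg.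
Qed.

Lemma bdd_on_ext (W : normedModType R) k (F F' : T -> V -> W) :
  (forall t x, U x -> F t x = F' t x) -> bdd_on G K k F -> bdd_on G K k F'.
Proof.
elim: k F F' => [|k IH] F F' FF' [[C HC] H2]; split=> //.
- by exists C; apply: filterS HC => t H x Kx; rewrite -FF'; [exact: H|exact: KU].
- by exists C; apply: filterS HC => t H x Kx; rewrite -FF'; [exact: H|exact: KU].
- move=> v; apply: IH (H2 v) => t x Ux; exact: derive_ext (FF' t) _ Ux.
Qed.

Lemma null_on_ext (W : normedModType R) k (F F' : T -> V -> W) :
  (forall t x, U x -> F t x = F' t x) -> null_on G K k F -> null_on G K k F'.
Proof.
elim: k F F' => [|k IH] F F' FF' [HC H2]; split=> //.
- move=> e /HC; apply: filterS => t H x Kx; rewrite -FF'; [exact: H|exact: KU].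
- move=> e /HC; apply: filterS => t H x Kx; rewrite -FF'; [exact: H|exact: KU].
- move=> v; apply: IH (H2 v) => t x Ux; exact: derive_ext (FF' t) _ Ux.
Qed.

Lemma derive_add (W : normedModType R) (f g : V -> W) v x :
  differentiable f x -> differentiable g x ->
  'D_v (fun y => f y + g y) x = 'D_v f x + 'D_v g x.
Proof. by move=> df dg; rewrite -deriveD //; exact: diff_derivable. Qed.

Lemma derive_scale (W : normedModType R) (f : V -> W) (c : R) v x :
  differentiable f x -> 'D_v (fun y => c *: f y) x = c *: 'D_v f x.
Proof. by move=> df; rewrite -deriveZ //; exact: diff_derivable. Qed.

Lemma bdd_on_add (W : normedModType R) k (F F' : T -> V -> W) :
  (forall t, smooth U (F t)) -> (forall t, smooth U (F' t)) ->
  bdd_on G K k F -> bdd_on G K k F' -> bdd_on G K k (fun t x => F t x + F' t x).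
Proof.
elim: k F F' => [|k IH] F F' sF sF' [[C HC] H2] [[C' HC'] H2'].
  split=> //; exists (C + C'); apply: filterS2 HC HC' => t H H' x Kx.
  by rewrite (le_trans (ler_normD _ _)) // lerD ?H ?H'.
split.
  exists (C + C'); apply: filterS2 HC HC' => t H H' x Kx.
  by rewrite (le_trans (ler_normD _ _)) // lerD ?H ?H'.
move=> v; apply: bdd_on_ext (IH _ _ _ _ (H2 v) (H2' v)).
- by move=> t x Ux; rewrite derive_add //; [exact: (sF t 1).1|exact: (sF' t 1).1].
- by move=> t; apply: smooth_derive.
- by move=> t; apply: smooth_derive.
Qed.

Lemma null_on_add (W : normedModType R) k (F F' : T -> V -> W) :
  (forall t, smooth U (F t)) -> (forall t, smooth U (F' t)) ->
  null_on G K k F -> null_on G K k F' -> null_on G K k (fun t x => F t x + F' t x).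
Proof.
elim: k F F' => [|k IH] F F' sF sF' [HC H2] [HC' H2'].
  split=> // e e0; have e2 : 0 < e / 2 by rewrite divr_gt0.
  apply: filterS2 (HC _ e2) (HC' _ e2) => t H H' x Kx.
  by rewrite (le_lt_trans (ler_normD _ _)) // [ltRHS]splitr ltrD ?H ?H'.
split.
  move=> e e0; have e2 : 0 < e / 2 by rewrite divr_gt0.
  apply: filterS2 (HC _ e2) (HC' _ e2) => t H H' x Kx.
  by rewrite (le_lt_trans (ler_normD _ _)) // [ltRHS]splitr ltrD ?H ?H'.
move=> v; apply: null_on_ext (IH _ _ _ _ (H2 v) (H2' v)).
- by move=> t x Ux; rewrite derive_add //; [exact: (sF t 1).1|exact: (sF' t 1).1].
- by move=> t; apply: smooth_derive.
- by move=> t; apply: smooth_derive.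
Qed.

Lemma bdd_on_scale (W : normedModType R) k (c : R) (F : T -> V -> W) :
  (forall t, smooth U (F t)) ->
  bdd_on G K k F -> bdd_on G K k (fun t x => c *: F t x).
Proof.
have HC0 (F' : T -> V -> W) C : (\forall t \near G, forall x, K x -> `|F' t x| <= C) ->
    exists C', \forall t \near G, forall x, K x -> `|c *: F' t x| <= C'.
  move=> HC; exists (`|c| * C); apply: filterS HC => t H x Kx.
  by rewrite normrZ ler_wpM2l ?H.
elim: k F => [|k IH] F sF [[C HC] H2]; split=> //; try exact: HC0 HC.
move=> v; apply: bdd_on_ext (IH _ _ (H2 v)).
- by move=> t x Ux; rewrite derive_scale //; exact: (sF t 1).1.
- by move=> t; apply: smooth_derive.
Qed.

Lemma null_on_scale (W : normedModType R) k (c : T -> R) (F : T -> V -> W) :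
  (forall t, smooth U (F t)) -> c @ G --> (0 : R) ->
  bdd_on G K k F -> null_on G K k (fun t x => c t *: F t x).
Proof.
move=> + c0.
have HC0 (F' : T -> V -> W) C : (\forall t \near G, forall x, K x -> `|F' t x| <= C) ->
    forall e, 0 < e -> \forall t \near G, forall x, K x -> `|c t *: F' t x| < e.
  move=> HC e e0; have C1 : 0 < `|C| + 1 by rewrite ltr_wpDl.
  have ce : 0 < e / (`|C| + 1) by rewrite divr_gt0.
  have Hc : \forall t \near G, `|c t| < e / (`|C| + 1).
    by have /cvgr0Pnorm_lt := c0; apply.
  apply: filterS2 HC Hc => t H ct x Kx; rewrite normrZ.
  move: ct; rewrite ltr_pdivlMr //; apply: le_lt_trans.
  by rewrite ler_wpM2l // (le_trans (H x Kx)) // (le_trans (ler_norm _)) // lerDl.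
elim: k F => [|k IH] F sF [[C HC] H2]; split=> //; try exact: HC0 HC.
move=> v; apply: null_on_ext (IH _ _ (H2 v)).
- by move=> t x Ux; rewrite derive_scale //; exact: (sF t 1).1.
- by move=> t; apply: smooth_derive.
Qed.

Lemma bdd_on_mul m k (A B : T -> V -> 'M[R]_m) :
  (forall t, smooth U (A t)) -> (forall t, smooth U (B t)) ->
  bdd_on G K k A -> bdd_on G K k B -> bdd_on G K k (fun t x => A t x *m B t x).
Proof.
have HC0 (A' B' : T -> V -> 'M[R]_m) C C' :
    (\forall t \near G, forall x, K x -> `|A' t x| <= C) ->
    (\forall t \near G, forall x, K x -> `|B' t x| <= C') ->
    exists C, \forall t \near G, forall x, K x -> `|A' t x *m B' t x| <= C.
  move=> HA HB; exists (m%:R * (C * C')); apply: filterS2 HA HB => t H H' x Kx.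
  by rewrite (le_trans (mxnorm_mul _ _)) // ler_wpM2l // ler_pM ?H ?H'.
elim: k A B => [|k IH] A B sA sB [[C HC] H2] [[C' HC'] H2'].
  by split=> //; exact: HC0 HC HC'.
split; first exact: HC0 HC HC'.
move=> v.
have AB' : bdd_on G K k.+1 A by split => //; exists C.
have BB' : bdd_on G K k.+1 B by split => //; exists C'.
have := bdd_on_add (k := k) (F := fun t x => A t x *m 'D_v (B t) x)
  (F' := fun t x => 'D_v (A t) x *m B t x).
move=> H; apply: bdd_on_ext (H _ _ _ _).
- move=> t x Ux.
  by rewrite (differentiable_mulmx ((sA t 1).1 x Ux) ((sB t 1).1 x Ux)).2.
- by move=> t; apply: smooth_mulmx => //; exact: smooth_derive.
- by move=> t; apply: smooth_mulmx => //; exact: smooth_derive.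
- exact: IH sA (fun t => smooth_derive v (sB t)) (bdd_onW AB') (H2' v).
- exact: IH (fun t => smooth_derive v (sA t)) sB (H2 v) (bdd_onW BB').
Qed.

Lemma null_on_mull m k (A B : T -> V -> 'M[R]_m) :
  (forall t, smooth U (A t)) -> (forall t, smooth U (B t)) ->
  bdd_on G K k A -> null_on G K k B -> null_on G K k (fun t x => A t x *m B t x).
Proof.
have HC0 (A' B' : T -> V -> 'M[R]_m) C :
    (\forall t \near G, forall x, K x -> `|A' t x| <= C) ->
    (forall e, 0 < e -> \forall t \near G, forall x, K x -> `|B' t x| < e) ->
    forall e, 0 < e -> \forall t \near G, forall x, K x -> `|A' t x *m B' t x| < e.
  move=> HA HB e e0.
  have C1 : 0 < m%:R * `|C| + 1 by rewrite ltr_wpDl // mulr_ge0.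
  apply: filterS2 HA (HB (e / (m%:R * `|C| + 1)) _) => [t H H' x Kx|]; last first.
    by rewrite divr_gt0.
  have := H' x Kx; rewrite ltr_pdivlMr //; apply: le_lt_trans.
  rewrite (le_trans (mxnorm_mul _ _)) // mulrDr mulr1 ler_wpDr //.
  by rewrite mulrA [leRHS]mulrC ler_wpM2r // ler_wpM2l // (le_trans (H x Kx)) ?ler_norm.
elim: k A B => [|k IH] A B sA sB [[C HC] H2] [HC' H2'].
  by split=> //; exact: HC0 HC HC'.
split; first exact: HC0 HC HC'.
move=> v.
have AB' : bdd_on G K k.+1 A by split => //; exists C.
have BB' : null_on G K k.+1 B by [].
have := null_on_add (k := k) (F := fun t x => A t x *m 'D_v (B t) x)
  (F' := fun t x => 'D_v (A t) x *m B t x).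
move=> H; apply: null_on_ext (H _ _ _ _).
- move=> t x Ux.
  by rewrite (differentiable_mulmx ((sA t 1).1 x Ux) ((sB t 1).1 x Ux)).2.
- by move=> t; apply: smooth_mulmx => //; exact: smooth_derive.
- by move=> t; apply: smooth_mulmx => //; exact: smooth_derive.
- exact: IH sA (fun t => smooth_derive v (sB t)) (bdd_onW AB') (H2' v).
- exact: IH (fun t => smooth_derive v (sA t)) sB (H2 v) (null_onW BB').
Qed.

Lemma null_on_mulr m k (A B : T -> V -> 'M[R]_m) :
  (forall t, smooth U (A t)) -> (forall t, smooth U (B t)) ->
  null_on G K k A -> bdd_on G K k B -> null_on G K k (fun t x => A t x *m B t x).
Proof.
have HC0 (A' B' : T -> V -> 'M[R]_m) C :
    (\forall t \near G, forall x, K x -> `|B' t x| <= C) ->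
    (forall e, 0 < e -> \forall t \near G, forall x, K x -> `|A' t x| < e) ->
    forall e, 0 < e -> \forall t \near G, forall x, K x -> `|A' t x *m B' t x| < e.
  move=> HA HB e e0.
  have C1 : 0 < m%:R * `|C| + 1 by rewrite ltr_wpDl // mulr_ge0.
  apply: filterS2 HA (HB (e / (m%:R * `|C| + 1)) _) => [t H H' x Kx|]; last first.
    by rewrite divr_gt0.
  have := H' x Kx; rewrite ltr_pdivlMr //; apply: le_lt_trans.
  rewrite (le_trans (mxnorm_mul _ _)) // mulrDr mulr1 ler_wpDr //.
  by rewrite mulrCA ler_wpM2l // ler_wpM2l // (le_trans (H x Kx)) ?ler_norm.
elim: k A B => [|k IH] A B sA sB [HC H2] [[C HC'] H2'].
  by split=> //; exact: HC0 HC' HC.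
split; first exact: HC0 HC' HC.
move=> v.
have AB' : null_on G K k.+1 A by [].
have BB' : bdd_on G K k.+1 B by split => //; exists C.
have := null_on_add (k := k) (F := fun t x => A t x *m 'D_v (B t) x)
  (F' := fun t x => 'D_v (A t) x *m B t x).
move=> H; apply: null_on_ext (H _ _ _ _).
- move=> t x Ux.
  by rewrite (differentiable_mulmx ((sA t 1).1 x Ux) ((sB t 1).1 x Ux)).2.
- by move=> t; apply: smooth_mulmx => //; exact: smooth_derive.
- by move=> t; apply: smooth_mulmx => //; exact: smooth_derive.
- exact: IH sA (fun t => smooth_derive v (sB t)) (null_onW AB') (H2' v).
- exact: IH (fun t => smooth_derive v (sA t)) sB (H2 v) (bdd_onW BB').
Qed.

End UniformFamiliesTheory.

Lemma cvg_near {T} {U : nbhsType} (G : set_system T) (f : T -> U) (l : U) (P : set U) :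
  f @ G --> l -> nbhs l P -> \forall t \near G, P (f t).
Proof. by move=> fl lP; exact: fl. Qed.

Lemma for_continuous_norm {R : realType} {T : topologicalType} {W : normedModType R}
  (f : T -> W) x : {for x, continuous f} -> {for x, continuous (fun y => `|f y|)}.
Proof. by move=> cf; apply: cvg_norm; exact: cf. Qed.

(** * The topology of Gamma(End TM) *)

Section EndoTopology.
Context {R : realType} {n : nat} {M : compactComplexManifold R n}.
Local Notation m := (n + n)%N.
Implicit Types (A B : endo M) (i : chart M) (K : set 'cV[R]_m).

Lemma endo_valD A B p : (A + B : endo M) p = A p + B p.
Proof. by []. Qed.

Lemma endo_valN A p : (- A : endo M) p = - A p.
Proof. by []. Qed.

Lemma endo_valB A B p : (A - B : endo M) p = A p - B p.
Proof. by []. Qed.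

Lemma endo_valZ (c : R) A p : (c *: A : endo M) p = c *: A p.
Proof. by []. Qed.

Lemma endo_val0 p : (0 : endo M) p = 0.
Proof. by []. Qed.

Lemma endo_mulE A B p : endo_mul A B p = A p *m B p.
Proof. by []. Qed.

Lemma endo_eqP A B : (forall p, A p = B p) -> A = B.
Proof. by move=> AB; apply/val_inj/funext => p; exact: AB. Qed.

Lemma smooth_local_end A i : smooth (chart_image i) (local_end A i).
Proof. by have /asboolP := valP A; exact. Qed.

Lemma chart_image_open i : open (chart_image i).
Proof. exact: coord_dom_open. Qed.

Lemma local_endD A B i x : local_end (A + B : endo M) i x = local_end A i x + local_end B i x.
Proof. by rewrite /local_end endo_valD mulmxDr mulmxDl. Qed.

Lemma local_endZ (c : R) A i x : local_end (c *: A : endo M) i x = c *: local_end A i x.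
Proof. by rewrite /local_end endo_valZ -scalemxAr -scalemxAl. Qed.

Lemma local_endN A i x : local_end (- A : endo M) i x = - local_end A i x.
Proof. by rewrite -scaleN1r local_endZ scaleN1r. Qed.

Lemma local_endB A B i x : local_end (A - B : endo M) i x = local_end A i x - local_end B i x.
Proof. by rewrite local_endD local_endN. Qed.

Lemma local_endM A B i x : chart_image i x ->
  local_end (endo_mul A B) i x = local_end A i x *m local_end B i x.
Proof. by move=> /frame_unit Fu; rewrite /local_end endo_mulE !mulmxA mulmxK. Qed.

Lemma smooth_iter_derive (V W : normedModType R) (U : set V) (f : V -> W) vs :
  smooth U f -> smooth U (iter_derive vs f).
Proof. by move=> sf; elim: vs => //= v vs IH; exact: smooth_derive. Qed.

Lemma iter_derive_ext (V W : normedModType R) (U : set V) (f g : V -> W) vs :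
  open U -> (forall x, U x -> f x = g x) ->
  forall x, U x -> iter_derive vs f x = iter_derive vs g x.
Proof.
move=> oU fg; elim: vs => //= v vs IH x Ux; exact: (derive_ext oU v IH Ux).
Qed.

Lemma iter_deriveD (V W : normedModType R) (U : set V) (f g h : V -> W) vs :
  open U -> smooth U g -> smooth U h -> (forall x, U x -> f x = g x + h x) ->
  forall x, U x -> iter_derive vs f x = iter_derive vs g x + iter_derive vs h x.
Proof.
move=> oU sg sh fE; elim: vs => //= v vs IH x Ux.
rewrite (derive_ext oU v IH Ux) -derive_add //.
  exact: (smooth_iter_derive vs sg 1).1.
exact: (smooth_iter_derive vs sh 1).1.
Qed.

Lemma iter_derive_normD (V W : normedModType R) (U : set V) (f g h : V -> W) vs :
  open U -> smooth U g -> smooth U h -> (forall x, U x -> f x = g x + h x) ->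
  forall x, U x -> `|iter_derive vs f x| <= `|iter_derive vs h x| + `|iter_derive vs g x|.
Proof.
by move=> oU sg sh E x Ux; rewrite (iter_deriveD vs oU sg sh E Ux) addrC ler_normD.
Qed.

Lemma smooth_continuous (V W : normedModType R) (U : set V) (f : V -> W) x :
  smooth U f -> U x -> {for x, continuous f}.
Proof. by move=> sf Ux; exact: (sf 0). Qed.

Lemma null_on_iterP (V W : normedModType R) T (G : set_system T) (K : set V)
    (F : T -> V -> W) : Filter G ->
  (forall k, null_on G K k F) <->
  forall vs e, 0 < e -> \forall t \near G, forall x, K x -> `|iter_derive vs (F t) x| < e.
Proof.
move=> FG; split=> [H vs|H k].
  elim/last_ind: vs F H => [|vs v IH] F H; first exact: (H 0).1.
  have /IH Hv k : null_on G K k (fun t => 'D_v (F t)) by have := (H k.+1).2 v.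
  move=> e e0; apply: filterS (Hv e e0) => t Ht x Kx.
  by rewrite /iter_derive foldr_rcons; exact: Ht.
elim: k F H => [|k IH] F H; split=> //; try exact: (H [::]).
move=> v; apply: IH => vs e e0; apply: filterS (H (rcons vs v) e e0) => t Ht x Kx.
by have := Ht x Kx; rewrite /iter_derive foldr_rcons.
Qed.

Lemma compact_lt_bound (V : topologicalType) (K : set V) (f : V -> R) e :
  compact K -> (forall x, K x -> {for x, continuous f}) ->
  (forall x, K x -> f x < e) -> exists2 d, 0 < d & forall x, K x -> f x + d < e.
Proof.
move=> cK cf fe; have [[x0 Kx0]|K0] := pselect (K !=set0); last first.
  by exists 1 => // x Kx; exfalso; apply: K0; exists x.
have [||c /set_mem Kc Hc] := @compact_EVT_max _ _ f K _ cK _.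
- by exists x0.
- by apply: continuous_in_subspaceT => x /set_mem Kx; exact: cf.
have fce := fe c Kc.
exists ((e - f c) / 2) => [|x Kx]; first by rewrite divr_gt0 // subr_gt0.
apply: (@le_lt_trans _ _ (f c + (e - f c) / 2)); last first.
  by rewrite -ltrBrDl [ltRHS]splitr ltrDl divr_gt0 // subr_gt0.
by rewrite lerD2r Hc // inE.
Qed.

Lemma endo_cvgP T (G : set_system T) (F : T -> endo M) A : Filter G ->
  F @ G --> A <-> forall i K, compact K -> K `<=` chart_image i ->
    forall k, null_on G K k (fun t => local_end (F t - A : endo M) i).
Proof.
move=> FG; split=> [FA i K cK Ki|H].
  apply/null_on_iterP => vs e e0.
  suff nA : nbhs A (endo_ball A i K vs e).
    by apply: filterS (cvg_near FA nA) => t Ht x Kx; exact: (Ht x Kx).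
  apply: open_nbhs_nbhs; split.
    exists [set endo_ball A i K vs e]; last by rewrite bigcup_set1.
    move=> _ ->; exists [fset endo_ball A i K vs e]%fset.
      by move=> S; rewrite inE inE => /eqP ->; exists A, i, K, vs, e.
    by rewrite set_fset1 bigcap_set1.
  move=> x Kx /=; rewrite (iter_derive_ext (g := cst 0) _ (@chart_image_open i)).
  - suff -> : iter_derive vs (cst 0 : 'cV[R]_m -> 'M[R]_m) = cst 0 by rewrite normr0.
    by elim: (vs) => //= v ws ->; apply/funext => y; rewrite derive_cst.
  - by move=> y _; rewrite local_endB subrr.
  - exact: Ki.
move=> P; rewrite nbhsE => -[Q [[D DS <-] [C DC CA]] DP].
apply: (filterS DP); apply: (@filterS _ _ _ C); first by move=> B CB; exists C.
have /DS[E ES EC] := DC; rewrite -EC; apply: filter_bigI => S SE.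
have /ES := SE; rewrite inE => -[A' [i [K [vs [e [cK Ki SEq]]]]]].
have SA : endo_ball A' i K vs e A.
  by rewrite -SEq; move: CA; rewrite -EC; apply.
rewrite SEq.
pose f x := `|iter_derive vs (local_end (A - A' : endo M) i) x|.
have [|d d0 Hd] := @compact_lt_bound _ K f e cK _ SA.
  move=> x Kx; 
  apply: for_continuous_norm.
  exact: (smooth_continuous (smooth_iter_derive vs (@smooth_local_end (A - A') i)) (Ki x Kx)).
have /null_on_iterP/(_ vs d d0) := H i K cK Ki.
move=> Hn; suff key : \forall t \near G, endo_ball A' i K vs e (F t) by exact: key.
apply: filterS Hn => t Ht; rewrite /endo_ball /mkset => x Kx.
apply: le_lt_trans (Hd x Kx); rewrite /f.
have E1 : forall x, chart_image i x -> local_end (F t - A' : endo M) i x =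
    local_end (F t - A : endo M) i x + local_end (A - A' : endo M) i x.
  by move=> y _; rewrite !local_endB addrA subrK.
have E2 := iter_derive_normD vs (@chart_image_open i) (smooth_local_end _ i)
  (smooth_local_end _ i) E1 (Ki x Kx).
by apply: (le_trans E2); apply: lerD; [exact: lexx|exact/ltW/(Ht x Kx)].
Qed.

Lemma bdd_on_cst T (G : set_system T) (K U : set 'cV[R]_m) k (f : 'cV[R]_m -> 'M[R]_m) :
  Filter G -> compact K -> K `<=` U -> smooth U f -> bdd_on G K k (fun _ : T => f).
Proof.
move=> FG cK KU.
have H0 (g : 'cV[R]_m -> 'M[R]_m) : smooth U g ->
    exists C, \forall t \near G, forall x, K x -> `|(fun _ : T => g) t x| <= C.
  move=> sg; have [->|/set0P K0] := eqVneq K set0; first by exists 0; near=> t.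
  have [c _ Hc] : exists2 c, c \in K & forall x, x \in K -> `|g x| <= `|g c|.
    apply: compact_EVT_max => //; apply: continuous_in_subspaceT => x /set_mem Kx.
    by apply: for_continuous_norm; exact: smooth_continuous (KU x Kx).
  by exists `|g c|; near=> t => x Kx; apply: Hc; exact: mem_set.
elim: k f => [|k IH] f sf; split=> //; try exact: H0.
by move=> v; apply: IH; exact: smooth_derive.
Unshelve. all: by end_near. Qed.

Lemma endo_cvg_bdd T (G : set_system T) (F : T -> endo M) A i K k : Filter G ->
  F @ G --> A -> compact K -> K `<=` chart_image i ->
  bdd_on G K k (fun t => local_end (F t) i).
Proof.
move=> FG /endo_cvgP FA cK Ki.
have H := null_bdd_on FG (FA i K cK Ki k).
have := bdd_on_add FG (@chart_image_open i) Ki _ _ H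
  (bdd_on_cst k FG cK Ki (smooth_local_end A i)).
move=> H'; apply: (bdd_on_ext FG (@chart_image_open i) Ki _ (H' _ _)) => //.
- by move=> t x _; rewrite local_endB subrK.
- by move=> t; exact: smooth_local_end.
- by move=> t; exact: smooth_local_end.
Qed.

Lemma endo_cvgD T (G : set_system T) (F F' : T -> endo M) A A' : Filter G ->
  F @ G --> A -> F' @ G --> A' -> (fun t => F t + F' t) @ G --> A + A'.
Proof.
move=> FG /endo_cvgP FA /endo_cvgP FA'; apply/endo_cvgP => i K cK Ki k.
have := null_on_add FG (@chart_image_open i) Ki _ _ (FA i K cK Ki k) (FA' i K cK Ki k).
move=> H; apply: (null_on_ext FG (@chart_image_open i) Ki _ (H _ _)) => //.
- by move=> t x _; rewrite -local_endD opprD addrACA.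
- by move=> t; exact: smooth_local_end.
- by move=> t; exact: smooth_local_end.
Qed.

Lemma endo_cvgM T (G : set_system T) (F F' : T -> endo M) A A' : Filter G ->
  F @ G --> A -> F' @ G --> A' ->
  (fun t => endo_mul (F t) (F' t)) @ G --> endo_mul A A'.
Proof.
move=> FG cF cF'; apply/endo_cvgP => i K cK Ki k.
have sl (B C : endo M) : smooth (chart_image i) (fun x => local_end B i x *m local_end C i x).
  exact: (smooth_mulmx (@chart_image_open i) (smooth_local_end B i) (smooth_local_end C i)).
have H1 := null_on_mulr FG (@chart_image_open i) Ki
  (fun t => smooth_local_end (F t - A) i) (fun t => smooth_local_end (F' t) i)
  ((endo_cvgP _ _ FG).1 cF i K cK Ki k) (endo_cvg_bdd k FG cF' cK Ki).
have H2 := null_on_mull FG (@chart_image_open i) Ki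
  (fun t => smooth_local_end A i) (fun t => smooth_local_end (F' t - A') i)
  (bdd_on_cst k FG cK Ki (smooth_local_end A i)) ((endo_cvgP _ _ FG).1 cF' i K cK Ki k).
have := null_on_add FG (@chart_image_open i) Ki _ _ H1 H2.
move=> H; apply: (null_on_ext FG (@chart_image_open i) Ki _ (H (fun=> sl _ _) (fun=> sl _ _))).
move=> t x ix; rewrite -!local_endM // -local_endD; congr (_ _ i x); apply/funext => p.
by rewrite !(endo_valD, endo_valN, endo_mulE) mulmxBl mulmxBr addrA subrK.
Qed.

Lemma endo_one_subproof : (fun _ : M => 1%:M : 'M[R]_m) \in @smooth_end_pred R n M.
Proof.
apply/asboolP => i k; have oU := @chart_image_open i.
apply: Ck_ext (Ck_cst k 1%:M oU) => // x /frame_unit Fu.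
by rewrite /local_end mulmx1 mulVmx.
Qed.

Definition endo_one : endo M := Endo endo_one_subproof.

Lemma endo_cvgZ T (G : set_system T) (c : T -> R) (l : R) (F : T -> endo M) A : Filter G ->
  c @ G --> l -> F @ G --> A -> (fun t => c t *: F t) @ G --> l *: A.
Proof.
move=> FG cc cF.
have E (a : R) B : a *: B = endo_mul (a *: endo_one) B.
  by apply: endo_eqP => p; rewrite endo_mulE !endo_valZ -scalemxAl mul1mx.
rewrite E; under eq_fun do rewrite E.
apply: endo_cvgM => //; apply/endo_cvgP => i K cK Ki k.
have c0 : (fun t => c t - l) @ G --> (0 : R).
  by rewrite -(subrr l); apply: cvgB => //; exact: cvg_cst.
have := null_on_scale FG (@chart_image_open i) Ki
  (fun _ => smooth_local_end endo_one i) c0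
  (bdd_on_cst k FG cK Ki (smooth_local_end endo_one i)).
apply: (null_on_ext FG (@chart_image_open i) Ki).
by move=> t x ix; rewrite -!local_endZ scalerBl.
Qed.

End EndoTopology.

(** * Differential calculus in Frechet spaces *)

Section FrechetCalculusTheory.
Context {R : realType}.
Implicit Types E F : preTopologicalLmodType R.

Definition topological_lmod E : Prop :=
  (forall T (G : set_system T) (f g : T -> E) (a b : E), Filter G ->
     f @ G --> a -> g @ G --> b -> (fun t => f t + g t) @ G --> a + b) /\
  (forall T (G : set_system T) (c : T -> R) (f : T -> E) (l : R) (a : E), Filter G ->
     c @ G --> l -> f @ G --> a -> (fun t => c t *: f t) @ G --> l *: a).

Definition curve_deriv F (c : R -> F) (s : R) (l : F) :=
  (fun r => r^-1 *: (c (s + r) - c s)) @ 0^' --> l.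

(* What local convexity is used for: a curve whose velocity stays close to l
   has its increment close to l. *)
Definition mean_value_space F : Prop := forall (l : F) V, nbhs l V ->
  exists2 V', nbhs l V' & forall c c' : R -> F,
    (forall s, 0 <= s <= 1 -> curve_deriv c s (c' s)) ->
    (forall s, 0 <= s <= 1 -> V' (c' s)) -> V (c 1 - c 0).

Definition lin_cts E F (L : E -> F) : Prop :=
  (forall (c : R) x y, L (c *: x + y) = c *: L x + L y) /\
  (forall T (G : set_system T) (f : T -> E) (a : E), Filter G ->
     f @ G --> a -> (fun t => L (f t)) @ G --> L a).

Definition bilin_cts E F (H : preTopologicalLmodType R) (b : E -> F -> H) : Prop :=
  [/\ (forall (c : R) x y z, b (c *: x + y) z = c *: b x z + b y z),
      (forall (c : R) x y z, b z (c *: x + y) = c *: b z x + b z y)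
    & (forall T (G : set_system T) (f : T -> E) (g : T -> F) (x : E) (y : F), Filter G ->
     f @ G --> x -> g @ G --> y -> (fun t => b (f t) (g t)) @ G --> b x y)].

Lemma cvg_fun_ext T (U : topologicalType) (G : set_system T) (f g : T -> U) (l : U) : Filter G ->
  (\forall t \near G, f t = g t) -> f @ G --> l -> g @ G --> l.
Proof. by move=> FG fg; apply: cvg_trans; apply: near_eq_cvg. Qed.

Lemma cvg_constant T (U : topologicalType) (G : set_system T) (a : U) :
  Filter G -> (fun _ : T => a) @ G --> a.
Proof. by move=> FG; exact: cvg_cst. Qed.
Arguments cvg_constant {T U G} a FG.

Lemma cvg_pair_fst T (U V : topologicalType) (G : set_system T) (f : T -> U * V) (l : U * V) :
  Filter G -> f @ G --> l -> (fun t => (f t).1) @ G --> l.1.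
Proof. by case: l => a b FG fl; apply: (cvg_comp _ _ fl); exact: cvg_fst. Qed.

Lemma cvg_pair_snd T (U V : topologicalType) (G : set_system T) (f : T -> U * V) (l : U * V) :
  Filter G -> f @ G --> l -> (fun t => (f t).2) @ G --> l.2.
Proof. by case: l => a b FG fl; apply: (cvg_comp _ _ fl); exact: cvg_snd. Qed.

Lemma cvg_pairP T (U V : topologicalType) (G : set_system T) (f : T -> U) (g : T -> V) (a : U) (b : V) :
  Filter G -> f @ G --> a -> g @ G --> b -> (fun t => (f t, g t)) @ G --> (a, b).
Proof. by move=> FG fa gb; exact: cvg_pair. Qed.

Lemma topological_lmod_prod E F :
  topological_lmod E -> topological_lmod F -> topological_lmod (E * F)%type.
Proof.
move=> [DE ZE] [DF ZF]; split=> [T G f g [a1 a2] [b1 b2] FG fa gb|T G c f l [a1 a2] FG cl fa].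
  apply: cvg_pairP.
    by apply: DE; [exact: (cvg_pair_fst FG fa)|exact: (cvg_pair_fst FG gb)].
  by apply: DF; [exact: (cvg_pair_snd FG fa)|exact: (cvg_pair_snd FG gb)].
apply: cvg_pairP.
  by apply: ZE => //; exact: (cvg_pair_fst FG fa).
by apply: ZF => //; exact: (cvg_pair_snd FG fa).
Qed.

Lemma cvg_dnbhs T (U : topologicalType) (G : set_system T) (f : T -> U) (l : U) : Filter G ->
  f @ G --> l -> (\forall t \near G, f t != l) -> f @ G --> l^'.
Proof.
move=> FG fl fn A /= Al.
have H : \forall t \near G, f t != l -> A (f t).
  exact: (@cvg_near T U G f l (fun y => y != l -> A y)).
have : \forall t \near G, A (f t) by apply: filterS2 H fn => t; exact.
by [].
Qed.

Lemma cvg_dnbhs_id : (id : R -> R) @ (0 : R)^' --> (0 : R).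
Proof. exact: cvg_within. Qed.

Lemma cvg_scaled_dnbhs (c : R) : (fun r : R => r * c) @ (0 : R)^' --> (0 : R).
Proof.
rewrite -[X in _ --> X](mul0r c); apply: cvgM; [exact: cvg_dnbhs_id|exact: cvg_cst].
Qed.

Lemma has_dirderiv_scale E F (f : E -> F) x h l T (G : set_system T) (t : T -> R) :
  Filter G -> has_dirderiv f x h l -> t @ G --> (0 : R) -> (\forall a \near G, t a != 0) ->
  (fun a => (t a)^-1 *: (f (x + t a *: h) - f x)) @ G --> l.
Proof. by move=> FG fl t0 tn; apply: (cvg_comp _ _ (cvg_dnbhs FG t0 tn) fl). Qed.

Lemma lim_unique T (U : topologicalType) (G : set_system T) (f : T -> U) (a b : U) :
  hausdorff_space U -> ProperFilter G -> f @ G --> a -> f @ G --> b -> a = b.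
Proof. by move=> hU FG fa fb; exact: (cvg_unique hU fa fb). Qed.

Lemma has_dirderiv_unique E F (f : E -> F) x h l l' : hausdorff_space F ->
  has_dirderiv f x h l -> has_dirderiv f x h l' -> l = l'.
Proof. by move=> hF; exact: lim_unique. Qed.

Lemma cvg_unit_interval T (G : set_system T) (t : T -> R) : Filter G -> t @ G --> (0 : R) ->
  (fun p : T * R => p.2 * t p.1) @ filter_prod G (globally [set s : R | 0 <= s <= 1])
    --> (0 : R).
Proof.
move=> FG t0; apply/cvgr0Pnorm_lt => e e0.
exists ([set a | `|t a| < e], [set s : R | 0 <= s <= 1]).
  by split=> //=; have /cvgr0Pnorm_lt := t0; apply.
move=> [a s] /= [ta /andP[s0 s1]]; rewrite normrM; apply: le_lt_trans ta.
by rewrite ger0_norm // ler_piMl.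
Qed.

Lemma near_unit_interval T (G : set_system T) (P : T * R -> Prop) : Filter G ->
  (\forall p \near filter_prod G (globally [set s : R | 0 <= s <= 1]), P p) ->
  \forall a \near G, forall s, 0 <= s <= 1 -> P (a, s).
Proof.
move=> FG [[A B] /= [GA GB] AB]; apply: filterS GA => a Aa s s01.
by apply: AB; split=> //=; exact: GB.
Qed.

Lemma cvg_prod_fst T S (U : nbhsType) (G : set_system T) (H : set_system S) (f : T -> U) (l : U) :
  Filter G -> Filter H -> f @ G --> l -> (fun p => f p.1) @ filter_prod G H --> l.
Proof. by move=> FG FH fl; apply: (cvg_comp _ _ _ fl); exact: cvg_fst. Qed.

Lemma strict_diff E F (U : set E) (g : E -> F) (dg : E * E -> F) x h
    T (G : set_system T) (y k : T -> E) (t : T -> R) : Filter G ->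
  topological_lmod E -> mean_value_space F -> open U ->
  (forall x h, U x -> has_dirderiv g x h (dg (x, h))) -> U x ->
  {for (x, h), continuous dg} ->
  y @ G --> x -> k @ G --> h -> t @ G --> (0 : R) -> (\forall a \near G, t a != 0) ->
  (fun a => (t a)^-1 *: (g (y a + t a *: k a) - g (y a))) @ G --> dg (x, h).
Proof.
move=> FG [DE ZE] mF oU dgP Ux cdg yx kh t0 tn V /mF[V' lV' HV'].
set H := filter_prod G (globally [set s : R | 0 <= s <= 1]).
have FH : Filter H by exact: filter_prod_filter.
pose z (p : T * R) := y p.1 + (p.2 * t p.1) *: k p.1.
have zx : z @ H --> x.
  rewrite -[x]addr0 -(scale0r h); apply: DE; first exact: cvg_prod_fst.
  by apply: ZE; [exact: cvg_unit_interval|exact: cvg_prod_fst].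
have nU : \forall p \near H, U (z p) by apply: (cvg_near zx); exact: open_nbhs_nbhs.
have nV : \forall p \near H, V' (dg (z p, k p.1)).
  have zk : (fun p => (z p, k p.1)) @ H --> (x, h).
    by apply: cvg_pairP => //; exact: cvg_prod_fst.
  exact: (cvg_near (cvg_comp _ _ zk cdg) lV').
suff key : \forall a \near G, V ((t a)^-1 *: (g (y a + t a *: k a) - g (y a))) by exact: key.
apply: filterS3 (near_unit_interval (P := fun p => U (z p)) FG nU)
  (near_unit_interval (P := fun p => V' (dg (z p, k p.1))) FG nV) tn => a Ua Va ta.
have := HV' (fun s => (t a)^-1 *: g (z (a, s))) (fun s => dg (z (a, s), k a)) _ Va.
rewrite -scalerBr /z /= mul1r mul0r scale0r addr0; apply=> s s01.
have ra : (fun r : R => r * t a) @ 0^' --> (0 : R) by exact: cvg_scaled_dnbhs.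
have rn : \forall r \near (0 : R)^', r * t a != 0.
  by apply: filterS (nbhs_dnbhs_neq (0 : R)) => r r0; rewrite mulf_neq0.
apply: cvg_fun_ext (has_dirderiv_scale _ (dgP _ (k a) (Ua s s01)) ra rn).
near=> r; rewrite -scalerBr scalerA invfM /z /=.
by rewrite mulrDl scalerDl addrA.
Unshelve. all: by end_near. Qed.

Section DirectionalDerivative.
Context {E F : preTopologicalLmodType R} {U : set E} {g : E -> F} {dg : E * E -> F}.
Hypotheses (tE : topological_lmod E) (tF : topological_lmod F) (mF : mean_value_space F)
  (hF : hausdorff_space F) (oU : open U).
Hypothesis dgP : forall x h, U x -> has_dirderiv g x h (dg (x, h)).

Lemma dirderivD x h k : U x -> (forall h, {for (x, h), continuous dg}) ->
  dg (x, h + k) = dg (x, h) + dg (x, k).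
Proof.
move=> Ux cdg; apply: (has_dirderiv_unique hF (@dgP _ (h + k) Ux)).
have xt : (fun t : R => x + t *: h) @ 0^' --> x.
  rewrite -[X in _ --> X]addr0 -(scale0r h); apply: tE.1; first exact: cvg_cst.
  by apply: tE.2; [exact: cvg_dnbhs_id|exact: cvg_cst].
have xk := strict_diff (dnbhs_filter (0 : R)) tE mF oU (@dgP) Ux (cdg k) xt (cvg_constant k (dnbhs_filter _)) cvg_dnbhs_id
  (nbhs_dnbhs_neq (0 : R)).
rewrite /has_dirderiv; apply: cvg_fun_ext (tF.1 _ _ _ _ _ _ (dnbhs_filter _) (@dgP _ h Ux) xk).
near=> t; rewrite -scalerDr; congr (_ *: _).
by rewrite [in RHS]scalerDr [in RHS]addrA [LHS]addrC subrKA.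
Unshelve. all: by end_near. Qed.

Lemma dirderivB x h k : U x -> (forall h, {for (x, h), continuous dg}) ->
  dg (x, h - k) = dg (x, h) - dg (x, k).
Proof.
by move=> Ux cdg; have := dirderivD (h - k) k Ux cdg; rewrite subrK => ->; rewrite addrK.
Qed.

Lemma dirderiv0 x : U x -> dg (x, 0) = 0.
Proof.
move=> Ux; apply: (has_dirderiv_unique hF (@dgP _ 0 Ux)).
rewrite /has_dirderiv; apply: cvg_fun_ext (cvg_cst 0).
by near=> t; rewrite scaler0 addr0 subrr scaler0.
Unshelve. all: by end_near. Qed.

Lemma dirderivZ x (c : R) h : U x -> dg (x, c *: h) = c *: dg (x, h).
Proof.
move=> Ux; have [->|c0] := eqVneq c 0; first by rewrite !scale0r dirderiv0.
have tc : (fun t : R => t * c) @ 0^' --> (0 : R) by exact: cvg_scaled_dnbhs.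
have tn : \forall r \near (0 : R)^', r * c != 0.
  by apply: filterS (nbhs_dnbhs_neq (0 : R)) => r r0; rewrite mulf_neq0.
have H := has_dirderiv_scale (dnbhs_filter (0 : R)) (@dgP _ h Ux) tc tn.
apply: (has_dirderiv_unique hF (@dgP _ (c *: h) Ux)).
rewrite /has_dirderiv; apply: cvg_fun_ext (tF.2 _ _ _ _ _ _ (dnbhs_filter _) (cvg_constant c (dnbhs_filter _)) H).
by near=> t; rewrite [LHS]scalerA [in RHS]scalerA invfM mulrCA mulfV // mulr1.
Unshelve. all: by end_near. Qed.

End DirectionalDerivative.

Section SecondDerivative.
Context {E F : preTopologicalLmodType R} {U : set E} {g : E -> F} {dg : E * E -> F}
  {ddg : (E * E) * (E * E) -> F}.
Hypotheses (tE : topological_lmod E) (tF : topological_lmod F) (mF : mean_value_space F)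
  (hF : hausdorff_space F) (oU : open U).
Hypothesis dgP : forall x h, U x -> has_dirderiv g x h (dg (x, h)).
Hypothesis cdg : forall x h, U x -> {for (x, h), continuous dg}.
Hypothesis ddgP : forall xh kl : E * E, (U `*` [set: E]) xh -> has_dirderiv dg xh kl (ddg (xh, kl)).
Hypothesis cddg : forall xh kl : E * E, (U `*` [set: E]) xh -> {for (xh, kl), continuous ddg}.

Let oUT : open (U `*` [set: E]).
Proof.
by rewrite openE => -[a b] [/= Ua _]; exists (U, setT) => //; split=> /=;
  [exact: open_nbhs_nbhs|exact: filterT].
Qed.

Lemma second_difference x h k : U x ->
  (fun t : R => t^-1 *: (t^-1 *:
     (g (x + t *: h + t *: k) - g (x + t *: k) - (g (x + t *: h) - g x)))) @ 0^' -->
  ddg ((x, k), (h, 0)).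
Proof.
move=> Ux V /mF[V' lV' HV'].
set H := filter_prod (0 : R)^' (globally [set s : R | 0 <= s <= 1]).
have FH : Filter H by exact: filter_prod_filter.
have H1 : (fun p : R * R => p.1) @ H --> (0 : R).
  exact: (cvg_prod_fst (dnbhs_filter _) (globally_filter _) cvg_dnbhs_id).
have H1n : \forall p \near H, p.1 != 0.
  exists ([set r | r != 0], setT) => [|[a b] /= [] //]; split=> /=.
    exact: (nbhs_dnbhs_neq (0 : R)).
  by [].
have zx : (fun p : R * R => x + (p.2 * p.1) *: k) @ H --> x.
  rewrite -[X in _ --> X]addr0 -(scale0r k); apply: tE.1; first exact: cvg_cst.
  by apply: tE.2; [exact: cvg_unit_interval (cvg_dnbhs_id)|exact: cvg_cst].
have zhx : (fun p : R * R => x + p.1 *: h + (p.2 * p.1) *: k) @ H --> x.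
  rewrite -[X in _ --> X]addr0 -(scale0r k); apply: tE.1; last first.
    by apply: tE.2; [exact: cvg_unit_interval (cvg_dnbhs_id)|exact: cvg_cst].
  rewrite -[X in _ --> X]addr0 -(scale0r h); apply: tE.1; first exact: cvg_cst.
  by apply: tE.2 => //; exact: cvg_cst.
have tEE := topological_lmod_prod tE tE.
have UxT : (U `*` [set: E]) (x, k) by [].
have S := strict_diff FH tEE mF oUT (@ddgP) UxT (@cddg _ (h, 0) UxT)
  (cvg_pairP FH zx (cvg_constant k FH)) (cvg_constant (h, 0) FH) H1 H1n.
have nV := cvg_near S lV'.
have nU : \forall p \near H, U (x + (p.2 * p.1) *: k).
  by apply: (cvg_near zx); exact: open_nbhs_nbhs.
have nUh : \forall p \near H, U (x + p.1 *: h + (p.2 * p.1) *: k).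
  by apply: (cvg_near zhx); exact: open_nbhs_nbhs.
suff key : \forall t \near (0 : R)^', V (t^-1 *: (t^-1 *:
     (g (x + t *: h + t *: k) - g (x + t *: k) - (g (x + t *: h) - g x)))) by exact: key.
near=> t; have t0 : t != 0 by near: t; exact: (nbhs_dnbhs_neq (0 : R)).
have Ut : forall s, 0 <= s <= 1 -> U (x + (s * t) *: k).
  by near: t; exact: (near_unit_interval (P := fun p => U (x + (p.2 * p.1) *: k)) _ nU).
have Uht : forall s, 0 <= s <= 1 -> U (x + t *: h + (s * t) *: k).
  by near: t; exact: (near_unit_interval (P := fun p => U (x + p.1 *: h + (p.2 * p.1) *: k)) _ nUh).
have Vt : forall s, 0 <= s <= 1 ->
    V' (t^-1 *: (dg ((x + (s * t) *: k, k) + t *: (h, 0)) - dg (x + (s * t) *: k, k))).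
  by near: t; exact: (near_unit_interval (P := fun p => V' (p.1^-1 *:
      (dg ((x + (p.2 * p.1) *: k, k) + p.1 *: (h, 0)) - dg (x + (p.2 * p.1) *: k, k)))) _ nV).
pose c s := t^-1 *: (t^-1 *: (g (x + t *: h + (s * t) *: k) - g (x + (s * t) *: k))).
pose c' s := t^-1 *: (dg ((x + (s * t) *: k, k) + t *: (h, 0)) - dg (x + (s * t) *: k, k)).
have := HV' c c' _ Vt.
rewrite /c -!scalerBr !mul1r !mul0r !scale0r !addr0; apply=> s s01.
have ra : (fun r : R => r * t) @ 0^' --> (0 : R) by exact: cvg_scaled_dnbhs.
have rn : \forall r \near (0 : R)^', r * t != 0.
  by apply: filterS (nbhs_dnbhs_neq (0 : R)) => r r0; rewrite mulf_neq0.
have D1 := has_dirderiv_scale (dnbhs_filter (0 : R)) (@dgP _ k (Ut s s01)) ra rn.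
have D2 := has_dirderiv_scale (dnbhs_filter (0 : R)) (@dgP _ k (Uht s s01)) ra rn.
have D3 := tF.1 _ _ _ _ _ _ (dnbhs_filter _) D2 (tF.2 _ _ _ _ _ _ (dnbhs_filter _) (cvg_constant (-1 : R) (dnbhs_filter _)) D1).
have D4 := tF.2 _ _ _ _ _ _ (dnbhs_filter _) (cvg_constant (t^-1 : R) (dnbhs_filter _)) D3.
rewrite scaleN1r in D4.
have E1 : (x + (s * t) *: k, k) + t *: (h, 0) = (x + t *: h + (s * t) *: k, k).
  by rewrite -[LHS]/(x + (s * t) *: k + t *: h, k + t *: 0) scaler0 addr0 addrAC.
rewrite /c' E1.
apply: cvg_fun_ext D4; near=> r.
rewrite scaleN1r -scalerBr [LHS]scalerA -[in RHS]scalerBr -[in RHS]scalerBr.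
rewrite [in RHS]scalerA [in RHS]scalerA; congr (_ *: _).
  by rewrite invfM mulrA ![in RHS]mulrA [t^-1 * r^-1]mulrC.
rewrite [(s + r) * t]mulrDl [(_ + _) *: k]scalerDl !addrA !opprB.
by rewrite [in LHS]addrACA [X in _ + X]addrC [in LHS]addrACA.
Unshelve. all: by end_near. Qed.

Lemma second_derivative_sym x h k : U x ->
  ddg ((x, k), (h, 0)) = ddg ((x, h), (k, 0)).
Proof.
move=> Ux; have H1 := @second_difference x h k Ux; have H2 := @second_difference x k h Ux.
apply: lim_unique hF _ H1 _.
apply: cvg_fun_ext H2.
near=> t; do 2![congr (_ *: _)]; rewrite (addrAC x (t *: k)) !opprB.
by rewrite -!addrA; congr (_ + _); rewrite addrCA [in RHS]addrCA; congr (_ + _); rewrite addrC.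
Unshelve. all: by end_near. Qed.

Lemma derivative_along x y h q T (G : set_system T) (k r : T -> E) (t : T -> R) : Filter G ->
  U x -> k @ G --> h -> r @ G --> q -> t @ G --> (0 : R) -> (\forall a \near G, t a != 0) ->
  (fun a => (t a)^-1 *: (dg (x + t a *: k a, y + t a *: r a) - dg (x, y))) @ G -->
  ddg ((x, y), (h, 0)) + dg (x, q).
Proof.
move=> FG Ux kh rq t0 tn; have UxT : (U `*` [set: E]) (x, y) by [].
have tEE := topological_lmod_prod tE tE.
have -> : dg (x, q) = ddg ((x, y), (0, q)).
  apply: (has_dirderiv_unique hF _ (@ddgP _ (0, q) UxT)).
  rewrite /has_dirderiv; apply: cvg_fun_ext (cvg_cst (dg (x, q))).
  near=> s; have -> : (x, y) + s *: (0, q) = (x, y + s *: q).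
    by rewrite -[LHS]/(x + s *: 0, y + s *: q) scaler0 addr0.
  rewrite (dirderivD tE tF mF hF oU (@dgP) y (s *: q) Ux (fun h => @cdg x h Ux)).
  rewrite addrAC subrr add0r (dirderivZ tF hF (@dgP) s q Ux) scalerA mulVf ?scale1r //.
  by near: s; exact: (nbhs_dnbhs_neq (0 : R)).
rewrite -(dirderivD tEE tF mF hF oUT (@ddgP) (h, 0) (0, q) UxT (fun kl => @cddg _ kl UxT)).
rewrite -[(h, 0) + (0, q)]/(h + 0, 0 + q) addr0 add0r.
exact: (strict_diff FG tEE mF oUT (@ddgP) UxT (@cddg _ (h, q) UxT) (cvg_constant (x, y) FG)
  (cvg_pairP FG kh rq) t0 tn).
Unshelve. all: by end_near. Qed.

End SecondDerivative.
End FrechetCalculusTheory.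

Arguments cvg_constant {T U G} a FG.

Section FrechetSmoothness.
Context {R : realType}.
Implicit Types E F H : preTopologicalLmodType R.

Lemma frechet_CkW k E F (U : set E) (f : E -> F) :
  frechet_Ck k.+1 U f -> frechet_Ck k U f.
Proof.
elim: k E F U f => [|k IH] E F U f [cf [df [dfP Cdf]]]; split=> //.
by exists df; split=> //; exact: IH.
Qed.

Lemma frechet_Ck_sub k E F (U U' : set E) (f : E -> F) : U' `<=` U ->
  frechet_Ck k U f -> frechet_Ck k U' f.
Proof.
elim: k E F U U' f => [|k IH] E F U U' f UU' [cf df]; split=> //; try by move=> x /UU'; exact: cf.
move: df => [df [dfP Cdf]]; exists df; split; first by move=> x h /UU'; exact: dfP.
by apply: IH Cdf => -[x h] [/= /UU' ? _].
Qed.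

Lemma lin_ctsB E F (L : E -> F) x y : lin_cts L -> L (x - y) = L x - L y.
Proof. by move=> [lL _]; rewrite addrC -scaleN1r lL scaleN1r addrC. Qed.

Lemma lin_cts0 E F (L : E -> F) : lin_cts L -> L 0 = 0.
Proof. by move=> lL; rewrite -(subrr 0) lin_ctsB // subrr. Qed.

Lemma lin_ctsZ E F (L : E -> F) (c : R) x : lin_cts L -> L (c *: x) = c *: L x.
Proof. by move=> lL; rewrite -[c *: x]addr0 lL.1 lin_cts0 // addr0. Qed.

Lemma lin_ctsD E F (L : E -> F) x y : lin_cts L -> L (x + y) = L x + L y.
Proof. by move=> lL; rewrite -[x]scale1r lL.1 !scale1r. Qed.

Lemma lin_cts_continuous E F (L : E -> F) x : lin_cts L -> {for x, continuous L}.
Proof. by move=> [_ cL]; apply: (cL _ (nbhs x) id); exact: cvg_id. Qed.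

Lemma lin_cts_comp E F H (L : E -> F) (L' : F -> H) :
  lin_cts L -> lin_cts L' -> lin_cts (fun x => L' (L x)).
Proof.
move=> [lL cL] [lL' cL']; split=> [c x y|T G f a FG fa]; first by rewrite lL lL'.
by apply: cL'; exact: cL.
Qed.

Lemma lin_cts_id E : lin_cts (@id E).
Proof. by split. Qed.

Lemma lin_cts_fst E F : lin_cts (fst : E * F -> E).
Proof. by split=> // T G f a FG fa; exact: (cvg_pair_fst FG fa). Qed.

Lemma lin_cts_snd E F : lin_cts (snd : E * F -> F).
Proof. by split=> // T G f a FG fa; exact: (cvg_pair_snd FG fa). Qed.

Lemma lin_cts_pair E F H (L : E -> F) (L' : E -> H) :
  lin_cts L -> lin_cts L' -> lin_cts (fun x => (L x, L' x)).
Proof.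
move=> [lL cL] [lL' cL']; split=> [c x y|T G f a FG fa]; first by rewrite lL lL'.
by apply: cvg_pairP => //; [exact: cL|exact: cL'].
Qed.

Lemma has_dirderiv_comp_lin E F H (L : E -> F) (f : F -> H) x h l : lin_cts L ->
  has_dirderiv f (L x) (L h) l -> has_dirderiv (fun x => f (L x)) x h l.
Proof.
move=> lL; apply: cvg_fun_ext; near=> t.
by rewrite (lin_ctsD x _ lL) (lin_ctsZ _ _ lL).
Unshelve. all: by end_near. Qed.

Lemma has_dirderiv_lin_comp E F H (L : F -> H) (f : E -> F) x h l : lin_cts L ->
  has_dirderiv f x h l -> has_dirderiv (fun x => L (f x)) x h (L l).
Proof.
move=> lL fl; have := lL.2 _ _ _ _ (dnbhs_filter _) fl; apply: cvg_fun_ext; near=> t.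
by rewrite (lin_ctsZ _ _ lL) (lin_ctsB _ _ lL).
Unshelve. all: by end_near. Qed.

Lemma has_dirderivD E F (f g : E -> F) x h l l' : topological_lmod F ->
  has_dirderiv f x h l -> has_dirderiv g x h l' ->
  has_dirderiv (fun x => f x + g x) x h (l + l').
Proof.
move=> tF fl gl; have := tF.1 _ _ _ _ _ _ (dnbhs_filter _) fl gl; apply: cvg_fun_ext; near=> t.
by rewrite -scalerDr opprD addrACA.
Unshelve. all: by end_near. Qed.

Lemma line_cvg E (x h : E) : topological_lmod E ->
  (fun t : R => x + t *: h) @ 0^' --> x.
Proof.
move=> tE; rewrite -[X in _ --> X]addr0 -(scale0r h); apply: tE.1; first exact: cvg_cst.
by apply: tE.2; [exact: cvg_dnbhs_id|exact: cvg_cst].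
Qed.

Lemma bilin_ctsBl E F H (b : E -> F -> H) x y z : bilin_cts b -> b (x - y) z = b x z - b y z.
Proof. by move=> [bl _ _]; rewrite addrC -scaleN1r bl scaleN1r addrC. Qed.

Lemma bilin_ctsBr E F H (b : E -> F -> H) x y z : bilin_cts b -> b z (x - y) = b z x - b z y.
Proof. by move=> [_ br _]; rewrite addrC -scaleN1r br scaleN1r addrC. Qed.

Lemma bilin_ctsZl E F H (b : E -> F -> H) (c : R) x z : bilin_cts b -> b (c *: x) z = c *: b x z.
Proof.
move=> bb; have [bl _ _] := bb; rewrite -[c *: x]addr0 bl -(subrr 0) bilin_ctsBl //.
by rewrite subrr addr0.
Qed.

Lemma bilin_ctsZr E F H (b : E -> F -> H) (c : R) x z : bilin_cts b -> b z (c *: x) = c *: b z x.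
Proof.
move=> bb; have [_ br _] := bb; rewrite -[c *: x]addr0 br -(subrr 0) bilin_ctsBr //.
by rewrite subrr addr0.
Qed.

Lemma has_dirderiv_bilin E F F' H (b : F -> F' -> H) (f : E -> F) (g : E -> F') x h l l' :
  topological_lmod E -> topological_lmod H -> bilin_cts b -> {for x, continuous g} ->
  has_dirderiv f x h l -> has_dirderiv g x h l' ->
  has_dirderiv (fun x => b (f x) (g x)) x h (b l (g x) + b (f x) l').
Proof.
move=> tE tH bb cg fl gl; have [_ _ cb] := bb.
have gx : (fun t : R => g (x + t *: h)) @ 0^' --> g x.
  exact: (cvg_comp _ _ (@line_cvg _ x h tE) cg).
have H1 := cb _ _ _ _ _ _ (dnbhs_filter _) fl gx.
have H2 := cb _ _ _ _ _ _ (dnbhs_filter _) (cvg_constant (f x) (dnbhs_filter _)) gl.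
have := tH.1 _ _ _ _ _ _ (dnbhs_filter _) H1 H2; apply: cvg_fun_ext; near=> t.
rewrite (bilin_ctsZl _ _ _ bb) (bilin_ctsZr _ _ _ bb) -scalerDr (bilin_ctsBl _ _ _ bb).
rewrite (bilin_ctsBr _ _ _ bb).
by rewrite addrA subrK.
Unshelve. all: by end_near. Qed.

Lemma frechet_Ck_comp_lin k E F H (L : E -> F) (U : set F) (U' : set E) (f : F -> H) :
  lin_cts L -> (forall x, U' x -> U (L x)) ->
  frechet_Ck k U f -> frechet_Ck k U' (fun x => f (L x)).
Proof.
elim: k E F H L U U' f => [|k IH] E F H L U U' f lL UU' [cf df]; split=> //.
- move=> x /UU' Ux; exact: (continuous_comp (@lin_cts_continuous _ _ L x lL) (cf _ Ux)).
- move=> x /UU' Ux; exact: (continuous_comp (@lin_cts_continuous _ _ L x lL) (cf _ Ux)).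
move: df => [df [dfP Cdf]]; exists (fun p => df (L p.1, L p.2)); split.
  by move=> x h /UU' Ux; apply: has_dirderiv_comp_lin => //; exact: dfP.
apply: (IH _ _ _ (fun p => (L p.1, L p.2)) (U `*` setT) _ df) => //.
  apply: lin_cts_pair; first exact: (lin_cts_comp (lin_cts_fst _ _) lL).
  exact: (lin_cts_comp (lin_cts_snd _ _) lL).
by move=> [x h] [/= /UU' ? _].
Qed.

Lemma frechet_Ck_lin_comp k E F H (L : F -> H) (U : set E) (f : E -> F) :
  lin_cts L -> frechet_Ck k U f -> frechet_Ck k U (fun x => L (f x)).
Proof.
elim: k E F H L U f => [|k IH] E F H L U f lL [cf df]; split=> //.
- move=> x Ux; exact: (continuous_comp (cf _ Ux) (@lin_cts_continuous _ _ L (f x) lL)).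
- move=> x Ux; exact: (continuous_comp (cf _ Ux) (@lin_cts_continuous _ _ L (f x) lL)).
move: df => [df [dfP Cdf]]; exists (fun p => L (df p)); split; last exact: IH.
by move=> x h Ux; apply: has_dirderiv_lin_comp => //; exact: dfP.
Qed.

Lemma frechet_CkD k E F (U : set E) (f g : E -> F) : topological_lmod F ->
  frechet_Ck k U f -> frechet_Ck k U g -> frechet_Ck k U (fun x => f x + g x).
Proof.
move=> tF; elim: k E U f g => [|k IH] E U f g [cf df] [cg dg]; split=> //.
- by move=> x Ux; apply: tF.1; [exact: cf|exact: cg].
- by move=> x Ux; apply: tF.1; [exact: cf|exact: cg].
move: df dg => [df [dfP Cdf]] [dg [dgP Cdg]].
exists (fun p => df p + dg p); split; last exact: IH.
by move=> x h Ux; apply: has_dirderivD => //; [exact: dfP|exact: dgP].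
Qed.

Lemma frechet_Ck_cst k E F (U : set E) (a : F) : frechet_Ck k U (fun _ => a).
Proof.
have C0 E' (b : F) (x : E') : {for x, continuous (fun _ : E' => b)} by exact: cvg_cst.
elim: k E U a => [|k IH] E U a; split=> //.
exists (fun _ => 0); split; last exact: IH.
move=> x h _; apply: cvg_fun_ext (cvg_cst 0); near=> t.
by rewrite subrr scaler0.
Unshelve. all: by end_near. Qed.

Lemma frechet_Ck_id k E (U : set E) : topological_lmod E -> frechet_Ck k U (@id E).
Proof.
move=> tE; suff Hk E' (L : E' -> E) (V : set E') : lin_cts L -> frechet_Ck k V L.
  exact: Hk (lin_cts_id E).
elim: k E' L V => [|k IH] E' L V lL; split=> //; try by move=> x _; exact: lin_cts_continuous.
exists (fun p => L p.2); split; last by apply: IH; exact: (lin_cts_comp (lin_cts_snd _ _) lL).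
move=> x h _; apply: cvg_fun_ext (cvg_cst (L h)); near=> t.
rewrite (lin_ctsD x _ lL) (lin_ctsZ _ _ lL) addrC addKr scalerA mulVf ?scale1r //.
by near: t; exact: (nbhs_dnbhs_neq (0 : R)).
Unshelve. all: by end_near. Qed.

Lemma frechet_Ck_bilin k E F F' H (b : F -> F' -> H) (U : set E) (f : E -> F) (g : E -> F') :
  topological_lmod E -> topological_lmod H -> bilin_cts b ->
  frechet_Ck k U f -> frechet_Ck k U g -> frechet_Ck k U (fun x => b (f x) (g x)).
Proof.
move=> + tH bb; have [_ _ cb] := bb.
elim: k E U f g => [|k IH] E U f g tE Cf Cg; split=> //.
- by move=> x Ux; apply: cb; [exact: Cf.1|exact: Cg.1].
- by move=> x Ux; apply: cb; [exact: Cf.1|exact: Cg.1].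
move: (frechet_CkW Cf) (frechet_CkW Cg) => Cf' Cg'.
move: Cf Cg => [cf [df [dfP Cdf]]] [cg [dg [dgP Cdg]]].
exists (fun p => b (df p) (g p.1) + b (f p.1) (dg p)); split.
  move=> x h Ux; apply: has_dirderiv_bilin => //; first exact: cg.
    exact: dfP.
  exact: dgP.
have tEE := topological_lmod_prod tE tE.
have comp1 (G : preTopologicalLmodType R) (q : E -> G) : frechet_Ck k U q -> frechet_Ck k (U `*` [set: E]) (fun p : E * E => q p.1).
  apply: (frechet_Ck_comp_lin (lin_cts_fst _ _)).
  by move=> [x h] [].
apply: frechet_CkD => //; apply: IH => //; exact: comp1.
Qed.

End FrechetSmoothness.

Section Instances.
Context {R : realType}.

Lemma topological_lmod_R : topological_lmod R^o.
Proof.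
split=> [T G f g a b FG|T G f g a b FG]; first exact: cvgD.
exact: cvgM.
Qed.

Lemma mean_value_scalar (c c' : R -> R) :
  (forall s : R, 0 <= s <= 1 -> curve_deriv (F := R^o) c s (c' s)) ->
  exists2 s : R, 0 <= s <= 1 & c 1 - c 0 = c' s.
Proof.
move=> cd.
have D (s : R) : 0 <= s <= 1 -> is_derive s (1 : R) (c : R -> R) (c' s).
  move=> s01; have H : (fun h : R => h^-1 *: ((c \o shift s) (h *: (1 : R)) - c s)) @ 0^' --> c' s.
    apply: cvg_fun_ext (cd s s01); near=> h.
    by rewrite /= [h *: 1]mulr1 addrC [s + h]addrC [in RHS]addrC.
  split; first by apply: cvgP; exact: H.
  exact: cvg_lim H.
have [||s s01 E] := @MVT_segment R c c' 0 1 ler01.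
- by move=> s; rewrite in_itv /= => /andP[s0 s1]; apply: D; rewrite !ltW.
- apply: derivable_within_continuous => s; rewrite in_itv /= => s01.
  by have [] := D s s01.
by exists s; [move: s01; rewrite in_itv|rewrite E subr0 mulr1].
Unshelve. all: by end_near. Qed.

Lemma mean_value_space_R : mean_value_space R^o.
Proof.
move=> l V lV; exists V => // c c' cd cV.
by have [s s01 ->] := mean_value_scalar cd; exact: cV.
Qed.

Section Endo.
Context {n : nat} {M : compactComplexManifold R n}.
Local Notation m := (n + n)%N.
Implicit Types (i : chart M).

Lemma topological_lmod_endo : topological_lmod (endo M).
Proof. by split=> *; [exact: endo_cvgD|exact: endo_cvgZ]. Qed.

Definition jet i vs (x : 'cV[R]_m) (a b : 'I_m) (A : endo M) : R :=
  iter_derive vs (local_end A i) x a b.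

Lemma iter_deriveZ (V W : normedModType R) (U : set V) (f : V -> W) (c : R) vs :
  open U -> smooth U f ->
  forall x, U x -> iter_derive vs (fun x => c *: f x) x = c *: iter_derive vs f x.
Proof.
move=> oU sf; elim: vs => //= v vs IH x Ux.
rewrite (derive_ext oU v IH Ux) -derive_scale //.
exact: (smooth_iter_derive vs sf 1).1.
Qed.

Lemma jet_lin i vs x a b : chart_image i x -> lin_cts (jet i vs x a b : endo M -> R^o).
Proof.
move=> ix; have oU := @chart_image_open _ _ M i.
have lJ (c : R) (A B : endo M) :
    jet i vs x a b (c *: A + B) = c * jet i vs x a b A + jet i vs x a b B.
  rewrite /jet (@iter_deriveD _ _ _ _ _ (fun x => c *: local_end A i x)
    (local_end B i) vs oU _ (smooth_local_end B i) _ x ix).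
  - by rewrite (iter_deriveZ c vs oU (smooth_local_end A i) ix) !mxE.
  - suff -> : (fun x => c *: local_end A i x) = local_end (c *: A) i by exact: smooth_local_end.
    by apply/funext => y; rewrite local_endZ.
  - by move=> y _; rewrite local_endD local_endZ.
split=> // T G f A FG /endo_cvgP fA.
have Kx : [set x] `<=` chart_image i by move=> y ->.
have /(null_on_iterP _ _ FG) H := fA i [set x] (@compact_set1 _ x) Kx.
apply/cvgrPdist_lt => e e0; apply: filterS (H vs e e0) => t /(_ x erefl).
apply: le_lt_trans; rewrite distrC.
have -> : jet i vs x a b (f t) - jet i vs x a b A = jet i vs x a b (f t - A).
  by rewrite addrC -mulN1r -lJ scaleN1r addrC.
exact: mxnorm_entry.
Qed.

Lemma mean_value_space_endo : mean_value_space (endo M).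
Proof.
move=> A V AV.
pose good : set_system (endo M) := fun V => exists2 V', nbhs A V' & forall c c' : R -> endo M,
    (forall s : R, 0 <= s <= 1 -> curve_deriv c s (c' s)) ->
    (forall s, 0 <= s <= 1 -> V' (c' s)) -> V (c 1 - c 0).
have Fgood : Filter good.
  split.
  - by exists setT => //; exact: filterT.
  - move=> P Q [P' nP' HP] [Q' nQ' HQ]; exists (P' `&` Q'); first exact: filterI.
    by move=> c c' cd cPQ; split; [apply: (HP _ c')|apply: (HQ _ c')] => // s /cPQ [].
  - by move=> P Q PQ [P' nP' HP]; exists P' => // c c' cd cP; apply/PQ/(HP _ c').
suff : id @ good --> A by move=> /(_ V AV).
apply/endo_cvgP => i K cK Ki k; move: k; apply/null_on_iterP => vs e e0.
have e2 : 0 < e / 2 by rewrite divr_gt0.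
exists (fun B => forall x, K x -> `|iter_derive vs (local_end (B - A : endo M) i) x| < e / 2).
  have /(endo_cvgP _ _ _) H : id @ (nbhs A) --> A by exact: cvg_id.
  by have /null_on_iterP := H i K cK Ki; apply.
move=> c c' cd cV x Kx; apply: (@le_lt_trans _ _ (e / 2)); last first.
  by rewrite gtr_pMr // invf_lt1 // ltr1n.
apply: mxnorm_le => [|a b]; first exact: ltW.
have lJ := @jet_lin i vs x a b (Ki x Kx).
have cJ (s : R) : 0 <= s <= 1 -> curve_deriv (F := R^o) (fun s => jet i vs x a b (c s) : R^o) s
    (jet i vs x a b (c' s)).
  move=> /cd cds; have := lJ.2 _ _ _ _ (dnbhs_filter _) cds; apply: cvg_fun_ext.
  by near=> t; rewrite lin_ctsZ // lin_ctsB.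
have [s s01 E] := mean_value_scalar cJ.
have J : jet i vs x a b (c 1 - c 0 - A) = jet i vs x a b (c' s - A).
  rewrite (lin_ctsB (c 1 - c 0) A lJ) (lin_ctsB (c 1) (c 0) lJ) (lin_ctsB (c' s) A lJ).
  by congr (_ - _); exact: E.
rewrite -[X in `|X|]/(jet i vs x a b _) J.
by apply: le_trans (ltW (cV s s01 x Kx)); exact: mxnorm_entry.
Unshelve. all: by end_near. Qed.

Lemma lin_cts_eval (p : M) (a b : 'I_m) : lin_cts (fun A : endo M => A p a b : R^o).
Proof.
pose i := chart_at p; pose x := Defs.coord i p.
have ip : dom i p := chart_at_dom p.
have ix : chart_image i x by exists p.
have Fu := frame_unit ix.
have E (A : endo M) : A p a b = \sum_c \sum_d
    (frame i x a d * jet i [::] x d c A) * invmx (frame i x) c b.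
  have -> : A p = frame i x *m local_end A i x *m invmx (frame i x).
    by rewrite /local_end (Defs.coordK ip) !mulmxA mulmxV // mul1mx mulmxK.
  rewrite mxE; apply: eq_bigr => c _; rewrite mxE mulr_suml; exact: eq_bigr.
have lE c d := @jet_lin i [::] x d c ix.
split=> [r A B|T G f A FG fA].
  rewrite !E scaler_sumr -big_split; apply: eq_bigr => c _ /=.
  rewrite scaler_sumr -big_split; apply: eq_bigr => d _ /=.
  by rewrite (lE c d).1 mulrDr mulrDl -scalerAr -scalerAl.
rewrite E; under eq_fun do rewrite E.
apply: cvg_big => [|c _]; first exact: add_continuous.
apply: cvg_big => [|d _]; first exact: add_continuous.
apply: (@cvgMr_tmp _ _ _ FG); apply: (@cvgMl_tmp _ _ _ FG); exact: ((lE c d).2 T G f A FG fA).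
Qed.

Lemma hausdorff_endo : hausdorff_space (endo M).
Proof.
move=> A B AB; apply: endo_eqP => p; apply/matrixP => a b.
have hR : hausdorff_space R^o by exact: norm_hausdorff.
have cont C := @lin_cts_continuous _ _ _ _ C (lin_cts_eval p a b).
apply: hR => P Q PA QB.
have [C [PC QC]] := AB _ _ (cont A P PA) (cont B Q QB).
by exists (C p a b).
Qed.

Lemma bilin_endo_mul : bilin_cts (@endo_mul R n M).
Proof.
split=> [c A B C|c A B C|T G f g A B FG]; last exact: endo_cvgM.
  by apply: endo_eqP => p; rewrite !(endo_valD, endo_valZ, endo_mulE) mulmxDl -scalemxAl.
by apply: endo_eqP => p; rewrite !(endo_valD, endo_valZ, endo_mulE) mulmxDr -scalemxAr.
Qed.

End Endo.
End Instances.

Section SmoothInverse.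
Context {R : realType} {V : normedModType R}.

Lemma differentiable_bigsum (W : normedModType R) I (r : seq I) (F : I -> V -> W) x :
  (forall i, differentiable (F i) x) -> differentiable (fun y => \sum_(i <- r) F i y) x.
Proof.
move=> dF; elim: r => [|i r IH].
  under eq_fun do rewrite big_nil; exact: differentiable_cst.
under eq_fun do rewrite big_cons; exact: differentiableD.
Qed.

Lemma differentiable_bigprod I (r : seq I) (F : I -> V -> R) x :
  (forall i, differentiable (F i) x) -> differentiable (fun y => \prod_(i <- r) F i y) x.
Proof.
move=> dF; elim: r => [|i r IH].
  under eq_fun do rewrite big_nil; exact: differentiable_cst.
under eq_fun do rewrite big_cons; exact: differentiableM.
Qed.

Lemma differentiable_mxentry m k (A : V -> 'M[R]_(m, k)) x :
  (forall i j, differentiable (fun y => A y i j) x) -> differentiable A x.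
Proof.
move=> dA.
have -> : A = fun y => \sum_i \sum_j A y i j *: (delta_mx i j : 'M[R]_(m, k)).
  by apply/funext => y; exact: matrix_sum_delta.
apply: differentiable_bigsum => i; apply: differentiable_bigsum => j.
exact: differentiableZl.
Qed.

Lemma differentiable_entry m k (A : V -> 'M[R]_(m, k)) x i j :
  differentiable A x -> differentiable (fun y => A y i j) x.
Proof.
move=> dA; apply: (@differentiable_comp _ _ _ _ A (fun B : 'M[R]_(m, k) => B i j)) => //.
exact: differentiable_coord.
Qed.

Lemma differentiable_det m (A : V -> 'M[R]_m) x :
  (forall i j, differentiable (fun y => A y i j) x) -> differentiable (fun y => \det (A y)) x.
Proof.
move=> dA; apply: differentiable_bigsum => s; apply: differentiableM.
  exact: differentiable_cst.
exact: differentiable_bigprod.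
Qed.

Lemma differentiable_invmx m (A : V -> 'M[R]_m) (U : set V) x : open U -> U x ->
  (forall y, U y -> A y \in unitmx) -> differentiable A x ->
  differentiable (fun y => invmx (A y)) x.
Proof.
move=> oU Ux uA dA; have dE i j := differentiable_entry i j dA.
have d0 : \det (A x) != 0 by rewrite -unitfE -unitmxE uA.
apply: (@near_eq_differentiable _ _ _ (fun y => (\det (A y))^-1 *: \adj (A y))).
  by apply: filterS (open_nbhs_nbhs (conj oU Ux)) => y /uA; rewrite /invmx => ->.
apply: differentiable_mxentry => i j.
under eq_fun do rewrite !mxE.
apply: differentiableM; first by apply: differentiableV => //; exact: differentiable_det.
apply: differentiableM; first exact: differentiable_cst.
apply: differentiable_det => a b; under eq_fun do rewrite !mxE; exact: dE.
Qed.

Lemma derive_invmx m (A : V -> 'M[R]_m) (U : set V) x v : open U -> U x ->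
  (forall y, U y -> A y \in unitmx) -> differentiable A x ->
  'D_v (fun y => invmx (A y)) x = - (invmx (A x) *m ('D_v A x *m invmx (A x))).
Proof.
move=> oU Ux uA dA; have dI := differentiable_invmx oU Ux uA dA.
have [_ /(_ v)] := differentiable_mulmx dA dI.
rewrite (near_eq_derive (g := cst 1%:M)); last first.
  by apply: filterS (open_nbhs_nbhs (conj oU Ux)) => y /uA uy; rewrite mulmxV.
rewrite derive_cst => /esym/eqP; rewrite addr_eq0 => /eqP E.
by rewrite -[LHS](mulKmx (uA x Ux)) E mulmxN.
Qed.

Lemma CkW (W : normedModType R) k (U : set V) (f : V -> W) : Ck k.+1 U f -> Ck k U f.
Proof.
elim: k f => [|k IH] f [df Df].
  by move=> x Ux; apply: differentiable_continuous; exact: df.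
by split=> // v; exact: IH.
Qed.

Lemma Ck_mulmx m k (U : set V) (f g : V -> 'M[R]_m) : open U ->
  Ck k U f -> Ck k U g -> Ck k U (fun y => f y *m g y).
Proof.
move=> oU; elim: k f g => [|k IH] f g.
  move=> cf cg x Ux; have FN : Filter (nbhs x) by exact: nbhs_filter.
  exact: (cvg_comp _ _ (cvg_pairP FN (cf x Ux) (cg x Ux)) (@mulmx_continuous R m (f x, g x))).
move=> Cf Cg; have [Cf' Cg'] := (CkW Cf, CkW Cg); move: Cf Cg => [df Df] [dg Dg].
split=> [x Ux|v]; first by have [] := differentiable_mulmx (df x Ux) (dg x Ux).
apply: Ck_ext (Ck_lin 1 oU (IH _ _ Cf' (Dg v)) (IH _ _ (Df v) Cg')) => // x Ux.
have [_ ->] := differentiable_mulmx (df x Ux) (dg x Ux).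
by rewrite !fctE scale1r.
Qed.

Lemma smooth_invmx m (A : V -> 'M[R]_m) (U : set V) : open U ->
  (forall y, U y -> A y \in unitmx) -> smooth U A -> smooth U (fun y => invmx (A y)).
Proof.
move=> oU uA sA; have dI x Ux := differentiable_invmx oU Ux uA ((sA 1).1 x Ux).
elim=> [|k IH]; first by move=> x Ux; apply: differentiable_continuous; exact: dI.
split=> // v.
have CD := Ck_mulmx oU IH (Ck_mulmx oU (smooth_derive v sA k) IH).
apply: Ck_ext (Ck_lin (-1) oU CD (Ck_cst k 0 oU)) => // x Ux.
by rewrite (derive_invmx v oU Ux uA ((sA 1).1 x Ux)) !fctE addr0 scaleN1r.
Qed.

End SmoothInverse.

Section EndoInverse.
Context {R : realType} {n : nat} {M : compactComplexManifold R n}.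
Local Notation m := (n + n)%N.
Implicit Types (A B : endo M).

Lemma invmx_conj (F A : 'M[R]_m) : F \in unitmx -> A \in unitmx ->
  invmx F *m invmx A *m F = invmx (invmx F *m A *m F).
Proof.
move=> uF uA; have uC : invmx F *m A *m F \in unitmx.
  by rewrite !unitmx_mul unitmx_inv uF uA.
by rewrite -[LHS](mulKmx uC) !mulmxA mulmxK // mulmxK // mulmxKV // mulVmx ?mulmx1.
Qed.

Lemma endo_inv_subproof A : (forall p, A p \in unitmx) ->
  (fun p => invmx (A p)) \in @smooth_end_pred R n M.
Proof.
move=> uA; apply/asboolP => i; have oU := @chart_image_open _ _ M i.
have uC x : chart_image i x -> local_end A i x \in unitmx.
  by move=> /frame_unit Fu; rewrite /local_end !unitmx_mul unitmx_inv Fu uA.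
move=> k; apply: Ck_ext (smooth_invmx oU uC (smooth_local_end A i) k) => // x ix.
by rewrite /local_end invmx_conj //; exact: frame_unit.
Qed.

Definition endo_inv A (uA : forall p, A p \in unitmx) : endo M := Endo (endo_inv_subproof uA).

Lemma endo_mulC_inv A (uA : forall p, A p \in unitmx) : endo_mul A (endo_inv uA) = endo_one.
Proof. by apply: endo_eqP => p; rewrite endo_mulE mulmxV. Qed.

Lemma endo_inv_cvg1 T (G : set_system T) (F : T -> endo M) (I : T -> endo M) : Filter G ->
  F @ G --> endo_one -> (forall t, endo_mul (F t) (I t) = endo_one) -> I @ G --> endo_one.
Proof.
move=> FG cF FI; apply/endo_cvgP => i K cK Ki.
have oU := @chart_image_open _ _ M i.
have F1 := (endo_cvgP _ _ FG).1 cF i K cK Ki.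
have F0 k := endo_cvg_bdd k FG cF cK Ki.
have FIx t x : chart_image i x -> local_end (F t) i x *m local_end (I t) i x = 1%:M.
  move=> ix; rewrite -local_endM // FI /local_end mulmx1 mulVmx //.
  exact: frame_unit.
have bI : forall k, bdd_on G K k (fun t => local_end (I t) i).
  have H0 : exists C, \forall t \near G, forall x, K x -> `|local_end (I t) i x| <= C.
    have [H1 _] := F1 0.
    have e0 : 0 < (m%:R * 2 + 1)^-1 :> R by rewrite invr_gt0 ltr_wpDl // mulr_ge0.
    exists (2 * `|1%:M : 'M[R]_m|); apply: filterS (H1 _ e0) => t Ht x Kx.
    have ix := Ki x Kx; have := Ht x Kx; set D := local_end _ i x => HD.
    have DE : local_end (F t) i x = 1%:M + D.
      rewrite /D local_endB; suff -> : local_end (@endo_one R n M) i x = 1%:M.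
        by rewrite addrC subrK.
      by rewrite /local_end mulmx1 mulVmx //; exact: frame_unit.
    have := FIx t x ix; rewrite DE mulmxDl mul1mx; set J := local_end (I t) i x => E.
    have JE : J = 1%:M - D *m J by rewrite -E addrK.
    have J1 : `|J| <= `|1%:M : 'M[R]_m| + m%:R * (`|D| * `|J|).
      by rewrite {1}JE (le_trans (ler_normB _ _)) // lerD2l mxnorm_mul.
    have D1 : m%:R * `|D| <= 2^-1.
      move: HD; rewrite -[ltRHS]mul1r ltr_pdivlMr ?ltr_wpDl // ?mulr_ge0 // => HD.
      have := normr_ge0 D; lra.
    rewrite mulrA in J1; have := ler_wpM2r (normr_ge0 J) D1; lra.
  elim=> [|k IH]; first by split.
  split=> // v.
  pose f t x := -1 *: (local_end (I t) i x *m ('D_v (local_end (F t) i) x *m local_end (I t) i x)).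
  have sI t := smooth_local_end (I t) i.
  have sF t := smooth_local_end (F t) i.
  have sDI t : smooth (chart_image i) (fun x => 'D_v (local_end (F t) i) x *m local_end (I t) i x).
    by apply: smooth_mulmx => //; exact: smooth_derive.
  have b1 : bdd_on G K k f.
    apply: (bdd_on_scale FG oU Ki); first by move=> t; exact: smooth_mulmx.
    apply: (bdd_on_mul FG oU Ki) => //.
    apply: (bdd_on_mul FG oU Ki) => //; first by move=> t; exact: smooth_derive.
    exact: (F0 k.+1).2.
  apply: (bdd_on_ext FG oU Ki _ b1) => t x ix; rewrite /f scaleN1r.
  have uF y : chart_image i y -> local_end (F t) i y \in unitmx.
    by move=> iy; have /mulmx1_unit[] := FIx t y iy.
  have IE y : chart_image i y -> local_end (I t) i y = invmx (local_end (F t) i y).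
    by move=> iy; rewrite -[LHS](mulKmx (uF y iy)) FIx // mulmx1.
  rewrite (derive_ext oU v IE ix) (derive_invmx v oU ix uF ((sF t 1).1 x ix)) IE //.
move=> k.
have sN t := smooth_local_end (- I t) i.
have bN : bdd_on G K k (fun t => local_end (- I t) i).
  have B := bdd_on_scale FG oU Ki (-1) (fun t => smooth_local_end (I t) i) (bI k).
  by apply: (bdd_on_ext FG oU Ki _ B) => t x _; rewrite local_endN scaleN1r.
have H := null_on_mulr FG oU Ki (fun t => smooth_local_end (F t - endo_one) i) sN (F1 k) bN.
apply: (null_on_ext FG oU Ki _ H) => t x ix.
rewrite -local_endM //; congr (local_end _ i x); apply/funext => p.
have := congr1 (fun A : endo M => A p) (FI t); rewrite !endo_mulE !endo_valB endo_valN => E.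
by rewrite mulmxN mulmxBl E mul1mx opprB.
Qed.

End EndoInverse.

(** * Calculus on the space of compatible structures *)

Section PointwiseCompatibility.
Context {R : realType} {m : nat}.
Implicit Types w J A B : 'M[R]_m.

Lemma unitmx_inj_col A : (forall u : 'cV[R]_m, A *m u = 0 -> u = 0) -> A \in unitmx.
Proof.
move=> H; rewrite -unitmx_tr -row_free_unit; apply/inj_row_free => v vA.
apply: trmx_inj; rewrite trmx0; apply: H.
by rewrite -[LHS]trmxK trmx_mul trmxK vA trmx0.
Qed.

Lemma selfadjoint_sqr (g N : 'M[R]_m) (u : 'cV[R]_m) : N^T *m g = g *m N ->
  (u^T *m (g *m (N *m N)) *m u) 0 0 = ((N *m u)^T *m g *m (N *m u)) 0 0.
Proof. by move=> sN; rewrite trmx_mul !mulmxA -[u^T *m N^T *m g]mulmxA sN !mulmxA. Qed.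

Variables (w J : 'M[R]_m).
Hypotheses (skw : w^T = - w) (cJ : compatible_at w J).

Let J2 : J *m J = - 1%:M. Proof. by case: cJ. Qed.
Let Jpos (u : 'cV[R]_m) : u != 0 -> 0 < (u^T *m w *m J *m u) 0 0.
Proof. by case: cJ => _ _; exact. Qed.

Lemma compatible_trmx : J^T *m w = - (w *m J).
Proof.
have [_ JwJ _] := cJ.
by rewrite -[in RHS]JwJ -mulmxA J2 mulmxN mulmx1 opprK.
Qed.

Lemma tangent_atP A : A *m J + J *m A = 0 ->
  (A^T *m w *m J)^T = A^T *m w *m J <-> A^T *m w = - (w *m A).
Proof.
move=> /eqP; rewrite addr_eq0 => /eqP AJ.
have -> : (A^T *m w *m J)^T = - (w *m A *m J).
  by rewrite !trmx_mul trmxK skw !mulNmx mulmxN mulmxA compatible_trmx mulNmx opprK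
    -!mulmxA AJ mulmxN opprK.
split=> [H|->]; last by rewrite mulNmx.
have := congr1 (fun B => B *m J) H.
rewrite mulNmx -!mulmxA J2 !mulmxN !mulmx1 opprK => E.
by rewrite -[LHS]opprK -E.
Qed.

Definition herm (u : 'cV[R]_m) : R := (u^T *m (w *m J) *m u) 0 0.

Lemma herm_gt0 u : u != 0 -> 0 < herm u.
Proof. by move=> /Jpos; rewrite /herm !mulmxA. Qed.

Lemma herm_ge0 u : 0 <= herm u.
Proof.
have [->|u0] := eqVneq u 0; last exact/ltW/herm_gt0.
by rewrite /herm mulmx0 mxE.
Qed.

Variables (B : 'M[R]_m).
Hypotheses (BJ : B *m J = - (J *m B)) (Bw : B^T *m w = - (w *m B)).

Let g := w *m J.
Let selfadj (N : 'M[R]_m) := N^T *m g = g *m N.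

Let saB : selfadj B.
Proof. by rewrite /selfadj /g mulmxA Bw mulNmx -!mulmxA BJ mulmxN opprK. Qed.
Let sa1 : selfadj 1%:M.
Proof. by rewrite /selfadj trmx1 mul1mx mulmx1. Qed.
Let saD N N' : selfadj N -> selfadj N' -> selfadj (N + N').
Proof. by rewrite /selfadj => sN sN'; rewrite linearD /= mulmxDl mulmxDr sN sN'. Qed.
Let saN N : selfadj N -> selfadj (- N).
Proof. by rewrite /selfadj => sN; rewrite linearN /= mulNmx mulmxN sN. Qed.
Let saM N N' : N *m N' = N' *m N -> selfadj N -> selfadj N' -> selfadj (N *m N').
Proof.
by rewrite /selfadj => c sN sN'; rewrite trmx_mul -mulmxA sN mulmxA sN' -mulmxA -c.
Qed.
Let herm_sqr N u : selfadj N -> (u^T *m (g *m (N *m N)) *m u) 0 0 = herm (N *m u).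
Proof. exact: selfadjoint_sqr. Qed.

Let Nm := 1%:M - B.
Let Np := 1%:M + B.
(* With B = - t J A / 2, the structures [acsQ *m J *m invmx acsQ] form a curve
   of compatible structures through J with velocity A. *)
Definition acsQ : 'M[R]_m := 2^-1 *: (1%:M + Nm *m Nm).
Definition acsP : 'M[R]_m := 2^-1 *: (1%:M + Np *m Np).

Let saNm : selfadj Nm. Proof. by apply: saD => //; exact: saN. Qed.
Let saNp : selfadj Np. Proof. exact: saD. Qed.

Let Ncomm : Nm *m Np = Np *m Nm.
Proof.
have c1 : comm_mx Nm 1%:M by exact: comm_mx1.
apply: comm_mxD => //; rewrite /comm_mx /Nm !mulmxBl !mulmxBr mulmx1 mul1mx //.
Qed.

Lemma acsQP : acsQ *m acsP = acsP *m acsQ.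
Proof.
have cQ : comm_mx (1%:M + Nm *m Nm) (1%:M + Np *m Np).
  apply: comm_mxD; first exact: comm_mx1.
  apply: comm_mx_sym; apply: comm_mxD; first exact: comm_mx1.
  by apply: comm_mxM; apply: comm_mx_sym; apply: comm_mxM; exact: Ncomm.
by rewrite /acsQ /acsP -!scalemxAl -!scalemxAr cQ.
Qed.

Lemma acsQ_unit : acsQ \in unitmx.
Proof.
apply: unitmx_inj_col => u Qu; apply/eqP; apply: contraT => u0.
have : (u^T *m (g *m (1%:M + Nm *m Nm)) *m u) 0 0 = 0.
  have : (1%:M + Nm *m Nm) *m u = 0.
    move: Qu; rewrite /acsQ -scalemxAl => /eqP; rewrite scaler_eq0 invr_eq0 pnatr_eq0 /=.
    by move/eqP.
  by rewrite -!mulmxA => ->; rewrite !mulmx0 mxE.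
rewrite mulmxDr mulmx1 mulmxDr mulmxDl mxE (herm_sqr _ saNm) => E.
by have := herm_gt0 u0; have := herm_ge0 (Nm *m u); rewrite /herm -/g in E *; lra.
Qed.

Lemma acsJQ : J *m acsQ = acsP *m J.
Proof.
rewrite /acsQ /acsP -scalemxAr -scalemxAl; congr (_ *: _).
rewrite mulmxDr mulmxDl mulmx1 mul1mx; congr (_ + _).
have JN : J *m Nm = Np *m J by rewrite /Nm /Np mulmxDr mulmxDl mulmx1 mul1mx mulmxN BJ.
by rewrite mulmxA JN -!mulmxA JN.
Qed.

Lemma acsJP : J *m acsP = acsQ *m J.
Proof.
have H := congr1 (fun X => J *m X *m J) acsJQ.
rewrite /= !mulmxA J2 mulNmx mul1mx -!mulmxA J2 !mulmxN !mulmx1 mulNmx in H.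
by apply: oppr_inj; rewrite -H.
Qed.

Definition acs_conj : 'M[R]_m := acsQ *m J *m invmx acsQ.

Lemma acs_conjE : acs_conj = J + 2%:R *: (J *m B *m invmx acsQ).
Proof.
have uQ := acsQ_unit.
have -> : acs_conj = (J *m acsQ + 2%:R *: (J *m B)) *m invmx acsQ.
  rewrite /acs_conj -acsJP scalemxAr -mulmxDr; congr (_ *m _ *m _).
  rewrite /acsP /acsQ /Np /Nm !mulmxDl !mulmxDr !mulNmx !mulmxN !mulmx1 !mul1mx opprK.
  by apply/matrixP => i j; rewrite !mxE; field.
by rewrite mulmxDl mulmxK // -scalemxAl.
Qed.

Lemma acs_conj_compatible : compatible_at w acs_conj.
Proof.
have uQ := acsQ_unit; have [_ JwJ _] := cJ.
have Qw : acsQ^T *m w = w *m acsP.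
  rewrite /acsQ /acsP linearZ /= -scalemxAl -scalemxAr; congr (_ *: _).
  have Nw : Nm^T *m w = w *m Np.
    by rewrite /Nm /Np linearB /= trmx1 mulmxBl mul1mx Bw opprK mulmxDr mulmx1.
  by rewrite linearD /= trmx1 trmx_mul mulmxDl mulmxDr mul1mx mulmx1 -mulmxA Nw mulmxA Nw -mulmxA.
have Pw : acsP^T *m w = w *m acsQ.
  rewrite /acsQ /acsP linearZ /= -scalemxAl -scalemxAr; congr (_ *: _).
  have Nw : Np^T *m w = w *m Nm.
    by rewrite /Nm /Np linearD /= trmx1 mulmxDl mul1mx Bw mulmxBr mulmx1.
  by rewrite linearD /= trmx1 trmx_mul mulmxDl mulmxDr mul1mx mulmx1 -mulmxA Nw mulmxA Nw -mulmxA.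
split.
- rewrite /acs_conj !mulmxA mulmxKV // -[acsQ *m J *m J]mulmxA J2 mulmxN mulmx1 mulNmx mulmxV //.
- have -> : acs_conj = J *m acsP *m invmx acsQ by rewrite acsJP.
  have E : (J *m acsP)^T *m w *m (J *m acsP) = w *m acsP *m acsQ.
    rewrite trmx_mul -!mulmxA [w *m (J *m _)]mulmxA [J^T *m _]mulmxA [J^T *m (w *m J)]mulmxA JwJ.
    by rewrite mulmxA Pw -!mulmxA acsQP.
  move: (J *m acsP) E => X E.
  rewrite trmx_mul -[_ *m X^T *m w]mulmxA mulmxA -[_ *m (X^T *m w) *m X]mulmxA E.
  by rewrite mulmxA mulmxK // -Qw mulmxA trmx_inv mulVmx ?unitmx_tr // mul1mx.
- move=> u u0; pose v := invmx acsQ *m u.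
  have uE : u = acsQ *m v by rewrite /v mulKVmx.
  have v0 : v != 0 by apply: contraNneq u0 => v0; rewrite uE v0 mulmx0.
  have -> : u^T *m w *m acs_conj *m u = v^T *m (g *m (acsQ *m acsP)) *m v.
    rewrite /acs_conj {1}uE -!mulmxA -/v trmx_mul -mulmxA [acsQ^T *m _]mulmxA Qw /g.
    rewrite -!mulmxA; do 2 congr (_ *m _).
    have K : acsP *m acsQ *m J = J *m acsQ *m acsP by rewrite -mulmxA -acsJP mulmxA -acsJQ.
    by rewrite !mulmxA K.
  have -> : acsQ *m acsP = 2^-1 *: (2^-1 *: (1%:M + Nm *m Nm + Np *m Np + (Nm *m Np) *m (Nm *m Np))).
    rewrite /acsQ /acsP -!scalemxAl -!scalemxAr; do 2 congr (_ *: _).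
    have K a b : (1%:M + a) *m (1%:M + b) = 1%:M + a + b + a *m b :> 'M[R]_m.
      by rewrite mulmxDl mul1mx mulmxDr mulmx1 -!addrA; congr (_ + _); rewrite addrCA.
    rewrite K; congr (_ + _).
    by rewrite -!mulmxA [Np *m (Nm *m Np)]mulmxA -Ncomm !mulmxA.
  have fZ (a : R) X : (v^T *m (g *m (a *: X)) *m v) 0 0 = a * (v^T *m (g *m X) *m v) 0 0.
    by rewrite -!scalemxAr -scalemxAl mxE.
  have fD X Y : (v^T *m (g *m (X + Y)) *m v) 0 0 =
      (v^T *m (g *m X) *m v) 0 0 + (v^T *m (g *m Y) *m v) 0 0.
    by rewrite !mulmxDr mulmxDl mxE.
  rewrite !fZ !fD mulmx1.
  have saNN : selfadj (Nm *m Np) by exact: saM.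
  rewrite (herm_sqr v saNm) (herm_sqr v saNp) (herm_sqr v saNN).
  have := herm_gt0 v0; have := herm_ge0 (Nm *m v); have := herm_ge0 (Np *m v).
  have := herm_ge0 (Nm *m Np *m v); rewrite /herm -/g => h1 h2 h3 h4.
  rewrite !mulr_gt0 ?invr_gt0 //; lra.
Qed.

End PointwiseCompatibility.

Section AcsCalculus.
Context {R : realType} {n : nat} {M : compactKahlerManifold R n}.
Local Notation m := (n + n)%N.
Implicit Types (J : acs M) (A B : endo M) (F : preTopologicalLmodType R).

Lemma acs_compatible J p : compatible_at (omega p) (sval J p).
Proof. exact: (svalP J). Qed.

Lemma tangentP J A : tangent J A <->
  (forall p, A p *m sval J p = - (sval J p *m A p)) /\
  (forall p, (A p)^T *m omega p = - (omega p *m A p)).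
Proof.
split=> [H|[H1 H2] p].
  split=> p; have [H1 H2] := H p; first by apply/eqP; rewrite -addr_eq0 H1.
  by apply: ((tangent_atP (omega_skew p) (acs_compatible J p) H1).1 H2).
have AJ : A p *m sval J p + sval J p *m A p = 0 by rewrite H1 addNr.
split=> //; apply: ((tangent_atP (omega_skew p) (acs_compatible J p) AJ).2 (H2 p)).
Qed.

Lemma tangent_lin J A B (c : R) : tangent J A -> tangent J B -> tangent J (c *: A + B).
Proof.
move=> /tangentP[A1 A2] /tangentP[B1 B2]; apply/tangentP; split=> p;
  rewrite endo_valD endo_valZ.
  by rewrite mulmxDl mulmxDr -scalemxAl -scalemxAr A1 B1 opprD scalerN.
rewrite linearD linearZ /= mulmxDl mulmxDr -scalemxAl -scalemxAr A2 B2.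
by rewrite opprD scalerN.
Qed.

Lemma acsJJ J : endo_mul (sval J) (sval J) = - endo_one.
Proof. by apply: endo_eqP => p; rewrite endo_mulE; have [] := acs_compatible J p. Qed.

Lemma endo_mulA A B (C : endo M) : endo_mul A (endo_mul B C) = endo_mul (endo_mul A B) C.
Proof. by apply: endo_eqP => p; rewrite !endo_mulE mulmxA. Qed.

Lemma acs_curve J A : tangent J A -> exists (gam : R -> acs M) (K : R -> endo M),
  (forall t, sval (gam t) = sval J + t *: K t) /\ K @ (0 : R)^' --> A.
Proof.
move=> /tangentP[AJ Aw].
pose B0 : endo M := (- 2^-1) *: endo_mul (sval J) A.
pose N t : endo M := endo_one - t *: B0.
pose Q t : endo M := 2^-1 *: (endo_one + endo_mul (N t) (N t)).
have J2 p : sval J p *m sval J p = - 1%:M by have [] := acs_compatible J p.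
have B0E t p : (t *: B0) p = t *: ((- 2^-1) *: (sval J p *m A p)) by [].
have BJ t p : (t *: B0) p *m sval J p = - (sval J p *m (t *: B0) p).
  rewrite B0E -!scalemxAl -!scalemxAr -scalerN -scalerN; do 2 congr (_ *: _).
  by rewrite -mulmxA AJ mulmxN.
have Bw t p : ((t *: B0) p)^T *m omega p = - (omega p *m (t *: B0) p).
  have spZ (c : R) (X : 'M[R]_m) : X^T *m omega p = - (omega p *m X) ->
      (c *: X)^T *m omega p = - (omega p *m (c *: X)).
    by move=> H; rewrite -scalemxAr -scalerN -H scalemxAl; congr (_ *m _); exact: linearZ.
  rewrite B0E; apply/spZ/spZ.
  rewrite trmx_mul -mulmxA (compatible_trmx (acs_compatible J p)) mulmxN [(A p)^T *m _]mulmxA Aw mulNmx opprK.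
  by rewrite -!mulmxA AJ mulmxN.
have QE t p : Q t p = acsQ ((t *: B0) p) by [].
have uQ t p : Q t p \in unitmx.
  by rewrite QE; exact: (acsQ_unit (acs_compatible J p) (BJ t p) (Bw t p)).
have cE t p : (sval J + t *: endo_mul A (endo_inv (uQ t))) p
    = acs_conj (sval J p) ((t *: B0) p).
  rewrite (acs_conjE (acs_compatible J p) (BJ t p) (Bw t p)) endo_valD endo_valZ endo_mulE.
  rewrite -QE !scalemxAl B0E; congr (_ + _ *m _).
  rewrite -!scalemxAr mulmxA -!scalemxAl J2 mulNmx mul1mx !scalerN !scalerA -scaleNr; congr (_ *: _).
  by field.
have cP t p : compatible_at (omega p) ((sval J + t *: endo_mul A (endo_inv (uQ t))) p).
  rewrite cE; exact: (acs_conj_compatible (acs_compatible J p) (BJ t p) (Bw t p)).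
exists (fun t => exist _ _ (cP t)), (fun t => endo_mul A (endo_inv (uQ t))); split=> //.
have AE : endo_mul A endo_one = A by apply: endo_eqP => p; rewrite endo_mulE mulmx1.
rewrite -[X in _ --> X]AE.
apply: endo_cvgM; first exact: cvg_cst.
apply: (endo_inv_cvg1 (F := Q)) => [|t]; last exact: endo_mulC_inv.
have cN : N @ 0^' --> (endo_one : endo M).
  have E1 : endo_one + (- 0) *: B0 = endo_one :> endo M by rewrite oppr0 scale0r addr0.
  rewrite -[X in _ --> X]E1 /N; under eq_fun do rewrite -scaleNr.
  apply: endo_cvgD; first exact: cvg_cst.
  by apply: endo_cvgZ; [apply: cvgN; exact: cvg_dnbhs_id|exact: cvg_cst].
have E2 : 2^-1 *: (endo_one + endo_mul endo_one endo_one) = endo_one :> endo M.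
  apply: endo_eqP => p; rewrite endo_valZ endo_valD endo_mulE mulmx1.
  by apply/matrixP => a b; rewrite !mxE; field.
rewrite -[X in _ --> X]E2; apply: endo_cvgZ; first exact: cvg_cst.
by apply: endo_cvgD; [exact: cvg_cst|exact: endo_cvgM].
Qed.

Definition nice_space F :=
  [/\ topological_lmod F, mean_value_space F & hausdorff_space F].

Lemma nice_endo : nice_space (endo M).
Proof.
by split; [exact: topological_lmod_endo|exact: mean_value_space_endo|exact: hausdorff_endo].
Qed.

Lemma nice_R : nice_space R^o.
Proof.
by split; [exact: topological_lmod_R|exact: mean_value_space_R|exact: norm_hausdorff].
Qed.

Section Derivative.
Context {F : preTopologicalLmodType R}.
Hypothesis nF : nice_space F.
Implicit Types f : acs M -> F.

Let tE := @topological_lmod_endo R n M.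

Lemma curve_limit_ext f J A U g l (gam : R -> acs M) (K : R -> endo M) :
  local_extension f J U g -> has_dirderiv g (sval J) A l ->
  (forall t, sval (gam t) = sval J + t *: K t) -> K @ (0 : R)^' --> A ->
  (fun t => t^-1 *: (f (gam t) - f J)) @ (0 : R)^' --> l.
Proof.
have [tF mF hF] := nF.
move=> [oU UJ sg gf] gl gamE KA.
have [cg [dg [dgP [cdg _]]]] := sg 1.
rewrite (has_dirderiv_unique hF gl (dgP _ A UJ)).
have UJT : (U `*` [set: endo M]) (sval J, A) by [].
have H := strict_diff (dnbhs_filter (0 : R)) tE mF oU dgP UJ (cdg _ UJT)
  (cvg_constant (sval J) (dnbhs_filter _)) KA cvg_dnbhs_id (nbhs_dnbhs_neq (0 : R)).
have gamJ : (fun t => sval J + t *: K t) @ (0 : R)^' --> sval J.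
  rewrite -[X in _ --> X]addr0 -(scale0r A); apply: tE.1; first exact: cvg_cst.
  by apply: tE.2 => //; exact: cvg_dnbhs_id.
have nU : \forall t \near (0 : R)^', U (sval J + t *: K t).
  by apply: (cvg_near gamJ); exact: open_nbhs_nbhs.
apply: cvg_fun_ext H; apply: filterS nU => t Ut.
by rewrite -gamE !gf // gamE.
Qed.

Lemma acs_diff_ext f J A U g l : tangent J A -> local_extension f J U g ->
  has_dirderiv g (sval J) A l -> acs_diff f J A = l.
Proof.
have [tF mF hF] := nF.
move=> tA fg gl; have [gam [K [gamE KA]]] := acs_curve tA.
have H1 := curve_limit_ext fg gl gamE KA.
rewrite /acs_diff; case: xgetP => [_ -> [U' [g' [fg' gl']]]|/(_ l)[]]; last by exists U, g.
exact: (lim_unique hF _ (curve_limit_ext fg' gl' gamE KA) H1).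
Qed.

Lemma acs_diff_dirderiv f J U g (dg : endo M * endo M -> F) A : tangent J A ->
  local_extension f J U g -> (forall x h, U x -> has_dirderiv g x h (dg (x, h))) ->
  acs_diff f J A = dg (sval J, A).
Proof.
move=> tA fg dgP; have [_ UJ _ _] := fg.
by apply: (acs_diff_ext tA fg); exact: dgP.
Qed.

Lemma acs_diff_curve f J A (gam : R -> acs M) (K : R -> endo M) : acs_smooth f -> tangent J A ->
  (forall t, sval (gam t) = sval J + t *: K t) -> K @ (0 : R)^' --> A ->
  (fun t => t^-1 *: (f (gam t) - f J)) @ (0 : R)^' --> acs_diff f J A.
Proof.
move=> sf tA gamE KA; have [U [g fg]] := sf J; have [oU UJ sg gf] := fg.
have [cg [dg [dgP _]]] := sg 1.
rewrite (acs_diff_dirderiv tA fg dgP).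
by apply: curve_limit_ext gamE KA; [exact: fg|exact: dgP].
Qed.

Lemma acs_diff_unique f J A l (gam : R -> acs M) (K : R -> endo M) : acs_smooth f -> tangent J A ->
  (forall t, sval (gam t) = sval J + t *: K t) -> K @ (0 : R)^' --> A ->
  (fun t => t^-1 *: (f (gam t) - f J)) @ (0 : R)^' --> l -> acs_diff f J A = l.
Proof.
have [_ _ hF] := nF.
by move=> sf tA gamE KA; apply: (lim_unique hF); exact: acs_diff_curve gamE KA.
Qed.

End Derivative.

Lemma along_commutator F (f : acs M -> F) (X Y : field M) J : nice_space F -> acs_smooth f -> is_vfield X -> is_vfield Y ->
  acs_smooth (along X f) -> acs_smooth (along Y f) ->
  tangent J (bracket X Y J) ->
  along X (along Y f) J - along Y (along X f) J = along (bracket X Y) f J.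
Proof.
move=> nF; have [tF mF hF] := nF; have [tE mE hE] := nice_endo.
move=> sf vX vY sXf sYf tB; have [U [g fg]] := sf J; have [oU UJ sg gf] := fg.
have [cg [dg [dgP [cdg [ddg [ddgP [cddg _]]]]]]] := sg 2.
have cdg' x h : U x -> {for (x, h), continuous dg}.
  by move=> Ux; apply: cdg; split.
have cddg' (xh kl : endo M * endo M) : (U `*` [set: endo M]) xh ->
    {for (xh, kl), continuous ddg}.
  by move=> Ux; apply: cddg; split.
have D Z W : is_vfield Z -> is_vfield W -> acs_smooth (along W f) ->
    along Z (along W f) J = ddg ((sval J, W J), (Z J, 0)) + dg (sval J, along Z W J).
  move=> [sZ tZ] [sW tW] sWf; have [gam [K [gamE KZ]]] := acs_curve (tZ J).
  apply: (acs_diff_unique nF sWf (tZ J) gamE KZ).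
  have rW := acs_diff_curve nice_endo sW (tZ J) gamE KZ.
  have H := derivative_along tE tF mF hF oU dgP cdg' ddgP cddg' (y := W J)
    (dnbhs_filter (0 : R)) UJ KZ rW cvg_dnbhs_id (nbhs_dnbhs_neq (0 : R)).
  have gamJ : (fun t => sval J + t *: K t) @ (0 : R)^' --> sval J.
    rewrite -[X in _ --> X]addr0 -(scale0r (Z J)); apply: tE.1; first exact: cvg_cst.
    by apply: tE.2 => //; exact: cvg_dnbhs_id.
  have nU : \forall t \near (0 : R)^', U (sval J + t *: K t).
    by apply: (cvg_near gamJ); exact: open_nbhs_nbhs.
  apply: cvg_fun_ext H; apply: filterS2 nU (nbhs_dnbhs_neq (0 : R)) => t Ut t0.
  rewrite -gamE in Ut *; rewrite scalerA mulfV // scale1r [W J + _]addrC subrK.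
  have fgt : local_extension f (gam t) U g by split.
  by rewrite /along (acs_diff_dirderiv nF (tW _) fgt dgP) (acs_diff_dirderiv nF (tW _) fg dgP).
have cdgJ h : {for (sval J, h), continuous dg} by apply: cdg; split.
rewrite (D X Y) // (D Y X) //.
rewrite (second_derivative_sym tE tF mF hF oU dgP ddgP cddg' (X J) (Y J) UJ).
rewrite opprD addrACA subrr add0r.
rewrite -(dirderivB tE tF mF hF oU dgP _ _ UJ cdgJ).
by rewrite /along (acs_diff_dirderiv nF tB fg dgP).
Qed.

End AcsCalculus.

Section SmoothMapsOnAcs.
Context {R : realType} {n : nat} {M : compactKahlerManifold R n}.
Local Notation m := (n + n)%N.
Implicit Types (J : acs M) (A B : endo M) (F H : preTopologicalLmodType R).

Let tE := @topological_lmod_endo R n M.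

Lemma acs_smooth_bilin F F' H (b : F -> F' -> H) (f : acs M -> F) (g : acs M -> F') :
  topological_lmod H -> bilin_cts b -> acs_smooth f -> acs_smooth g ->
  acs_smooth (fun J => b (f J) (g J)).
Proof.
move=> tH bb sf sg J; have [U [f' [oU UJ sf' ff']]] := sf J.
have [V [g' [oV VJ sg' gg']]] := sg J.
exists (U `&` V), (fun A => b (f' A) (g' A)); split=> //; first exact: openI.
  move=> k; apply: frechet_Ck_bilin => //.
    exact: (frechet_Ck_sub (@subIsetl _ U V) (sf' k)).
  exact: (frechet_Ck_sub (@subIsetr _ U V) (sg' k)).
by move=> J' [UJ' VJ']; rewrite ff' // gg'.
Qed.

Lemma acs_smooth_lin F F' (L : F -> F') (f : acs M -> F) :
  lin_cts L -> acs_smooth f -> acs_smooth (fun J => L (f J)).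
Proof.
move=> lL sf J; have [U [f' [oU UJ sf' ff']]] := sf J.
exists U, (fun A => L (f' A)); split=> // [k|J' UJ']; first exact: frechet_Ck_lin_comp.
by rewrite ff'.
Qed.

Lemma acs_smoothD F (f g : acs M -> F) : topological_lmod F ->
  acs_smooth f -> acs_smooth g -> acs_smooth (fun J => f J + g J).
Proof.
move=> tF sf sg J; have [U [f' [oU UJ sf' ff']]] := sf J.
have [V [g' [oV VJ sg' gg']]] := sg J.
exists (U `&` V), (fun A => f' A + g' A); split=> //; first exact: openI.
  move=> k; apply: frechet_CkD => //.
    exact: (frechet_Ck_sub (@subIsetl _ U V) (sf' k)).
  exact: (frechet_Ck_sub (@subIsetr _ U V) (sg' k)).
by move=> J' [UJ' VJ']; rewrite ff' // gg'.
Qed.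

Lemma acs_smooth_cst F (a : F) : acs_smooth (fun _ : acs M => a).
Proof.
move=> J; exists setT, (fun _ => a); split=> //; first exact: openT.
by move=> k; exact: frechet_Ck_cst.
Qed.

Lemma acs_smooth_sval : acs_smooth (fun J : acs M => sval J).
Proof.
move=> J; exists setT, id; split=> //; first exact: openT.
by move=> k; exact: frechet_Ck_id.
Qed.

Lemma lin_cts_scale F (c : R) : topological_lmod F -> lin_cts (fun x : F => c *: x).
Proof.
move=> [_ ZF]; split=> [d x y|T G f a FG fa]; last by apply: ZF => //; exact: cvg_cst.
by rewrite scalerDr !scalerA mulrC.
Qed.

Lemma acs_smoothZ F (c : R) (f : acs M -> F) : topological_lmod F ->
  acs_smooth f -> acs_smooth (fun J => c *: f J).
Proof. by move=> tF; exact: (acs_smooth_lin (lin_cts_scale c tF)). Qed.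

Lemma acs_smoothB F (f g : acs M -> F) : topological_lmod F ->
  acs_smooth f -> acs_smooth g -> acs_smooth (fun J => f J - g J).
Proof.
move=> tF sf sg; apply: acs_smoothD => //.
have := acs_smoothZ (-1) tF sg; congr acs_smooth; apply/funext => J.
by rewrite scaleN1r.
Qed.

Lemma acs_smoothM (f g : acs M -> endo M) :
  acs_smooth f -> acs_smooth g -> acs_smooth (fun J => endo_mul (f J) (g J)).
Proof. by apply: acs_smooth_bilin => //; exact: bilin_endo_mul. Qed.

Lemma acs_diff_dirderivP F (f : acs M -> F) J A : nice_space F -> acs_smooth f -> tangent J A ->
  exists U g, local_extension f J U g /\ has_dirderiv g (sval J) A (acs_diff f J A).
Proof.
move=> nF sf tA; have [U [g fg]] := sf J; exists U, g; split=> //.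
have [oU UJ sg gf] := fg; have [cg [dg [dgP _]]] := sg 1.
by rewrite (acs_diff_dirderiv nF tA fg dgP); exact: dgP.
Qed.

Lemma acs_diff_bilin F F' H (b : F -> F' -> H) (f : acs M -> F) (g : acs M -> F') J A :
  nice_space F -> nice_space F' -> nice_space H -> bilin_cts b ->
  acs_smooth f -> acs_smooth g -> tangent J A ->
  acs_diff (fun J => b (f J) (g J)) J A = b (acs_diff f J A) (g J) + b (f J) (acs_diff g J A).
Proof.
move=> nF nF' nH bb sf sg tA; have tH : topological_lmod H by have [] := nH.
have [U [f' [[oU UJ sf' ff'] df']]] := acs_diff_dirderivP nF sf tA.
have [V [g' [[oV VJ sg' gg'] dg']]] := acs_diff_dirderivP nF' sg tA.
have ext : local_extension (fun J => b (f J) (g J)) J (U `&` V) (fun A => b (f' A) (g' A)).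
  split=> //; first exact: openI.
    move=> k; apply: frechet_Ck_bilin => //.
      exact: (frechet_Ck_sub (@subIsetl _ U V) (sf' k)).
    exact: (frechet_Ck_sub (@subIsetr _ U V) (sg' k)).
  by move=> J' [UJ' VJ']; rewrite ff' // gg'.
apply: (acs_diff_ext nH tA ext); rewrite -(ff' J UJ) -(gg' J VJ).
apply: has_dirderiv_bilin => //.
by have [cg _] := sg' 0; exact: cg.
Qed.

Lemma acs_diff_lin F F' (L : F -> F') (f : acs M -> F) J A :
  nice_space F -> nice_space F' -> lin_cts L -> acs_smooth f -> tangent J A ->
  acs_diff (fun J => L (f J)) J A = L (acs_diff f J A).
Proof.
move=> nF nF' lL sf tA.
have [U [f' [[oU UJ sf' ff'] df']]] := acs_diff_dirderivP nF sf tA.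
have ext : local_extension (fun J => L (f J)) J U (fun A => L (f' A)).
  by split=> // [k|J' UJ']; [exact: frechet_Ck_lin_comp|rewrite ff'].
by apply: (acs_diff_ext nF' tA ext); exact: has_dirderiv_lin_comp.
Qed.

Lemma acs_diffD F (f g : acs M -> F) J A :
  nice_space F -> acs_smooth f -> acs_smooth g -> tangent J A ->
  acs_diff (fun J => f J + g J) J A = acs_diff f J A + acs_diff g J A.
Proof.
move=> nF sf sg tA; have tF : topological_lmod F by have [] := nF.
have [U [f' [[oU UJ sf' ff'] df']]] := acs_diff_dirderivP nF sf tA.
have [V [g' [[oV VJ sg' gg'] dg']]] := acs_diff_dirderivP nF sg tA.
have ext : local_extension (fun J => f J + g J) J (U `&` V) (fun A => f' A + g' A).
  split=> //; first exact: openI.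
    move=> k; apply: frechet_CkD => //.
      exact: (frechet_Ck_sub (@subIsetl _ U V) (sf' k)).
    exact: (frechet_Ck_sub (@subIsetr _ U V) (sg' k)).
  by move=> J' [UJ' VJ']; rewrite ff' // gg'.
by apply: (acs_diff_ext nF tA ext); exact: has_dirderivD.
Qed.

Lemma acs_diffZ F (c : R) (f : acs M -> F) J A :
  nice_space F -> acs_smooth f -> tangent J A ->
  acs_diff (fun J => c *: f J) J A = c *: acs_diff f J A.
Proof.
by move=> nF; apply: acs_diff_lin => //; apply: lin_cts_scale; have [] := nF.
Qed.

Lemma acs_diff_sub F (f g : acs M -> F) J A :
  nice_space F -> acs_smooth f -> acs_smooth g -> tangent J A ->
  acs_diff (fun J => f J - g J) J A = acs_diff f J A - acs_diff g J A.
Proof.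
move=> nF sf sg tA; have tF : topological_lmod F by have [] := nF.
have -> : (fun J => f J - g J) = (fun J => f J + (-1) *: g J).
  by apply/funext => J'; rewrite scaleN1r.
by rewrite acs_diffD // ?acs_diffZ ?scaleN1r //; exact: acs_smoothZ.
Qed.

Lemma acs_diff_cst F (a : F) J A : nice_space F -> tangent J A ->
  acs_diff (fun _ => a) J A = 0.
Proof.
move=> nF tA; have ext : local_extension (fun _ => a) J setT (fun _ => a).
  by split=> //; [exact: openT|move=> k; exact: frechet_Ck_cst].
apply: (acs_diff_ext nF tA ext).
apply: cvg_fun_ext (cvg_cst 0); near=> t.
by rewrite subrr scaler0.
Unshelve. all: by end_near. Qed.

Lemma acs_diff_sval J A : tangent J A -> acs_diff (fun J => sval J) J A = A.
Proof.
move=> tA; have ext : local_extension (fun J => sval J) J setT id.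
  by split=> //; [exact: openT|move=> k; exact: frechet_Ck_id].
apply: (acs_diff_ext nice_endo tA ext).
apply: cvg_fun_ext (cvg_cst A); near=> t.
rewrite addrC addKr scalerA mulVf ?scale1r //.
by near: t; exact: (nbhs_dnbhs_neq (0 : R)).
Unshelve. all: by end_near. Qed.

Lemma acs_diffM (f g : acs M -> endo M) J A :
  acs_smooth f -> acs_smooth g -> tangent J A ->
  acs_diff (fun J => endo_mul (f J) (g J)) J A =
  endo_mul (acs_diff f J A) (g J) + endo_mul (f J) (acs_diff g J A).
Proof.
by apply: acs_diff_bilin; [exact: nice_endo..|exact: bilin_endo_mul].
Qed.

Lemma lin_cts_fiber (p : M) (f : 'M[R]_m -> R) :
  (forall (c : R) X Y, f (c *: X + Y) = c * f X + f Y) ->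
  lin_cts (fun A : endo M => f (A p) : R^o).
Proof.
move=> lf.
have f0 : f 0 = 0 by have := lf (-1) 0 0; rewrite scaler0 addr0 mulN1r addNr.
have fD X Y : f (X + Y) = f X + f Y by rewrite -[X]scale1r lf mul1r scale1r.
have fZ (c : R) X : f (c *: X) = c * f X by rewrite -[c *: X]addr0 lf f0 addr0.
have E X : f X = \sum_i \sum_j X i j * f (delta_mx i j).
  rewrite {1}[X]matrix_sum_delta (big_morph f fD f0); apply: eq_bigr => i _.
  by rewrite (big_morph f fD f0); apply: eq_bigr => j _; rewrite fZ.
split=> [c A B|T G F A FG FA]; first by rewrite endo_valD endo_valZ lf.
rewrite E; under eq_fun do rewrite E.
apply: cvg_big => [|i _]; first exact: add_continuous.
apply: cvg_big => [|j _]; first exact: add_continuous.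
by apply: (@cvgMr_tmp _ _ _ FG); exact: ((lin_cts_eval p i j).2 T G F A FG FA).
Qed.

End SmoothMapsOnAcs.

Section Commutator.
Context {R : realType} {n : nat} {M : compactKahlerManifold R n}.
Implicit Types (A B C : endo M).

(* Locked, so that rewriting with linearity does not see through it. *)
Definition com A B : endo M := locked (endo_mul A B - endo_mul B A).

Lemma comE A B : com A B = endo_mul A B - endo_mul B A.
Proof. by rewrite /com -lock. Qed.

Lemma endo_mulDl A B C : endo_mul (A + B) C = endo_mul A C + endo_mul B C.
Proof. by apply: endo_eqP => p; rewrite endo_valD !endo_mulE !endo_valD mulmxDl. Qed.

Lemma endo_mulDr A B C : endo_mul C (A + B) = endo_mul C A + endo_mul C B.
Proof. by apply: endo_eqP => p; rewrite endo_valD !endo_mulE !endo_valD mulmxDr. Qed.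

Lemma endo_mulNl A B : endo_mul (- A) B = - endo_mul A B.
Proof. by apply: endo_eqP => p; rewrite endo_valN !endo_mulE !endo_valN mulNmx. Qed.

Lemma endo_mulNr A B : endo_mul A (- B) = - endo_mul A B.
Proof. by apply: endo_eqP => p; rewrite endo_valN !endo_mulE !endo_valN mulmxN. Qed.

Lemma endo_mulZl (c : R) A B : endo_mul (c *: A) B = c *: endo_mul A B.
Proof. by apply: endo_eqP => p; rewrite endo_valZ !endo_mulE !endo_valZ scalemxAl. Qed.

Lemma endo_mulZr (c : R) A B : endo_mul A (c *: B) = c *: endo_mul A B.
Proof. by apply: endo_eqP => p; rewrite endo_valZ !endo_mulE !endo_valZ scalemxAr. Qed.

Lemma endo_mul0l A : endo_mul 0 A = 0.
Proof. by rewrite -(subrr A) endo_mulDl endo_mulNl !subrr. Qed.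

Lemma endo_mul0r A : endo_mul A 0 = 0.
Proof. by rewrite -(subrr A) endo_mulDr endo_mulNr !subrr. Qed.

Lemma endo_mul1l A : endo_mul endo_one A = A.
Proof. by apply: endo_eqP => p; rewrite endo_mulE mul1mx. Qed.

Lemma comDl A B C : com (A + B) C = com A C + com B C.
Proof. by rewrite !comE endo_mulDl endo_mulDr opprD addrACA. Qed.

Lemma comDr A B C : com C (A + B) = com C A + com C B.
Proof. by rewrite !comE endo_mulDl endo_mulDr opprD addrACA. Qed.

Lemma comNl A B : com (- A) B = - com A B.
Proof. by rewrite !comE endo_mulNl endo_mulNr opprB opprK addrC. Qed.

Lemma comNr A B : com B (- A) = - com B A.
Proof. by rewrite !comE endo_mulNl endo_mulNr opprB opprK addrC. Qed.

Lemma comZr (c : R) A B : com B (c *: A) = c *: com B A.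
Proof. by rewrite !comE endo_mulZl endo_mulZr scalerBr. Qed.

Lemma com_jacobi A B C : com A (com B C) - com B (com A C) = com (com A B) C.
Proof.
rewrite !comE !(endo_mulDl, endo_mulDr, endo_mulNl, endo_mulNr, endo_mulA).
apply: endo_eqP => p; rewrite !(endo_valD, endo_valN).
by apply/matrixP => i j; rewrite !mxE; ring.
Qed.

Lemma com_leibniz A B C : com A (endo_mul B C) = endo_mul (com A B) C + endo_mul B (com A C).
Proof.
rewrite !comE !(endo_mulDl, endo_mulDr, endo_mulNl, endo_mulNr, endo_mulA).
by rewrite addrA subrK.
Qed.

End Commutator.

Section Connection.
Context {R : realType} {n : nat} {M : compactKahlerManifold R n}.
Local Notation m := (n + n)%N.
Implicit Types (J : acs M) (A B : endo M) (X Y Z W : field M) (f g : acs M -> endo M).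

Let tE := @topological_lmod_endo R n M.
Let nE := @nice_endo R n M.

Lemma anticomm J A : tangent J A -> endo_mul A (sval J) = - endo_mul (sval J) A.
Proof. by move=> /tangentP[H _]; apply: endo_eqP => p; rewrite endo_valN !endo_mulE. Qed.

Lemma mulJJ J A : endo_mul (sval J) (endo_mul (sval J) A) = - A.
Proof. by rewrite endo_mulA acsJJ endo_mulNl endo_mul1l. Qed.

Lemma tangent_mulJ J A : tangent J A -> tangent J (endo_mul (sval J) A).
Proof.
move=> tA; have [H1 H2] := (tangentP J A).1 tA; apply/tangentP; split=> p; rewrite endo_mulE.
  by rewrite -mulmxA H1 mulmxN.
rewrite trmx_mul -mulmxA (compatible_trmx (acs_compatible J p)) mulmxN [(A p)^T *m _]mulmxA H2.
rewrite mulNmx opprK.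
by rewrite -!mulmxA H1 mulmxN.
Qed.

Lemma tangentB J A B : tangent J A -> tangent J B -> tangent J (A - B).
Proof. by move=> tA tB; rewrite addrC -scaleN1r; exact: tangent_lin. Qed.

Lemma tangent0 J : tangent J 0.
Proof.
apply/tangentP; split=> p; have -> : (0 : endo M) p = 0 by [].
  by rewrite mulmx0 mul0mx oppr0.
by rewrite trmx0 mulmx0 mul0mx oppr0.
Qed.

Lemma tangentZ J (c : R) A : tangent J A -> tangent J (c *: A).
Proof. by move=> tA; rewrite -[c *: A]addr0; apply: tangent_lin => //; exact: tangent0. Qed.

Lemma vfieldB X Y : is_vfield X -> is_vfield Y -> is_vfield (fun J => X J - Y J).
Proof.
by move=> [sX tX] [sY tY]; split=> [|J]; [exact: acs_smoothB|exact: tangentB].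
Qed.

Lemma vfieldJ X : is_vfield X -> is_vfield (fieldJ X).
Proof.
move=> [sX tX]; split=> [|J]; last exact: tangent_mulJ.
by apply: acs_smoothM => //; exact: acs_smooth_sval.
Qed.

(* Every tangent vector at a point extends to a vector field, by orthogonal projection
   of a constant field. *)
Lemma vfield_extend J A : tangent J A -> exists2 Z, is_vfield Z & Z J = A.
Proof.
move=> tA; have [A1 A2] := (tangentP J A).1 tA.
pose Z : field M := fun J' => 2^-1 *: (A + endo_mul (sval J') (endo_mul A (sval J'))).
exists Z; last first.
  rewrite /Z (anticomm tA) endo_mulNr mulJJ opprK; apply: endo_eqP => p.
  by apply/matrixP => i j; rewrite !mxE; field.
split=> [|J'].
  apply: acs_smoothZ => //; apply: acs_smoothD => //; first exact: acs_smooth_cst.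
  apply: acs_smoothM; first exact: acs_smooth_sval.
  by apply: acs_smoothM; [exact: acs_smooth_cst|exact: acs_smooth_sval].
apply: tangentZ; apply/tangentP; split=> p; rewrite endo_valD !endo_mulE.
  have [J2 _ _] := acs_compatible J' p.
  rewrite mulmxDl mulmxDr [sval J' p *m (sval J' p *m _)]mulmxA J2 mulNmx mul1mx opprD opprK.
  by rewrite -!mulmxA J2 !mulmxN mulmx1 addrC.
have cJ := compatible_trmx (acs_compatible J' p).
rewrite linearD /= !trmx_mul mulmxDl mulmxDr A2 opprD; congr (_ + _).
rewrite -!mulmxA cJ !mulmxN [(A p)^T *m _]mulmxA A2 mulNmx mulmxN opprK.
by rewrite -mulmxA [_^T *m (omega p *m _)]mulmxA cJ mulNmx -mulmxA.
Qed.

(* The derivation d_X - [J X, _]/2 of the algebra of End(TM)-valued maps; it kills J. *)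
Definition covd X f : acs M -> endo M :=
  fun J => along X f J - 2^-1 *: com (endo_mul (sval J) (X J)) (f J).

Lemma covd_mul X f g J : is_vfield X -> acs_smooth f -> acs_smooth g ->
  covd X (fun J => endo_mul (f J) (g J)) J = endo_mul (covd X f J) (g J) + endo_mul (f J) (covd X g J).
Proof.
move=> [sX tX] sf sg; rewrite /covd /along acs_diffM // com_leibniz.
move: (com _ (f J)) (com _ (g J)) => cf cg.
rewrite endo_mulDl endo_mulDr endo_mulNl endo_mulNr endo_mulZl endo_mulZr scalerDr opprD.
by rewrite addrACA.
Qed.

Lemma covd_sub X f g J : is_vfield X -> acs_smooth f -> acs_smooth g ->
  covd X (fun J => f J - g J) J = covd X f J - covd X g J.
Proof.
move=> [sX tX] sf sg; rewrite /covd /along acs_diff_sub // comDr comNr.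
move: (com _ (f J)) (com _ (g J)) => cf cg.
by rewrite scalerDr scalerN !opprD !opprK addrACA.
Qed.

Lemma covd_com X f g J : is_vfield X -> acs_smooth f -> acs_smooth g ->
  covd X (fun J => com (f J) (g J)) J = com (covd X f J) (g J) + com (f J) (covd X g J).
Proof.
move=> vX sf sg; under [X in covd _ X _]eq_fun do rewrite comE.
rewrite covd_sub //; try exact: acs_smoothM.
by rewrite !covd_mul // !comE opprD [- _ + - _]addrC addrACA.
Qed.

Lemma covdZ X (c : R) f J : is_vfield X -> acs_smooth f ->
  covd X (fun J => c *: f J) J = c *: covd X f J.
Proof.
move=> [sX tX] sf; rewrite /covd /along acs_diffZ // comZr.
by move: (com _ _) => cf; rewrite scalerBr !scalerA mulrC.
Qed.

Lemma covd_sval X J : is_vfield X -> covd X (fun J => sval J) J = 0.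
Proof.
move=> [sX tX]; rewrite /covd /along acs_diff_sval // !comE -endo_mulA (anticomm (tX J)).
rewrite endo_mulNr mulJJ opprK; apply: endo_eqP => p; apply/matrixP => i j.
by rewrite !mxE; field.
Qed.

Lemma covd_tangent X Y J : is_vfield X -> is_vfield Y -> tangent J (covd X Y J).
Proof.
move=> vX vY; have [[sX tX] [sY tY]] := (vX, vY); have sS := @acs_smooth_sval R n M.
have H1 : endo_mul (covd X Y J) (sval J) = - endo_mul (sval J) (covd X Y J).
  have E : covd X (fun J => endo_mul (Y J) (sval J)) J =
           covd X (fun J => (-1) *: endo_mul (sval J) (Y J)) J.
    by congr (covd X _ J); apply/funext => J'; rewrite (anticomm (tY J')) scaleN1r.
  move: E; rewrite covdZ //; last exact: acs_smoothM.
  rewrite !covd_mul // covd_sval // scaleN1r.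
  by rewrite endo_mul0r endo_mul0l addr0 add0r.
apply/tangentP; split=> p.
  by have := congr1 (fun A : endo M => A p) H1; rewrite endo_valN !endo_mulE.
have [X1 X2] := (tangentP _ _).1 (tX J); have [Y1 Y2] := (tangentP _ _).1 (tY J).
have dE : (along X Y J p)^T *m omega p = - (omega p *m along X Y J p).
  apply/eqP; rewrite -addr_eq0; apply/eqP/matrixP => i j.
  pose phi (B : 'M[R]_m) : R := (B^T *m omega p + omega p *m B) i j.
  have phiL (c : R) (A B : 'M[R]_m) : phi (c *: A + B) = c * phi A + phi B.
    rewrite /phi linearD linearZ /= mulmxDl mulmxDr -scalemxAl -scalemxAr addrACA -scalerDr.
    by rewrite !mxE.
  have lf := lin_cts_fiber p phiL.
  rewrite -[LHS](acs_diff_lin nE nice_R lf sY (tX J)).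
  have -> : (fun J0 => ((Y J0 p)^T *m omega p + omega p *m Y J0 p) i j) = fun=> 0.
    by apply/funext => J'; have [_ ->] := (tangentP _ _).1 (tY J'); rewrite addNr mxE.
  by rewrite (acs_diff_cst _ nice_R (tX J)) mxE.
have [T1 T2] := (tangentP _ _).1 (tangent_mulJ (tX J)).
rewrite /covd endo_valB endo_valZ comE endo_valB.
move: (endo_mul _ (X J)) T2 => T T2; rewrite !endo_mulE.
have trD (A B : 'M[R]_m) : (A - B)^T = A^T - B^T by exact: linearB.
have trZ (c : R) (A : 'M[R]_m) : (c *: A)^T = c *: A^T by exact: linearZ.
have CE (U V : 'M[R]_m) : U^T *m omega p = - (omega p *m U) ->
    V^T *m omega p = - (omega p *m V) ->
    (U *m V - V *m U)^T *m omega p = - (omega p *m (U *m V - V *m U)).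
  move=> HU HV; rewrite trD !trmx_mul mulmxBl -!mulmxA HU HV !mulmxN.
  by rewrite [V^T *m _]mulmxA [U^T *m _]mulmxA HU HV !mulNmx !opprK mulmxBr opprB !mulmxA.
rewrite trD trZ mulmxBl dE -scalemxAl CE //.
by rewrite scalerN opprK [in RHS]mulmxBr -scalemxAr opprB addrC.
Qed.

End Connection.

Ltac endo_linear :=
  apply: endo_eqP => p; apply/matrixP => i j;
  rewrite !(endo_valD, endo_valN, endo_valZ) !mxE; field.

Section LeviCivita.
Context {R : realType} {n : nat} {M : compactKahlerManifold R n}.
Local Notation m := (n + n)%N.
Implicit Types (J : acs M) (A B C : endo M) (X Y Z W : field M).
Variable mu : {measure set (g_sigma_algebraType (@open M)) -> \bar R}.
Hypothesis linI : lin_cts (fun C : endo M => \int[mu]_p \tr (C p) : R^o).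
Hypothesis posG : forall J A, tangent J A -> A != 0 -> 0 < metric mu A A.
Variable nabla : field M -> field M -> field M.
Hypothesis LC : levi_civita mu nabla.

Let tE := @topological_lmod_endo R n M.
Let nE := @nice_endo R n M.

Lemma metricC A B : metric mu A B = metric mu B A.
Proof.
rewrite /metric; congr (_ * Rintegral _ _ _); apply/funext => p.
exact: mxtrace_mulC.
Qed.

Lemma bilin_metric : bilin_cts (fun A B : endo M => metric mu A B : R^o).
Proof.
have [bl br bc] := @bilin_endo_mul R n M.
have ME A B : metric mu A B = 2^-1 * (\int[mu]_p \tr (endo_mul A B p) : R) by [].
split=> [c A B C|c A B C|T G f g A B FG fA gB].
- by rewrite !ME bl linI.1 mulrDr; congr (_ + _); exact: mulrCA.
- by rewrite !ME br linI.1 mulrDr; congr (_ + _); exact: mulrCA.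
- have H := linI.2 _ _ _ _ FG (bc _ _ _ _ _ _ FG fA gB).
  by apply: (@cvgMl_tmp _ _ _ FG); exact: H.
Qed.

Lemma metricDl A B C : metric mu (A + B) C = metric mu A C + metric mu B C.
Proof. by have [H _ _] := bilin_metric; have := H 1 A B C; rewrite !scale1r. Qed.

Lemma metricBl A B C : metric mu (A - B) C = metric mu A C - metric mu B C.
Proof. exact: (bilin_ctsBl A B C bilin_metric). Qed.

Lemma metricBr A B C : metric mu C (A - B) = metric mu C A - metric mu C B.
Proof. by rewrite ![metric mu C _]metricC metricBl. Qed.

Lemma metricZl (c : R) A B : metric mu (c *: A) B = c * metric mu A B.
Proof. exact: (bilin_ctsZl c A B bilin_metric). Qed.

Lemma metricZr (c : R) A B : metric mu A (c *: B) = c * metric mu A B.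
Proof. by rewrite ![metric mu A _]metricC metricZl. Qed.

Lemma metric_com A B C : metric mu (com A B) C + metric mu B (com A C) = 0.
Proof.
rewrite !comE metricBl metricBr.
have E1 : metric mu (endo_mul A B) C = metric mu B (endo_mul C A).
  rewrite /metric; congr (_ * Rintegral _ _ _); apply/funext => p /=.
  by rewrite -mulmxA mxtrace_mulC mulmxA.
have E2 : metric mu (endo_mul B A) C = metric mu B (endo_mul A C).
  by rewrite /metric; congr (_ * Rintegral _ _ _); apply/funext => p /=; rewrite mulmxA.
by rewrite E1 E2 addrC subrKA subrr.
Qed.

Lemma along_fieldG X Y Z J : is_vfield X -> is_vfield Y -> is_vfield Z ->
  along X (fieldG mu Y Z) J = metric mu (covd X Y J) (Z J) + metric mu (Y J) (covd X Z J).
Proof.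
move=> [sX tX] [sY _] [sZ _].
rewrite /along /fieldG (acs_diff_bilin nE nE nice_R bilin_metric sY sZ (tX J)).
have := metric_com (endo_mul (sval J) (X J)) (Y J) (Z J); rewrite /covd.
move: (com _ (Y J)) (com _ (Z J)) => cY cZ E.
rewrite metricBl metricBr metricZl metricZr; move: E.
rewrite -[acs_diff Y J _]/(along X Y J) -[acs_diff Z J _]/(along X Z J).
set a := metric mu cY _; set b := metric mu _ cZ.
set c := metric mu _ (Z J); set d := metric mu (Y J) _.
by move=> E; change (c + d = c - 2^-1 * a + (d - 2^-1 * b) :> R); lra.
Qed.

Lemma covd_torsion_free X Y J : is_vfield X -> is_vfield Y ->
  covd X Y J - covd Y X J = bracket X Y J.
Proof.
move=> [_ tX] [_ tY].
have E : com (endo_mul (sval J) (X J)) (Y J) = com (endo_mul (sval J) (Y J)) (X J).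
  rewrite !comE !endo_mulA !(anticomm (tX J)) !(anticomm (tY J)) !endo_mulNl !opprK.
  by rewrite addrC.
by rewrite /covd E /bracket opprB addrA subrK.
Qed.

Lemma nabla_covd X Y : is_vfield X -> is_vfield Y -> nabla X Y = covd X Y.
Proof.
pose S X Y J := nabla X Y J - covd X Y J.
have Ssym V W J : is_vfield V -> is_vfield W -> S V W J = S W V J.
  move=> vV vW; have := congr1 (fun f : field M => f J) (nabla_torsion_free LC vV vW).
  rewrite /= -(covd_torsion_free J vV vW) => /eqP; rewrite subr_eq => /eqP E; rewrite /S E.
  by rewrite addrAC [covd V W J - _]addrC addrK addrC.
have Sskew V W Z J : is_vfield V -> is_vfield W -> is_vfield Z ->
    metric mu (S V W J) (Z J) = - metric mu (W J) (S V Z J).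
  move=> vV vW vZ; have := congr1 (fun f => f J) (nabla_metric LC vV vW vZ).
  rewrite /= along_fieldG // /fieldG /S metricBl metricBr => E.
  have {}E : metric mu (covd V W J) (Z J) + metric mu (W J) (covd V Z J) =
    metric mu (nabla V W J) (Z J) + metric mu (W J) (nabla V Z J) :> R := E.
  lra.
have S0 V W Z J : is_vfield V -> is_vfield W -> is_vfield Z ->
    metric mu (S V W J) (Z J) = 0.
  move=> vV vW vZ.
  have : metric mu (S V W J) (Z J) = - metric mu (S V W J) (Z J).
    rewrite {1}Sskew // (Ssym V Z) // metricC Sskew // opprK (Ssym Z W) // metricC Sskew //.
    by rewrite (Ssym W V) // metricC.
  lra.
move=> vX vY; apply/funext => J; apply/eqP; rewrite -subr_eq0; apply: contraT => SJ0.
have tS : tangent J (S X Y J).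
  by apply: tangentB; [have [_] := nabla_field LC vX vY|exact: covd_tangent].
have [Z vZ ZJ] := vfield_extend tS.
by have := posG tS SJ0; rewrite -{2}ZJ S0 // ltxx.
Qed.

Lemma acs_smooth_com (f g : acs M -> endo M) :
  acs_smooth f -> acs_smooth g -> acs_smooth (fun J => com (f J) (g J)).
Proof.
move=> sf sg; under eq_fun do rewrite comE.
by apply: acs_smoothB => //; exact: acs_smoothM.
Qed.

Lemma acs_smooth_JX X : is_vfield X -> acs_smooth (fun J => endo_mul (sval J) (X J)).
Proof. by move=> [sX _]; apply: acs_smoothM => //; exact: acs_smooth_sval. Qed.

Lemma along_smooth X Y : is_vfield X -> is_vfield Y -> acs_smooth (along X Y).
Proof.
move=> vX vY.
have -> : along X Y = fun J => nabla X Y J + 2^-1 *: com (endo_mul (sval J) (X J)) (Y J).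
  by apply/funext => J; rewrite nabla_covd // /covd subrK.
apply: acs_smoothD => //; first by have [] := nabla_field LC vX vY.
by apply: acs_smoothZ => //; apply: acs_smooth_com; [exact: acs_smooth_JX|have [] := vY].
Qed.

Lemma bracket_vfield X Y : is_vfield X -> is_vfield Y -> is_vfield (bracket X Y).
Proof.
move=> vX vY; rewrite -(nabla_torsion_free LC vX vY).
by apply: vfieldB; apply: (nabla_field LC).
Qed.

Lemma nablaJ X Y J : is_vfield X -> is_vfield Y ->
  nabla X (fieldJ Y) J = endo_mul (sval J) (nabla X Y J).
Proof.
move=> vX vY; have [sY _] := vY; rewrite !nabla_covd //; last exact: vfieldJ.
by rewrite covd_mul //; [rewrite covd_sval // endo_mul0l add0r|exact: acs_smooth_sval].
Qed.

Lemma complex_parallel : complex_structure_parallel nabla.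
Proof. by move=> X Y vX vY J; rewrite nablaJ // subrr. Qed.

Lemma curvature_vfield X Y Z : is_vfield X -> is_vfield Y -> is_vfield Z ->
  is_vfield (curvature nabla X Y Z).
Proof.
move=> vX vY vZ; have nf := nabla_field LC.
by apply: vfieldB; [apply: vfieldB; apply: (nf) => //; exact: nf|apply: (nf) => //; exact: bracket_vfield].
Qed.

Lemma com_JX_JY X Y J : is_vfield X -> is_vfield Y ->
  com (endo_mul (sval J) (X J)) (endo_mul (sval J) (Y J)) = com (X J) (Y J).
Proof.
move=> [_ tX] [_ tY].
have E A B : tangent J A -> endo_mul (endo_mul (sval J) A) (endo_mul (sval J) B) = endo_mul A B.
  move=> tA; rewrite endo_mulA -[endo_mul (endo_mul _ A) _]endo_mulA (anticomm tA).
  by rewrite endo_mulNr mulJJ opprK.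
by rewrite !comE !E.
Qed.

Lemma curvatureE X Y Z J : is_vfield X -> is_vfield Y -> is_vfield Z ->
  curvature nabla X Y Z J = (- 4^-1) *: com (com (X J) (Y J)) (Z J).
Proof.
move=> vX vY vZ; have vB := bracket_vfield vX vY; have [sZ _] := vZ.
have nf := nabla_field LC.
have two U V : is_vfield U -> is_vfield V -> nabla U (nabla V Z) J =
    along U (along V Z) J
    - 2^-1 *: com (endo_mul (U J) (V J) + endo_mul (sval J) (along U V J)) (Z J)
    - 2^-1 *: com (endo_mul (sval J) (V J)) (along U Z J)
    - 2^-1 *: com (endo_mul (sval J) (U J)) (along V Z J)
    + 4^-1 *: com (endo_mul (sval J) (U J)) (com (endo_mul (sval J) (V J)) (Z J)).
  move=> vU vV; rewrite (nabla_covd vU); last exact: nf.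
  have [[sU tU] [sV tV]] := (vU, vV); have sS := @acs_smooth_sval R n M.
  have sJV := acs_smooth_JX vV; have sc := acs_smooth_com sJV sZ.
  have d1 : acs_diff (fun J => com (endo_mul (sval J) (V J)) (Z J)) J (U J) =
      com (endo_mul (U J) (V J) + endo_mul (sval J) (along U V J)) (Z J) +
      com (endo_mul (sval J) (V J)) (along U Z J).
    under eq_fun do rewrite comE.
    rewrite (acs_diff_sub nE (acs_smoothM sJV sZ) (acs_smoothM sZ sJV) (tU J)).
    rewrite (acs_diffM sJV sZ (tU J)) (acs_diffM sZ sJV (tU J)) (acs_diffM sS sV (tU J)).
    rewrite (acs_diff_sval (tU J)) !comE opprD -/(along U V J) -/(along U Z J).
    by rewrite [- endo_mul (along U Z J) _ + _]addrC addrACA.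
  have d2 : along U (covd V Z) J = along U (along V Z) J -
      2^-1 *: acs_diff (fun J => com (endo_mul (sval J) (V J)) (Z J)) J (U J).
    rewrite -(acs_diffZ _ nE sc (tU J)).
    by rewrite -(acs_diff_sub nE (along_smooth vV vZ) (acs_smoothZ _ tE sc) (tU J)).
  rewrite (nabla_covd vV vZ) {1}/covd d2 d1 {1}/covd comDr comNr comZr.
  move: (along U (along V Z) J) (com _ (along V Z J)) (com _ (com _ _)) (com _ (Z J)) (com _ (along U Z J)).
  by move=> a1 a2 a3 a4 a5; endo_linear.
rewrite /curvature (two X Y) // (two Y X) // (nabla_covd vB vZ) /covd.
have -> : along (bracket X Y) Z J = along X (along Y Z) J - along Y (along X Z) J.
  symmetry; exact: (along_commutator nE sZ vX vY (along_smooth vX vZ) (along_smooth vY vZ) (vB.2 J)).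
have := com_jacobi (endo_mul (sval J) (X J)) (endo_mul (sval J) (Y J)) (Z J).
rewrite com_JX_JY // => /eqP; rewrite subr_eq => /eqP ->.
have E : com (endo_mul (sval J) (bracket X Y J)) (Z J) =
    com (endo_mul (X J) (Y J) + endo_mul (sval J) (along X Y J)) (Z J) -
    com (endo_mul (Y J) (X J) + endo_mul (sval J) (along Y X J)) (Z J) -
    com (com (X J) (Y J)) (Z J).
  rewrite /bracket -comNl -!comDl -comNl -comDl; congr com.
  rewrite !comE endo_mulDr endo_mulNr.
  have key (a1 a2 a3 a4 : endo M) : a1 - a2 = a3 + a1 - (a4 + a2) - (a3 - a4) by endo_linear.
  exact: key.
rewrite E.
have key (a1 a2 a3 a4 a5 a6 a7 a8 : endo M) :
    a1 - 2^-1 *: a2 - 2^-1 *: a3 - 2^-1 *: a4 + 4^-1 *: (a5 + a6) -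
    (a7 - 2^-1 *: a8 - 2^-1 *: a4 - 2^-1 *: a3 + 4^-1 *: a6) -
    (a1 - a7 - 2^-1 *: (a2 - a8 - a5)) = (- 4^-1) *: a5 by endo_linear.
exact: key.
Qed.

Lemma curvature_is_parallel : curvature_parallel nabla.
Proof.
move=> W X Y Z vW vX vY vZ J; have nf := nabla_field LC.
rewrite (nabla_covd vW (curvature_vfield vX vY vZ)).
have -> : curvature nabla X Y Z = fun J => (- 4^-1) *: com (com (X J) (Y J)) (Z J).
  by apply/funext => J'; exact: curvatureE.
have [[[sX _] [sY _]] [sZ _]] := (vX, vY, vZ).
have sXY := acs_smooth_com sX sY.
rewrite covdZ //; last exact: acs_smooth_com.
rewrite !covd_com // !curvatureE //; try exact: nf.
rewrite !nabla_covd // comDl !scalerDr.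
have key (a b c : endo M) : a + b + c - a - b - c = 0 by endo_linear.
exact: key.
Qed.

Lemma bracket_nabla X Y J : is_vfield X -> is_vfield Y ->
  bracket X Y J = nabla X Y J - nabla Y X J.
Proof. by move=> vX vY; rewrite -(nabla_torsion_free LC vX vY). Qed.

Lemma metricJJ J A B : tangent J A ->
  metric mu (endo_mul (sval J) A) (endo_mul (sval J) B) = metric mu A B.
Proof.
move=> /tangentP[AJ _]; rewrite /metric; congr (_ * Rintegral _ _ _); apply/funext => p.
have [J2 _ _] := acs_compatible J p.
rewrite !endo_mulE -mulmxA [A p *m _]mulmxA AJ mulNmx mulmxN.
by rewrite -[sval J p *m A p *m _]mulmxA [sval J p *m (sval J p *m _)]mulmxA J2 mulNmx mul1mx opprK.
Qed.

Lemma fundamental_form_skew J A B : tangent J A ->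
  metric mu (endo_mul (sval J) A) B = - metric mu (endo_mul (sval J) B) A.
Proof.
move=> tA; rewrite -(metricJJ B (tangent_mulJ tA)).
have -> : endo_mul (sval J) (endo_mul (sval J) A) = (-1) *: A by rewrite mulJJ scaleN1r.
by rewrite metricZl mulN1r metricC.
Qed.

Lemma nijenhuis_eq0 X Y J : is_vfield X -> is_vfield Y ->
  bracket (fieldJ X) (fieldJ Y) J - fieldJ (bracket (fieldJ X) Y) J
  - fieldJ (bracket X (fieldJ Y)) J - bracket X Y J = 0.
Proof.
move=> vX vY; have [vJX vJY] := (vfieldJ vX, vfieldJ vY).
have mJB A B : endo_mul (sval J) (A - B) = endo_mul (sval J) A - endo_mul (sval J) B.
  by rewrite endo_mulDr endo_mulNr.
have E1 := bracket_nabla J vJX vJY; rewrite (nablaJ J vJX vY) (nablaJ J vJY vX) in E1.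
have E2 : endo_mul (sval J) (bracket (fieldJ X) Y J) =
    endo_mul (sval J) (nabla (fieldJ X) Y J) - - nabla Y X J.
  by rewrite (bracket_nabla J vJX vY) (nablaJ J vY vX) mJB mulJJ.
have E3 : endo_mul (sval J) (bracket X (fieldJ Y) J) =
    - nabla X Y J - endo_mul (sval J) (nabla (fieldJ Y) X J).
  by rewrite (bracket_nabla J vX vJY) (nablaJ J vX vY) mJB mulJJ.
have key (u1 u2 u3 u4 a b c d : endo M) : u1 = a - b -> u2 = a - - d -> u3 = - c - b ->
    u4 = c - d -> u1 - u2 - u3 - u4 = 0 by do 4 move=> ->; endo_linear.
exact: key E1 E2 E3 (bracket_nabla J vX vY).
Qed.

Lemma fundamental_form_closed X Y Z J : is_vfield X -> is_vfield Y -> is_vfield Z ->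
  along X (kahler_form mu Y Z) J + along Y (kahler_form mu Z X) J
  + along Z (kahler_form mu X Y) J - kahler_form mu (bracket X Y) Z J
  - kahler_form mu (bracket Y Z) X J - kahler_form mu (bracket Z X) Y J = 0.
Proof.
pose Om A B : R := metric mu (endo_mul (sval J) A) B.
have nf := nabla_field LC.
have skew U V : is_vfield U -> forall B, Om (U J) B = - Om B (U J).
  by move=> vU B; apply: fundamental_form_skew; exact: vU.2.
have D U V W : is_vfield U -> is_vfield V -> is_vfield W ->
    along U (kahler_form mu V W) J = Om (nabla U V J) (W J) - Om (nabla U W J) (V J) :> R.
  move=> vU vV vW; have := congr1 (fun f => f J) (nabla_metric LC vU (vfieldJ vV) vW).
  rewrite /= => ->; rewrite /fieldG nablaJ //; congr (_ + _).
  by rewrite (@fundamental_form_skew J (V J)) //; exact: vV.2.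
have B U V W : is_vfield U -> is_vfield V ->
    kahler_form mu (bracket U V) W J = Om (nabla U V J) (W J) - Om (nabla V U J) (W J) :> R.
  move=> vU vV; rewrite /Om -metricBl -endo_mulNr -endo_mulDr -bracket_nabla //.
move=> vX vY vZ.
have key (u1 u2 u3 u4 u5 u6 a b c d e f : R) : u1 = a - b -> u2 = c - d -> u3 = e - f ->
    u4 = a - d -> u5 = c - f -> u6 = e - b -> u1 + u2 + u3 - u4 - u5 - u6 = 0 :> R.
  by do 6 move=> ->; ring.
exact: (key _ _ _ _ _ _ _ _ _ _ _ _ (D _ _ _ vX vY vZ) (D _ _ _ vY vZ vX) (D _ _ _ vZ vX vY)
  (B _ _ Z vX vY) (B _ _ X vY vZ) (B _ _ Y vZ vX)).
Qed.

Lemma levi_civita_kahler : formally_kahler mu.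
Proof.
split.
- exact: vfieldJ.
- by move=> X vX; apply/funext => J; exact: mulJJ.
- by move=> X Y vX vY J; exact: nijenhuis_eq0.
- by move=> X Y [sX _] [sY _]; apply: acs_smooth_bilin => //;
    [exact: topological_lmod_R|exact: bilin_metric].
- by move=> J c A A' B _ _ _; rewrite metricDl metricZl.
- by move=> J A B _ _; exact: metricC.
- exact: posG.
- by move=> J A B tA _; exact: metricJJ.
- by move=> X Y Z vX vY vZ J; exact: fundamental_form_closed.
Qed.

Lemma kahler_symmetric : [/\ complex_structure_parallel nabla, curvature_parallel nabla
    & formally_symmetric_kahler mu nabla].
Proof.
split; [exact: complex_parallel|exact: curvature_is_parallel|split; [exact: levi_civita_kahler|exact: curvature_is_parallel]].
Qed.

End LeviCivita.

(** * Positivity of traces and Pfaffians *)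

Section PositiveHermitian.
Context {C : numClosedFieldType} {n : nat}.
Local Open Scope sesquilinear_scope.
Variable H : 'M[C]_n.
Hypotheses (hH : H ^t* = H) (pH : forall u : 'rV[C]_n, u != 0 -> 0 < (u *m H *m u ^t*) 0 0).

Lemma positive_spectral : exists (P : 'M[C]_n) (D : 'rV[C]_n), [/\ P \is unitarymx, (forall i, 0 < D 0 i)
  & H = P ^t* *m diag_mx D *m P].
Proof.
have nH : H \is normalmx by apply/normalmxP; rewrite hH.
have HE := orthomx_spectralP nH; set P := spectralmx H in HE; set D := spectral_diag H in HE.
have uP : P \is unitarymx := spectral_unitarymx H.
have uuP := unitarymx_unit uP.
exists P, D; split=> //; last by rewrite -(invmx_unitary uP).
move=> i; have -> : D 0 i = (row i P *m H *m (row i P) ^t*) 0 0.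
  have E : P *m H *m P ^t* = diag_mx D.
    by rewrite {1}HE -(invmx_unitary uP) !mulmxA mulmxV // mul1mx mulmxK.
  have := congr1 (fun A : 'M[C]_n => A i i) E; rewrite [RHS]mxE eqxx mulr1n => <-.
  by rewrite -row_mul !mxE; apply: eq_bigr => j _; rewrite !mxE.
apply: pH; apply: contraTneq uP => r0; apply/negP => /unitarymxP/matrixP/(_ i i).
rewrite !mxE eqxx big1 => [/eqP|j _]; first by rewrite eq_sym oner_eq0.
by have /rowP/(_ j) := r0; rewrite !mxE => ->; rewrite mul0r.
Qed.

Lemma positive_det : 0 < \det H.
Proof.
have [P [D [uP D0 ->]]] := positive_spectral.
rewrite -(invmx_unitary uP) !det_mulmx det_inv mulrAC mulVf; last first.
  by rewrite -unitfE -unitmxE unitarymx_unit.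
by rewrite mul1r det_diag; apply: prodr_gt0.
Qed.

Lemma positive_trace (A : 'M[C]_n) : A ^t* *m H = H *m A -> A != 0 -> 0 < \tr (A *m A).
Proof.
have [P [D [uP D0 HE]]] := positive_spectral; have uuP := unitarymx_unit uP.
have PV := invmx_unitary uP.
move=> AH A0; pose B := P *m A *m P ^t*.
have AE : A = P ^t* *m B *m P.
  by rewrite /B -PV !mulmxA mulVmx // mul1mx mulmxKV.
have trE : \tr (A *m A) = \tr (B *m B).
  rewrite AE -PV !mulmxA mulmxK // -[LHS]mxtrace_mulC !mulmxA mulmxV // mul1mx //.
have B0 : B != 0 by apply: contraNneq A0 => B0; rewrite AE B0 mulmx0 mul0mx.
have trC (X Y : 'M[C]_n) : (X *m Y) ^t* = Y ^t* *m X ^t* by rewrite trmx_mul map_mxM.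
have BD : B ^t* *m diag_mx D = diag_mx D *m B.
  have PP : P *m P ^t* = 1%:M by rewrite -PV mulmxV.
  have E := congr1 (fun X => P *m X *m P ^t*) AH; rewrite /= {1 2}HE in E.
  rewrite /B !trC trmxCK !mulmxA in E *.
  rewrite PP mul1mx in E; rewrite -[in RHS]E.
  by rewrite -[RHS]mulmxA PP mulmx1.
have Bij i j : B j i = D 0 i * (B i j)^* / D 0 j.
  have := congr1 (fun X : 'M[C]_n => X j i) BD; rewrite /= mul_mx_diag mul_diag_mx !mxE => E.
  by rewrite [D 0 i * _]mulrC E mulrC mulKf // gt_eqF.
have /existsP[i0 /existsP[j0 Bn0]] : [exists i, [exists j, B i j != 0]].
  apply: contraNT B0 => /existsPn Bz; apply/eqP/matrixP => i j; rewrite [RHS]mxE.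
  by have /existsPn/(_ j) := Bz i; rewrite negbK => /eqP.
have T i j : B i j * B j i = `|B i j| ^+ 2 * (D 0 i / D 0 j).
  by rewrite (Bij i j) normCK; ring.
have T0 i j : 0 <= B i j * B j i by rewrite T mulr_ge0 ?exprn_ge0 // divr_ge0 // ltW.
rewrite trE /mxtrace (bigD1 i0) //= mxE (bigD1 j0) //= T.
rewrite -addrA ltr_wpDr //; last first.
  by rewrite mulr_gt0 ?exprn_gt0 ?normr_gt0 // divr_gt0.
rewrite addr_ge0 ?sumr_ge0 // => i _; rewrite mxE sumr_ge0 //.
Qed.

End PositiveHermitian.

Section Pfaffian.
Context {K : comNzRingType} {n : nat}.
Implicit Types (W F : 'M[K]_(n + n)).

(* 2^n n! times the Pfaffian, for the ordering (l_1, r_1, l_2, r_2, ...) of the basis. *)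
Definition pfsum W : K :=
  \sum_(s : 'S_(n + n)) (-1) ^+ s * \prod_(k < n) W (s (lshift n k)) (s (rshift n k)).

Lemma prod_sum_pairs (h : 'I_n -> 'I_(n + n) -> 'I_(n + n) -> K) :
  \prod_(k < n) \sum_u \sum_v h k u v =
  \sum_(f : {ffun 'I_(n + n) -> 'I_(n + n)}) \prod_(k < n) h k (f (lshift n k)) (f (rshift n k)).
Proof.
under eq_bigr do rewrite pair_bigA.
rewrite (bigA_distr_bigA (fun k p => h k p.1 p.2)) /=.
rewrite (reindex (fun f : {ffun 'I_(n + n) -> 'I_(n + n)} =>
  [ffun k => (f (lshift n k), f (rshift n k))])) /=.
  by apply: eq_bigr => f _; apply: eq_bigr => k _; rewrite ffunE.
exists (fun g : {ffun 'I_n -> 'I_(n + n) * 'I_(n + n)} =>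
  [ffun j => match fintype.split j with inl k => (g k).1 | inr k => (g k).2 end]) => [f _|g _];
  apply/ffunP => j; rewrite !ffunE.
  by rewrite -[j in RHS]splitK; case: (fintype.split j) => k; rewrite ffunE.
by rewrite (unsplitK (inl j)) (unsplitK (inr j)); case: (g j).
Qed.

Lemma pfsum_congr F W : pfsum (F^T *m W *m F) = \det F * pfsum W.
Proof.
pose G (s : 'S_(n + n)) (j u : 'I_(n + n)) := F u (s j).
transitivity (\sum_(f : {ffun 'I_(n + n) -> 'I_(n + n)}) \sum_(s : 'S_(n + n))
  (\prod_(k < n) W (f (lshift n k)) (f (rshift n k))) * ((-1) ^+ s * \prod_j G s j (f j))).
  rewrite exchange_big; apply: eq_bigr => /= s _.
  have -> : \prod_(k < n) (F^T *m W *m F) (s (lshift n k)) (s (rshift n k)) =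
      \prod_(k < n) \sum_u \sum_v G s (lshift n k) u * W u v * G s (rshift n k) v.
    apply: eq_bigr => k _; rewrite mxE exchange_big; apply: eq_bigr => v _.
    by rewrite !mxE big_distrl; apply: eq_bigr => u _; rewrite mxE.
  rewrite prod_sum_pairs big_distrr; apply: eq_bigr => f _ /=.
  rewrite mulrCA; congr (_ * _); rewrite big_split_ord /= -!big_split /=.
  by apply: eq_bigr => k _; rewrite -mulrA mulrCA.
under eq_bigr do rewrite -big_distrr /=.
have detE (f : {ffun 'I_(n + n) -> 'I_(n + n)}) :
    \sum_(s : 'S_(n + n)) (-1) ^+ s * \prod_j G s j (f j) = \det (\matrix_(j, l) F (f j) l).
  apply: eq_bigr => s _; congr (_ * _); by apply: eq_bigr => j _; rewrite mxE.
under eq_bigr do rewrite detE.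
rewrite (bigID (fun f : {ffun 'I_(n + n) -> 'I_(n + n)} => injectiveb f)) /= addrC big1 ?add0r.
  rewrite (reindex (@pval _)) /=; last first.
    pose in_Sn := insubd (1%g : 'S_(n + n)).
    by exists in_Sn => /= f Uf; first apply: val_inj; apply: insubdK.
  rewrite /pfsum big_distrr; apply: eq_big => /= [s | s _]; first exact: (valP s).
  have -> : \matrix_(j, l) F (pval s j) l = perm_mx s *m F.
    by rewrite -row_permE; apply/matrixP => i j; rewrite !mxE pvalE.
  rewrite det_mulmx det_perm [LHS]mulrC -mulrA mulrCA; congr (_ * (_ * _)).
  by apply: eq_bigr => k _; rewrite !pvalE.
move=> f /injectivePn[i1 [i2 Di12 Ef12]].
by rewrite (determinant_alternate Di12) ?mulr0 // => j; rewrite !mxE Ef12.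
Qed.

Lemma pfsumZ (c : K) W : pfsum (c *: W) = c ^+ n * pfsum W.
Proof.
rewrite /pfsum big_distrr; apply: eq_bigr => s _; rewrite /= mulrCA; congr (_ * _).
rewrite -[n in c ^+ n]card_ord -prodr_const -big_split /=.
by apply: eq_bigr => k _; rewrite mxE.
Qed.

Definition sympl : 'M[K]_(n + n) := block_mx 0 1%:M (- 1%:M) 0.

Lemma symplE u : exists (c : K) (u' : 'I_(n + n)), c * c = 1 /\
  forall j, sympl u j = c * (j == u')%:R /\ sympl j u = - c * (j == u')%:R.
Proof.
rewrite /sympl; case: (fintype.split_ordP u) => k ->.
  exists 1, (rshift n k); rewrite mulr1; split=> // j.
  case: (fintype.split_ordP j) => l ->; rewrite ?block_mxEul ?block_mxEur ?block_mxEdl ?block_mxEdr;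
    rewrite !mxE ?eq_lrshift ?eq_rshift ?mulr0 ?mul1r ?mulN1r //.
  by rewrite eq_sym.
exists (-1), (lshift n k); rewrite mulrNN mulr1; split=> // j.
case: (fintype.split_ordP j) => l ->; rewrite ?block_mxEul ?block_mxEur ?block_mxEdl ?block_mxEdr;
  rewrite !mxE ?eq_rlshift ?eq_lshift ?mulr0 ?opprK ?mul1r ?mulN1r //.
by rewrite eq_sym.
Qed.

End Pfaffian.

Lemma pfsum_map (K L : comNzRingType) (f : {rmorphism K -> L}) n (W : 'M[K]_(n + n)) :
  pfsum (map_mx f W) = f (pfsum W).
Proof.
rewrite /pfsum rmorph_sum; apply: eq_bigr => s _.
rewrite rmorphM rmorph_sign rmorph_prod; congr (_ * _).
by apply: eq_bigr => k _; rewrite mxE.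
Qed.

Lemma block_mx_eq (K : Type) m1 m2 n1 n2 (a a' : 'M[K]_(m1, n1)) (b b' : 'M[K]_(m1, n2))
    (c c' : 'M[K]_(m2, n1)) (d d' : 'M[K]_(m2, n2)) :
  a = a' -> b = b' -> c = c' -> d = d' -> block_mx a b c d = block_mx a' b' c' d'.
Proof. by move=> -> -> -> ->. Qed.

Section ComplexBlocks.
Context {R : rcfType} {n : nat}.
Local Notation C := R[i].
Local Notation rc := (real_complex R).

Let T : 'M[C]_(n + n) := block_mx 1%:M 1%:M (- 'i%C)%:M 'i%C%:M.

Let iN : - ('i%C * 'i%C) = 1 :> C.
Proof. by have := sqr_i R; rewrite expr2 => ->; rewrite opprK. Qed.

Lemma det_cayley : \det T = (2 * 'i%C) ^+ n.
Proof.
have -> : T = block_mx 1%:M 0 (- 'i%C)%:M 1%:M *m block_mx 1%:M 1%:M 0 (2 * 'i%C)%:M.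
  rewrite mulmx_block !mul1mx !mulmx1 !mul0mx !addr0 ?add0r /T; congr block_mx.
  by rewrite -raddfD /=; congr (_%:M); ring.
by rewrite det_mulmx det_lblock det_ublock !det1 !mul1r det_scalar.
Qed.

Lemma det_complex_linear_ge0 (a b : 'M[R]_n) : 0 <= \det (block_mx a (- b) b a).
Proof.
pose z := map_mx rc a + 'i%C *: map_mx rc b.
pose zc := map_mx rc a - 'i%C *: map_mx rc b.
have E : map_mx rc (block_mx a (- b) b a) *m T = T *m block_mx z 0 0 zc.
  rewrite map_block_mx map_mxN /T !mulmx_block !mulmx0 !mul1mx !mulmx1 !addr0 !add0r.
  rewrite !mul_mx_scalar !mul_scalar_mx /z /zc.
  have iI (X : 'M[C]_n) : 'i%C *: ('i%C *: X) = - X.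
    by rewrite scalerA -[X in _ = - X]scale1r -scaleNr -iN opprK.
  apply: block_mx_eq.
  - by rewrite scaleNr scalerN opprK.
  - by rewrite scalerN.
  - by rewrite !scaleNr scalerDr iI opprD opprK addrC.
  - by rewrite scalerBr iI opprK addrC.
have T0 : \det T != 0.
  by rewrite det_cayley expf_neq0 // mulf_neq0 ?pnatr_eq0 // neq0Ci.
have zcE : zc = map_mx Num.conj z.
  have conjE (x y : R) : rc x - 'i%C * rc y = Num.conj (rc x + 'i%C * rc y).
    by apply/eqP; rewrite eq_complex /=; apply/andP; split; apply/eqP; ring.
  by apply/matrixP => i j; rewrite !mxE conjE.
have : \det (map_mx rc (block_mx a (- b) b a)) = `|\det z| ^+ 2.
  have := congr1 determinant E; rewrite !det_mulmx mulrC => /(mulfI T0) ->.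
  by rewrite det_ublock zcE det_map_mx normCK.
rewrite det_map_mx => H.
have : 0 <= rc (\det (block_mx a (- b) b a)) by rewrite H exprn_ge0.
by rewrite lecE /= eqxx.
Qed.

Lemma det_symplectic_unitary_ge0 (X : 'M[R]_(n + n)) :
  X *m sympl = sympl *m X -> 0 <= \det X.
Proof.
rewrite -[X]submxK; set a := ulsubmx X; set b := ursubmx X; set c := dlsubmx X; set d := drsubmx X.
rewrite /sympl !mulmx_block !mulmx0 !mul0mx !mulmxN !mulNmx !mulmx1 !mul1mx !addr0 !add0r.

move=> /eq_block_mx[bc ad _ _].
suff -> : block_mx a b c d = block_mx a (- (- b)) (- b) a by exact: det_complex_linear_ge0.
by rewrite opprK bc ad.
Qed.

(* A nonzero term of the sum is the determinant of a signed permutation matrix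
   which commutes with [sympl]. *)
Lemma pfsum_sympl_gt0 : 0 < pfsum (sympl : 'M[R]_(n + n)).
Proof.
rewrite /pfsum (bigD1 (1%g : 'S_(n + n))) //= odd_perm1 mul1r big1 => [|k _]; last first.
  by rewrite !perm1 /sympl block_mxEur mxE eqxx.
rewrite ltr_wpDr // sumr_ge0 // => s _.
set e := fun k => (sympl : 'M[R]_(n + n)) (s (lshift n k)) (s (rshift n k)).
have [e0|] := boolP [exists k, e k == 0].
  have [k /eqP ek] := existsP e0.
  by rewrite (bigD1 k) //= -/(e k) ek mul0r mulr0.
move=> /existsPn ne0.
have eP k : e k * e k = 1 /\ forall j,
    sympl (s (lshift n k)) j = e k * (j == s (rshift n k))%:R /\
    sympl (s (rshift n k)) j = - e k * (j == s (lshift n k))%:R.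
  have := ne0 k; rewrite /e; move: (s (lshift n k)) (s (rshift n k)) => u v.
  have [c [u' [c1 Wu]]] := symplE (K := R) u.
  have [c2 [v' [_ Wv]]] := symplE (K := R) v.
  rewrite (Wu v).1; have [uv|_] := eqVneq v u'; last by rewrite mulr0 eqxx.
  rewrite !mulr1 => c0; split=> // j; split; first by rewrite (Wu j).1 uv.
  have := (Wv u).2; rewrite (Wu v).1 uv eqxx mulr1.
  have [uv'|_] := eqVneq u v'; last by rewrite mulr0 => /eqP; rewrite (negbTE c0).
  by rewrite mulr1 => cE; rewrite -uv (Wv j).1 -uv' cE opprK.
pose D : 'rV[R]_(n + n) := row_mx (\row_k e k) (const_mx 1).
have Dl k : D 0 (lshift n k) = e k by rewrite row_mxEl mxE.
have Dr k : D 0 (rshift n k) = 1 by rewrite row_mxEr mxE.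
pose X := diag_mx D *m perm_mx s.
have XE i j : X i j = D 0 i * (s i == j)%:R.
  by rewrite /X mul_diag_mx !mxE.
have -> : (-1) ^+ s * \prod_(k < n) e k = \det X.
  rewrite /X det_mulmx det_perm det_diag mulrC big_split_ord /=; congr (_ * _).
  rewrite [X in _ = _ * X]big1 ?mulr1 => [|k _]; last exact: Dr.
  by apply: eq_bigr => k _; rewrite Dl.
apply: det_symplectic_unitary_ge0.
apply/matrixP => i j; rewrite !mxE (bigD1 (s i)) //= XE eqxx mulr1 big1 ?addr0 => [|k ki]; last first.
  by rewrite XE eq_sym (negbTE ki) mulr0 mul0r.
have [c [i' [c1 Wi]]] := symplE (K := R) i.
rewrite (bigD1 i') //= (Wi i').1 eqxx mulr1 big1 ?addr0 => [|k ki]; last first.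
  by rewrite (Wi k).1 (negbTE ki) mulr0 mul0r.
rewrite XE.
have J2 k := proj2 (eP k).
case: (fintype.split_ordP i) Wi => k -> Wi.
  have := (Wi (rshift n k)).1; rewrite /sympl block_mxEur mxE eqxx.
  have [<-|_] := eqVneq (rshift n k) i'; last by rewrite mulr0 => /eqP; rewrite oner_eq0.
  rewrite mulr1 => <-; rewrite !mul1r -/sympl Dl. rewrite Dr (J2 k j).1 mulrA (eP k).1 !mul1r.
  by rewrite eq_sym.
have := (Wi (lshift n k)).1; rewrite [sympl _ _]block_mxEdl mxE mxE eqxx.
have [<-|_] := eqVneq (lshift n k) i'; last by rewrite mulr0 => /eqP; rewrite oppr_eq0 oner_eq0.
rewrite mulr1 => <-; rewrite mulN1r -/sympl Dl Dr (J2 k j).2 mul1r mulNr.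
by rewrite eq_sym.
Qed.

End ComplexBlocks.

Lemma cayley_congr (K : comNzRingType) (I : K) n (A B : 'M[K]_n) :
  I * I = -1 -> A^T = - A -> B^T = B ->
  let T := block_mx 1%:M 1%:M (- I)%:M I%:M : 'M[K]_(n + n) in
  let G := block_mx 1%:M 0 0 (B - I *: A) : 'M[K]_(n + n) in
  T^T *m block_mx A B (- B) A *m T = (2 * I) *: (G^T *m sympl *m G).
Proof.
move=> I2 skA syB /=.
have HT : (B - I *: A)^T = B + I *: A.
  apply/matrixP => i j; rewrite !mxE.
  have /matrixP/(_ i j) := syB; have /matrixP/(_ i j) := skA; rewrite !mxE => -> ->.
  by rewrite mulrN opprK.
rewrite /sympl !tr_block_mx !mulmx_block !trmx0 !trmx1 !tr_scalar_mx HT.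
rewrite !mulmx0 !mul0mx !mul1mx !mulmx1 !addr0 !add0r ?mulmxN ?mul0mx ?oppr0 ?addr0 ?mulmx1.
rewrite !mul_mx_scalar !mul_scalar_mx scale_block_mx !scaler0.
apply: block_mx_eq; apply/matrixP => i j; rewrite !mxE; ring: I2.
Qed.

Section PositivePfaffian.
Context {R : rcfType} {n : nat}.
Local Notation C := R[i].
Local Notation rc := (real_complex R).
Local Open Scope sesquilinear_scope.
Variables (A B : 'M[R]_n).
Hypotheses (skA : A^T = - A) (syB : B^T = B).
Hypothesis posAB : forall v : 'cV[R]_(n + n), v != 0 ->
  0 < (v^T *m block_mx B (- A) A B *m v) 0 0.

Definition cx_herm : 'M[C]_n := map_mx rc B - 'i%C *: map_mx rc A.
Local Notation H := cx_herm.
Let T : 'M[C]_(n + n) := block_mx 1%:M 1%:M (- 'i%C)%:M 'i%C%:M.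

Let iI p q (X : 'M[C]_(p, q)) : 'i%C *: ('i%C *: X) = - X.
Proof. by have := sqr_i R; rewrite expr2 scalerA => ->; rewrite scaleN1r. Qed.

Let HT : H^T = map_mx rc B + 'i%C *: map_mx rc A.
Proof.
apply/matrixP => i j; rewrite !mxE.
have /matrixP/(_ i j) := syB; have /matrixP/(_ i j) := skA; rewrite !mxE => -> ->.
by rewrite rmorphN mulrN opprK.
Qed.

Lemma cx_herm_conj : H ^t* = H.
Proof.
rewrite HT; apply/matrixP => i j; rewrite !mxE.
by apply/eqP; rewrite eq_complex /=; apply/andP; split; apply/eqP; ring.
Qed.

Lemma herm_expand (X Y : 'rV[C]_n) (X' Y' : 'cV[C]_n) (P Q : 'M[C]_n) :
  (X + 'i%C *: Y) *m (P - 'i%C *: Q) *m (X' - 'i%C *: Y') =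
  X *m P *m X' + Y *m P *m Y' - X *m Q *m Y' + Y *m Q *m X' +
  'i%C *: (Y *m P *m X' - X *m P *m Y' - X *m Q *m X' - Y *m Q *m Y').
Proof.
rewrite !(mulmxDl, mulmxDr, mulmxBl, mulmxBr, mulmxN, mulNmx).
have Zl p q r (a : C) (U : 'M[C]_(p, q)) (V : 'M[C]_(q, r)) : (a *: U) *m V = a *: (U *m V).
  by rewrite scalemxAl.
have Zr p q r (a : C) (U : 'M[C]_(p, q)) (V : 'M[C]_(q, r)) : U *m (a *: V) = a *: (U *m V).
  by rewrite scalemxAr.
rewrite !(Zl, Zr, mulmxN, mulNmx).
move: (X *m P *m X') (X *m P *m Y') (Y *m P *m X') (Y *m P *m Y') => a1 a2 a3 a4.
move: (X *m Q *m X') (X *m Q *m Y') (Y *m Q *m X') (Y *m Q *m Y') => b1 b2 b3 b4.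
rewrite !scalerDr !scalerN !iI ?opprK.
by rewrite [LHS](AC (2*2*(2*2)) (1*7*6*4*(3*5*2*8))).
Qed.

Lemma cx_herm_pos (u : 'rV[C]_n) : u != 0 -> 0 < (u *m H *m u ^t*) 0 0.
Proof.
move=> u0; pose x := map_mx (@complex.Re R) u; pose y := map_mx (@complex.Im R) u.
have uE : u = map_mx rc x + 'i%C *: map_mx rc y.
  apply/rowP => j; rewrite !mxE; case: (u _ _) => a b.
  by apply/eqP; rewrite eq_complex /=; apply/andP; split; apply/eqP; ring.
have ucE : u ^t* = map_mx rc x^T - 'i%C *: map_mx rc y^T.
  apply/colP => j; rewrite !mxE; case: (u _ _) => a b.
  by apply/eqP; rewrite eq_complex /=; apply/andP; split; apply/eqP; ring.
have s0 (z : 'rV[R]_n) : z *m A *m z^T = 0.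
  have : (z *m A *m z^T)^T = - (z *m A *m z^T).
    by rewrite !trmx_mul trmxK skA mulNmx mulmxN mulmxA.
  rewrite [X in X^T]mx11_scalar tr_scalar_mx -mx11_scalar => /eqP.
  rewrite -addr_eq0 -mulr2n -scaler_nat scaler_eq0 pnatr_eq0 /= => /eqP //.
have s1 : y *m B *m x^T = x *m B *m y^T.
  rewrite [RHS]mx11_scalar -tr_scalar_mx -mx11_scalar !trmx_mul trmxK syB mulmxA //.
have s2 : y *m A *m x^T = - (x *m A *m y^T).
  rewrite [X in - X]mx11_scalar -tr_scalar_mx -mx11_scalar !trmx_mul trmxK skA.
  by rewrite mulNmx mulmxN opprK mulmxA.
have -> : u *m H *m u ^t* = map_mx rc (x *m B *m x^T + y *m B *m y^T - x *m A *m y^T - x *m A *m y^T).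
  rewrite ucE uE herm_expand -!map_mxM s1 !s0 s2 subrr !map_mx0 !subr0 scaler0 addr0.
  by rewrite !map_mxD !map_mxN.
rewrite mxE ltcE /= eqxx /=.
pose v := col_mx x^T y^T.
have v0 : v != 0.
  apply: contraNneq u0 => /eqP; rewrite col_mx_eq0 => /andP[/eqP x0 /eqP y0].
  by rewrite uE -[x]trmxK -[y]trmxK x0 y0 !trmx0 !map_mx0 scaler0 addr0.
have := posAB v0; congr (_ < _); congr (fun_of_matrix _ 0 0).
rewrite /v tr_col_mx !trmxK mul_row_block mul_row_col !mulmxDl mulmxN mulNmx s2.
by rewrite [LHS](AC (2*2) (1*4*2*3)).
Qed.

Lemma pfsum_block_gt0 : 0 < pfsum (block_mx A B (- B) A).
Proof.
pose W := map_mx rc (block_mx A B (- B) A); pose G := block_mx 1%:M 0 0 H : 'M[C]_(n + n).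
have E : T^T *m W *m T = (2 * 'i%C) *: (G^T *m sympl *m G).
  rewrite /W /G /cx_herm map_block_mx map_mxN; apply: cayley_congr.
  - by have := sqr_i R; rewrite expr2.
  - by rewrite map_trmx skA map_mxN.
  - by rewrite map_trmx syB.
have T0 : \det T != 0.
  by rewrite det_cayley expf_neq0 // mulf_neq0 ?pnatr_eq0 // neq0Ci.
have := congr1 pfsum E; rewrite pfsum_congr pfsumZ pfsum_congr -det_cayley => /(mulfI T0).
rewrite det_lblock det1 mul1r.
have -> : (sympl : 'M[C]_(n + n)) = map_mx rc sympl.
  by rewrite /sympl map_block_mx !map_mx0 map_mxN map_mx1.
rewrite !pfsum_map => E'.
have : 0 < rc (pfsum (block_mx A B (- B) A)).
  rewrite E' mulr_gt0 //; first exact: positive_det cx_herm_conj cx_herm_pos.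
  by rewrite ltcE /= eqxx pfsum_sympl_gt0.
by rewrite ltcE /= eqxx.
Qed.

End PositivePfaffian.

Lemma trace_sqr_gt0 (R : rcfType) n (g X : 'M[R]_n) : g^T = g ->
  (forall v : 'cV[R]_n, v != 0 -> 0 < (v^T *m g *m v) 0 0) ->
  X^T *m g = g *m X -> X != 0 -> 0 < \tr (X *m X).
Proof.
move=> sg pg Xg X0; have sk0 : (0 : 'M[R]_n)^T = - 0 by rewrite trmx0 oppr0.
have pg0 (v : 'cV[R]_n) : 0 <= (v^T *m g *m v) 0 0.
  by have [->|/pg/ltW//] := eqVneq v 0; rewrite mulmx0 mxE.
have p2 (v : 'cV[R]_(n + n)) : v != 0 ->
    0 < (v^T *m block_mx g (- 0) 0 g *m v) 0 0.
  rewrite -[v]vsubmxK col_mx_eq0 negb_and oppr0 tr_col_mx mul_row_block mul_row_col.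
  rewrite !mulmx0 addr0 add0r mxE => /orP[|] v0; first by rewrite ltr_pwDl ?pg.
  by rewrite ltr_wpDl ?pg.
have H1 := cx_herm_conj sk0 sg; have H2 := cx_herm_pos sk0 sg p2.
have HE : cx_herm 0 g = map_mx (real_complex R) g.
  by rewrite /cx_herm map_mx0 scaler0 subr0.
rewrite HE in H1 H2.
have := positive_trace H1 H2 (A := map_mx (real_complex R) X).
have -> : \tr (map_mx (real_complex R) X *m map_mx (real_complex R) X) = real_complex R (\tr (X *m X)).
  by rewrite -map_mxM -[RHS]trace_map_mx.
rewrite ltcE /= eqxx /=; apply; last by rewrite map_mx_eq0.
have -> : map_mx Num.conj (map_mx (real_complex R) X)^T = map_mx (real_complex R) X^T.
  by apply/matrixP => i j; rewrite !mxE; exact: conjc_real.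
by rewrite -!map_mxM Xg.
Qed.

Lemma pfsum_gt0 (R : realType) n (W : 'M[R]_(n + n)) :
  W^T = - W -> compatible_at W stdJ -> 0 < pfsum W.
Proof.
rewrite -[W]submxK; set a := ulsubmx W; set b := ursubmx W; set c := dlsubmx W; set d := drsubmx W.
rewrite tr_block_mx opp_block_mx => /eq_block_mx[sa cb _ _] [_].
have NT (X : 'M[R]_n) : (- X)^T = - X^T by apply/matrixP => k l; rewrite !mxE.
rewrite /stdJ tr_block_mx !mulmx_block trmx0 NT trmx1.
rewrite !mul0mx !mulmx0 !mulNmx !mul1mx !addr0 !add0r !mulmxN !mulmx1 ?opprK.
move=> /eq_block_mx[da bc _ _] pos.
have cE : c = - b by rewrite -bc ?opprK.
rewrite cE da in pos |- *; apply: pfsum_block_gt0 => //.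
  by apply: oppr_inj; rewrite -NT -cE cb.
move=> v v0; have := pos v v0.
rewrite -(mulmxA v^T (block_mx a _ _ _)) mulmx_block !mulmx0 !add0r !addr0.
by rewrite !mulmxN !mulmx1 opprK.
Qed.

Section ManifoldPositivity.
Context {R : realType} {n : nat} {M : compactKahlerManifold R n}.
Local Notation m := (n + n)%N.
Implicit Types (i : chart M) (x : 'cV[R]_m).

Lemma frame_stdJ i x : chart_image i x -> frame i x *m stdJ = stdJ *m frame i x.
Proof.
move=> [q iq <-]; apply: transition_holomorphic; exists q => //.
by split=> //; rewrite (Defs.coordK iq); exact: chart_at_dom.
Qed.

Lemma local_form_skew i x : (local_form (@omega _ _ M) i x)^T = - local_form (@omega _ _ M) i x.
Proof. by rewrite /local_form !trmx_mul trmxK omega_skew mulNmx mulmxN mulmxA. Qed.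

Lemma local_form_compatible i x : chart_image i x ->
  compatible_at (local_form (@omega _ _ M) i x) stdJ.
Proof.
move=> ix; have FJ := frame_stdJ ix; have uF := frame_unit ix.
have [J2 JwJ pos] := @omega_kahler _ _ M (param i x).
rewrite /local_form; split=> // [|u u0].
  transitivity ((frame i x *m stdJ)^T *m omega (param i x) *m (frame i x *m stdJ)).
    by rewrite trmx_mul !mulmxA.
  by rewrite FJ trmx_mul -[in RHS]JwJ !mulmxA.
have Fu0 : frame i x *m u != 0.
  by apply: contraNneq u0 => Fu; rewrite -(mulKmx uF u) Fu mulmx0.
have := pos _ Fu0; rewrite trmx_mul -!mulmxA; congr (_ < fun_of_matrix _ _ _).
by do 3 congr (_ *m _); rewrite !mulmxA FJ.
Qed.

Lemma liouville_density_gt0 i x : chart_image i x -> 0 < liouville_density i x.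
Proof.
move=> ix; rewrite /liouville_density mulr_gt0 ?invr_gt0 ?mulr_gt0 ?exprn_gt0 ?ltr0n ?fact_gt0 //.
exact: pfsum_gt0 (local_form_skew i x) (local_form_compatible ix).
Qed.

Lemma liouville_density_continuous i x : chart_image i x ->
  {for x, continuous (@liouville_density R n M i)}.
Proof.
move=> ix; have cw : {for x, continuous (local_form (@omega _ _ M) i)}.
  exact: smooth_continuous (@omega_smooth _ _ M i) ix.
rewrite /prop_for /continuous_at /liouville_density.
apply: (@cvgMl_tmp _ _ _ (nbhs_filter x)).
apply: cvg_big => [|s _]; first exact: add_continuous.
apply: (@cvgMl_tmp _ _ _ (nbhs_filter x)).
apply: cvg_big => [|k _]; first exact: mul_continuous.
apply: (@cvg_comp _ _ _ (local_form (@omega _ _ M) i) (fun A : 'M[R]_m => A (s (lshift n k)) (s (rshift n k)))); first exact: cw.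
exact: coord_continuous.
Qed.

Lemma tangent_trace_gt0 (J : acs M) (A : endo M) p : tangent J A -> A p != 0 ->
  0 < \tr (A p *m A p).
Proof.
move=> /tangentP[/(_ p) AJ /(_ p) Aw]; have cJ := acs_compatible J p.
have [_ _ pos] := cJ; have Jw := compatible_trmx cJ.
apply: (@trace_sqr_gt0 _ _ (omega p *m sval J p)).
- by rewrite trmx_mul omega_skew mulmxN Jw opprK.
- by move=> v /pos; rewrite !mulmxA.
- by rewrite mulmxA Aw mulNmx -!mulmxA AJ mulmxN opprK.
Qed.

Lemma tangent_trace_ge0 (J : acs M) (A : endo M) p : tangent J A -> 0 <= \tr (A p *m A p).
Proof.
move=> tA; have [->|A0] := eqVneq (A p) 0; first by rewrite mulmx0 mxtrace0.
exact/ltW/(tangent_trace_gt0 tA).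
Qed.

Lemma trace_continuous (A : endo M) : continuous (fun p => \tr (A p)).
Proof.
move=> p; pose i := chart_at p.
have ip : dom i p := chart_at_dom p.
have ni : \forall q \near p, dom i q by apply: open_nbhs_nbhs; split=> //; exact: dom_open.
have E q : dom i q -> \tr (A q) = \tr (local_end A i (Defs.coord i q)).
  move=> iq; have uF := frame_unit (ex_intro2 _ _ q iq erefl : chart_image i (Defs.coord i q)).
  by rewrite /local_end (Defs.coordK iq) mxtrace_mulC mulmxA mulmxV // mul1mx.
have c1 : {for Defs.coord i p, continuous (local_end A i)}.
  by apply: smooth_continuous (smooth_local_end A i) _; exists p.
have c2 : {for p, continuous (Defs.coord i)} by exact: Defs.coord_continuous.
suff H : (fun q => \tr (local_end A i (Defs.coord i q))) @ p --> \tr (A p).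
  apply: cvg_trans H; apply: near_eq_cvg; apply: filterS ni => q /E //.
rewrite (E p ip) /mxtrace.
apply: cvg_big => [|k _]; first exact: add_continuous.
apply: (@cvg_comp _ _ _ (fun q => local_end A i (Defs.coord i q)) (fun A : 'M[R]_m => A k k)).
  exact: (@continuous_comp _ _ _ (Defs.coord i) (local_end A i) p).
exact: coord_continuous.
Qed.

End ManifoldPositivity.

(** * The Liouville measure *)

Section IteratedIntegral.
Context {R : realType}.
Implicit Types (c r : R).
Local Notation leb := (@lebesgue_measure R).

Lemma integral_le_nonmeasurable d (T : measurableType d) (mu : {measure set T -> \bar R})
  (f g : T -> \bar R) : (forall x, 0 <= f x)%E -> (forall x, f x <= g x)%E ->
  (\int[mu]_x f x <= \int[mu]_x g x)%E.
Proof.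
move=> f0 fg; have g0 x : (0 <= g x)%E by exact: le_trans (f0 x) (fg x).
rewrite !ge0_integralTE //; apply: ge_ereal_sup => _ [h hf <-].
by apply: ereal_sup_ubound; exists h => // x; apply: le_trans (fg x); exact: hf.
Qed.

Lemma integral_slab (a r : R) (c : R) : 0 <= c -> 0 <= r ->
  (\int[leb]_x (c%:E * (\1_(`[a - r, a + r]) x)%:E) = (c * (2 * r))%:E)%E.
Proof.
move=> c0 r0; rewrite ge0_integralZl //=; last first.
  by apply/measurable_EFinP; exact: measurable_indic.
rewrite integral_indic // setIT EFinM; congr (_ * _)%E.
apply: etrans (lebesgue_measure_itv `[a - r, a + r]) _; rewrite /= lte_fin.
case: ltP => [_|h]; first by rewrite -EFinD; congr (_%:E); ring.
by have -> : r = 0 by [lra]; rewrite mulr0.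
Qed.

Definition box m (x0 : 'cV[R]_m) r : set 'cV[R]_m := [set y | forall i, `|y i 0 - x0 i 0| <= r].

Lemma box_col m (x0 : 'cV[R]_(1 + m)) r (x : R) (y : 'cV[R]_m) :
  box x0 r (col_mx x%:M y) <-> `[x0 (lshift m 0) 0 - r, x0 (lshift m 0) 0 + r]%classic x /\ box (dsubmx x0) r y.
Proof.
rewrite /= in_itv /= -ler_distl; split=> [H|[H1 H2] i].
  split; first by have := H (lshift m 0); rewrite col_mxEu mxE eqxx.
  by move=> i; have := H (rshift 1 i); rewrite col_mxEd !mxE.
case: (fintype.split_ordP i) => j ->; first by rewrite (ord1 j) col_mxEu mxE eqxx.
by have := H2 j; rewrite col_mxEd !mxE.
Qed.

Lemma cV_integral_ge0 m (f : 'cV[R]_m -> \bar R) : (forall y, 0 <= f y)%E -> (0 <= cV_integral f)%E.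
Proof. by elim: m f => [|m IH] f f0 //=; apply: integral_ge0 => x _; exact: IH. Qed.

Lemma cV_integral_le_box m (f : 'cV[R]_m -> \bar R) x0 c r : 0 <= c -> 0 <= r ->
  (forall y, 0 <= f y)%E -> (forall y, f y <= (c * \1_(box x0 r) y)%:E)%E ->
  (cV_integral f <= (c * (2 * r) ^+ m)%:E)%E.
Proof.
move=> + r0; elim: m f x0 c => [|m IH] f x0 c c0 f0 fc.
  rewrite expr0 mulr1; apply: le_trans (fc 0) _; rewrite lee_fin ler_piMr //.
have rm : 0 <= c * (2 * r) ^+ m by rewrite mulr_ge0 // exprn_ge0 // mulr_ge0.
apply: (@le_trans _ _ (\int[leb]_x ((c * (2 * r) ^+ m)%:E *
   (\1_(`[(x0 : 'cV_(1 + m)) (lshift m 0) 0 - r, (x0 : 'cV_(1 + m)) (lshift m 0) 0 + r]) x)%:E))%E).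
  apply: integral_le_nonmeasurable => x; first by apply: cV_integral_ge0 => y.
  rewrite -EFinM indicE.
  rewrite [_ * _%:R]mulrAC; apply: (IH _ (dsubmx (x0 : 'cV_(1 + m)))) => // [|y].
    by rewrite mulr_ge0.
  apply: le_trans (fc _) _; rewrite lee_fin -mulrA ler_wpM2l // !indicE -natrM ler_nat mulnb.
  case: (boolP (_ \in box x0 r)) => // /set_mem/box_col[H1 H2].
  by rewrite !mem_set.
by rewrite integral_slab // -mulrA -exprSr.
Qed.

Lemma cV_integral_ge_box m (f : 'cV[R]_m -> \bar R) x0 c r : 0 <= c -> 0 <= r ->
  (forall y, 0 <= f y)%E -> (forall y, (c * \1_(box x0 r) y)%:E <= f y)%E ->
  ((c * (2 * r) ^+ m)%:E <= cV_integral f)%E.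
Proof.
move=> + r0; elim: m f x0 c => [|m IH] f x0 c c0 f0 fc.
  rewrite expr0 mulr1; apply: le_trans _ (fc 0); rewrite lee_fin indicE mem_set ?mulr1 //.
  by move=> [].
have rm : 0 <= c * (2 * r) ^+ m by rewrite mulr_ge0 // exprn_ge0 // mulr_ge0.
apply: (@le_trans _ _ (\int[leb]_x ((c * (2 * r) ^+ m)%:E *
   (\1_(`[(x0 : 'cV_(1 + m)) (lshift m 0) 0 - r, (x0 : 'cV_(1 + m)) (lshift m 0) 0 + r]) x)%:E))%E).
  by rewrite integral_slab // -mulrA -exprSr.
apply: integral_le_nonmeasurable => x.
  by rewrite -EFinM lee_fin mulr_ge0 // indicE.
rewrite -EFinM indicE.
rewrite [_ * _%:R]mulrAC; apply: (IH _ (dsubmx (x0 : 'cV_(1 + m)))) => // [|y].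
  by rewrite mulr_ge0.
apply: le_trans _ (fc _); rewrite lee_fin -mulrA ler_wpM2l // !indicE -natrM ler_nat mulnb.
case: (boolP (_ && _)) => // /andP[/set_mem H1 /set_mem H2].
by rewrite mem_set //; apply/box_col.
Qed.

End IteratedIntegral.

Section LiouvilleMeasure.
Context {R : realType} {n : nat} {M : compactKahlerManifold R n}.
Local Notation m := (n + n)%N.
Local Notation T := (g_sigma_algebraType (@open M)).
Variable mu : {measure set T -> \bar R}.
Hypothesis hmu : is_liouville mu.
Implicit Types (i : chart M) (x : 'cV[R]_m) (p q : M).

Lemma nbhs_box k (x : 'cV[R]_k) (N : set 'cV[R]_k) : nbhs x N ->
  exists2 r, 0 < r & box x r `<=` N.
Proof.
move=> /nbhs_normP[e /= e0 H]; exists (e / 2); first by rewrite divr_gt0.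
move=> y yx; apply: H; rewrite /ball_ /=; apply: (@le_lt_trans _ _ (e / 2)); last first.
  by rewrite ltr_pdivrMr // ltr_pMr // ltr1n.
apply: mxnorm_le => [|a b]; first by rewrite ltW // divr_gt0.
by rewrite (ord1 b) !mxE distrC; exact: yx.
Qed.

Lemma open_measurable_carrier (U : set M) : open U -> measurable (U : set T).
Proof. by move=> oU; exact: sub_sigma_algebra. Qed.

Lemma chart_nbhs i p (N : set 'cV[R]_m) : dom i p -> nbhs (Defs.coord i p) N ->
  \forall q \near p, dom i q /\ N (Defs.coord i q).
Proof.
move=> ip xN; have cp : {for p, continuous (Defs.coord i)} by exact: Defs.coord_continuous.
have np : \forall q \near p, dom i q by apply: open_nbhs_nbhs; split=> //; exact: dom_open.
by apply: filterS2 np (cp _ xN).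
Qed.

Lemma param_nbhs i p (U : set M) : dom i p -> nbhs p U ->
  \forall x \near Defs.coord i p, (Defs.coord i @` (U `&` dom i)) x.
Proof.
move=> ip pU; have ix : chart_image i (Defs.coord i p) by exists p.
have cx := @param_continuous _ _ M i _ ix.
have pU' : nbhs (param i (Defs.coord i p)) U by rewrite (Defs.coordK ip).
have nx : \forall x \near Defs.coord i p, chart_image i x.
  by apply: open_nbhs_nbhs; split=> //; exact: chart_image_open.
apply: filterS2 nx (cx _ pU') => _ [q iq <-] /=; rewrite (Defs.coordK iq) => Uq.
by exists q.
Qed.

Lemma liouville_open_gt0 (U : set M) p : open U -> U p -> (0 < mu U)%E.
Proof.
move=> oU Up; pose i := chart_at p; have ip : dom i p := chart_at_dom p.
have ix : chart_image i (Defs.coord i p) by exists p.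
have d0 := liouville_density_gt0 ix.
set x := Defs.coord i p in ix d0 *; set d := liouville_density i x in d0.
have oUi : open (U `&` dom i) by apply: openI => //; exact: dom_open.
have n1 : \forall y \near x, d / 2 < liouville_density i y.
  have nd : nbhs d [set t | d / 2 < t].
    apply: open_nbhs_nbhs; split; first exact: open_gt.
    by rewrite /= ltr_pdivrMr // ltr_pMr // ltr1n.
  exact: (cvg_near (liouville_density_continuous ix) nd).
have n2 := param_nbhs ip (open_nbhs_nbhs (conj oU Up)).
have [r r0 Hr] := nbhs_box (filterI n1 n2).
have mUi := open_measurable_carrier oUi.
apply: (@lt_le_trans _ _ (mu (U `&` dom i))); last first.
  by apply: le_measure; rewrite ?inE //; exact: open_measurable_carrier.
have Ui : U `&` dom i `<=` dom i by move=> q [].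
rewrite (hmu mUi Ui).
apply: (@lt_le_trans _ _ (d / 2 * (2 * r) ^+ m)%:E).
  by rewrite lte_fin mulr_gt0 ?exprn_gt0 ?divr_gt0 // mulr_gt0.
have den0 y : 0 <= \1_(Defs.coord i @` (U `&` dom i)) y * liouville_density i y.
  rewrite indicE; case: (boolP (_ \in _)) => [/set_mem [q [_ iq] <-]|_]; last by rewrite mul0r.
  by rewrite mul1r; apply/ltW/liouville_density_gt0; exists q.
apply: (@cV_integral_ge_box _ _ _ x) => [||y|y]; rewrite ?lee_fin; [|exact: ltW|exact: den0|].
  by rewrite ltW // divr_gt0.
rewrite [in leLHS]indicE; case: (boolP (_ \in _)) => [/set_mem/Hr[H1 H2]|_].
  by rewrite indicE mem_set // mulr1 mul1r ltW.
by rewrite mulr0 den0.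
Qed.

Lemma local_box p : exists (B : set M) (K : set 'cV[R]_m),
  [/\ open B, B p & B `<=` dom (chart_at p)] /\
  [/\ compact K, K `<=` chart_image (chart_at p), Defs.coord (chart_at p) @` B `<=` K &
    (mu B < +oo)%E].
Proof.
pose i := chart_at p; have ip : dom i p := chart_at_dom p.
have ix : chart_image i (Defs.coord i p) by exists p.
set x := Defs.coord i p in ix *; set d := liouville_density i x.
have d0 : 0 < d := liouville_density_gt0 ix.
have n1 : \forall y \near x, liouville_density i y < d + 1.
  have nd : nbhs d [set t | t < d + 1].
    by apply: open_nbhs_nbhs; split; [exact: open_lt|rewrite /= ltrDl].
  exact: (cvg_near (liouville_density_continuous ix) nd).
have n2 : \forall y \near x, chart_image i y.
  by apply: open_nbhs_nbhs; split=> //; exact: chart_image_open.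
have [r r0 Hr] := nbhs_box (filterI n1 n2).
have nx : nbhs x (box x r).
  apply: (nbhs_normP x (box x r)).2; exists r => // y; rewrite /ball_ /= distrC => yr i0.
  by apply: le_trans (ltW yr); have := mxnorm_entry (y - x) i0 0; rewrite !mxE.
have : nbhs p [set q | dom i q /\ box x r (Defs.coord i q)] := chart_nbhs ip nx.
rewrite nbhsE => -[B [oB Bp] HB].
exists B, (box x r); split; split=> //.
- by move=> q /HB[].
- exact: cV_closed_ball_compact.
- by move=> y /Hr[].
- by move=> _ [q /HB[_ Kq] <-].
have Bi : B `<=` dom i by move=> q /HB[].
rewrite (hmu (open_measurable_carrier oB) Bi).
apply: (@le_lt_trans _ _ ((d + 1) * (2 * r) ^+ m)%:E); last exact: ltry.
have den0 y : 0 <= \1_(Defs.coord i @` B) y * liouville_density i y.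
  rewrite indicE; case: (boolP (_ \in _)) => [/set_mem [q Bq <-]|_]; last by rewrite mul0r.
  by rewrite mul1r; apply/ltW/liouville_density_gt0; exists q => //; exact: Bi.
apply: (@cV_integral_le_box _ _ _ x) => [||y|y]; rewrite ?lee_fin; [|exact: ltW|exact: den0|].
  by rewrite ltW // addr_gt0.
rewrite !indicE; case: (boolP (_ \in _)) => [/set_mem [q Bq <-]|_].
  rewrite mul1r mem_set ?mulr1; last by have [] := HB _ Bq.
  by have [_ /Hr[/ltW]] := HB _ Bq.
by rewrite mul0r mulr_ge0 // ltW // addr_gt0.
Qed.

End LiouvilleMeasure.

Section LiouvilleIntegral.
Context {R : realType} {n : nat} {M : compactKahlerManifold R n}.
Local Notation m := (n + n)%N.
Local Notation T := (g_sigma_algebraType (@open M)).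
Variable mu : {measure set T -> \bar R}.
Hypothesis hmu : is_liouville mu.
Implicit Types (i : chart M) (x : 'cV[R]_m) (p q : M) (A C : endo M).

Lemma finite_chart_cover : exists (s : seq M) (B : M -> set M) (K : M -> set 'cV[R]_m),
  [/\ forall p, open (B p) /\ (mu (B p) < +oo)%E,
      forall p, compact (K p) /\ K p `<=` chart_image (chart_at p),
      forall p q, B p q -> dom (chart_at p) q /\ K p (Defs.coord (chart_at p) q) &
      forall q, exists2 p, p \in s & B p q].
Proof.
have [f Hf] := choice (fun p => let: ex_intro B (ex_intro K H) := local_box hmu p in
  ex_intro (fun X : set M * set 'cV[R]_m =>
   [/\ open X.1, X.1 p & X.1 `<=` dom (chart_at p)] /\
   [/\ compact X.2, X.2 `<=` chart_image (chart_at p), Defs.coord (chart_at p) @` X.1 `<=` X.2 &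
    (mu X.1 < +oo)%E]) (B, K) H).
have := @carrier_compact _ _ M; rewrite compact_cover => /(_ M setT (fun p => (f p).1)).
case=> [p _|q _|D _ Dc]; first by have [[]] := Hf p.
  by exists q => //; have [[]] := Hf q.
exists (enum_fset D), (fun p => (f p).1), (fun p => (f p).2); split=> [p|p|p q Bq|q].
- by have [[oB _ _] [_ _ _ ?]] := Hf p.
- by have [_ []] := Hf p.
- have [[_ _ Bd] [_ _ BK _]] := Hf p; split; first exact: Bd.
  by apply: BK; exists q.
- by have [p pD Bq] := Dc q I; exists p.
Qed.

Lemma liouville_finite : (mu setT < +oo)%E.
Proof.
have [s [B [K [HB _ _ Hs]]]] := finite_chart_cover.
have [oB mB] : (forall p, open (B p)) /\ (forall p, mu (B p) < +oo)%E.
  by split=> p; have [] := HB p.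
suff [oS HS] : open [set q | exists2 p, p \in s & B p q] /\
    (mu [set q | exists2 p, p \in s & B p q] < +oo)%E.
  suff <- : [set q | exists2 p, p \in s & B p q] = setT by [].
  by apply/seteqP; split=> q _ //; exact: Hs.
elim: s {Hs} => [|p s [oS HS]].
  suff -> : [set q | exists2 p, p \in [::] & B p q] = set0.
    by split; [exact: open0|rewrite measure0].
  by apply/seteqP; split=> q // [].
have -> : [set q | exists2 p', p' \in p :: s & B p' q] =
    B p `|` [set q | exists2 p, p \in s & B p q].
  apply/seteqP; split=> q.
    by move=> [p']; rewrite inE => /orP[/eqP ->|ps] Bq; [left|right; exists p'].
  move=> [Bq|[p' ps Bq]]; first by exists p => //; exact: mem_head.
  by exists p' => //; rewrite inE ps orbT.
split; first exact: openU.
apply: le_lt_trans (measureU2 _ (open_measurable_carrier (oB p)) (open_measurable_carrier oS)) _.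
exact: (lte_add_pinfty (mB p) HS).
Qed.

Lemma continuous_integrable (f : M -> R) : continuous f -> mu.-integrable setT (EFin \o f).
Proof.
move=> cf; apply: measurable_bounded_integrable => //; first exact: liouville_finite.
  apply: (measurability _ (RGenOpens.measurableE R)).
  move=> _ [_ [a [b ->] <-]]; rewrite setTI; apply: open_measurable_carrier.
  by have /continuousP := cf; apply; exact: interval_open.
have [||c _ Hc] := @compact_EVT_max _ _ (fun q => `|f q|) setT _ (@carrier_compact _ _ M) _.
- by exists point.
- apply: continuous_subspaceT => q; apply: for_continuous_norm; exact: cf.
exists `|f c|; split; first exact: num_real.
by move=> e ce q _; apply: le_trans (ltW ce); exact: Hc (mem_set I).
Qed.

Lemma trace_norm_le (X : 'M[R]_m) : `|\tr X| <= m%:R * `|X|.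
Proof.
rewrite (le_trans (ler_norm_sum _ _ _)) //.
apply: (@le_trans _ _ (\sum_(k < m) `|X|)); first by apply: ler_sum => k _; exact: mxnorm_entry.
by rewrite sumr_const card_ord mulr_natl.
Qed.

Definition trace_integral (C : endo M) : R := \int[mu]_p \tr (C p).

Lemma trace_integral_lin (c : R) A C :
  trace_integral (c *: A + C) = c * trace_integral A + trace_integral C.
Proof.
have iA := continuous_integrable (@trace_continuous _ _ _ A).
have iC := continuous_integrable (@trace_continuous _ _ _ C).
have iZ : mu.-integrable setT (EFin \o (fun p => c * \tr (A p))).
  by have := integrableZl measurableT c iA.
rewrite /trace_integral -(RintegralZl c measurableT iA) -(RintegralD measurableT iZ iC).
by apply: eq_Rintegral => p _; rewrite endo_valD endo_valZ mxtraceD mxtraceZ.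
Qed.

Lemma trace_integral_le C d : (forall q, `|\tr (C q)| <= d) ->
  `|trace_integral C| <= d * fine (mu setT).
Proof.
move=> Cd; have iC := continuous_integrable (@trace_continuous _ _ _ C).
rewrite (le_trans (le_normr_Rintegral measurableT iC)) //.
have -> : d * fine (mu setT) = \int[mu]_p d.
  by rewrite Rintegral_cst.
have iN : mu.-integrable setT (EFin \o (fun q => `|\tr (C q)|)).
  by apply: continuous_integrable => q; apply: (@for_continuous_norm R M R^o); exact: trace_continuous.
have id : mu.-integrable setT (EFin \o (fun _ => d)).
  by apply: continuous_integrable => q; exact: cvg_cst.
by apply: (le_Rintegral measurableT iN id) => q _; exact: Cd.
Qed.

Lemma near_all_seq S (G : set_system S) (s : seq M) (P : M -> S -> Prop) : Filter G ->
  (forall p, \forall t \near G, P p t) -> \forall t \near G, forall p, p \in s -> P p t.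
Proof.
move=> FG HP; elim: s => [|p s IH]; first by near=> t.
apply: filterS2 (HP p) IH => t H1 H2 p'; rewrite inE => /orP[/eqP ->|] //.
exact: H2.
Unshelve. all: by end_near. Qed.

Lemma trace_integral_cts : lin_cts (fun C : endo M => trace_integral C : R^o).
Proof.
split=> [c A C|S G F C FG FC]; first exact: trace_integral_lin.
have [s [B [K [_ HK HBK Hs]]]] := finite_chart_cover.
set V := fine (mu setT); have V0 : 0 <= V by apply: fine_ge0.
apply/cvgrPdist_le => e e0.
have V1 : 0 < V + 1 by rewrite ltr_wpDl.
have m1 : 0 < m%:R + 1 :> R by rewrite ltr_wpDl.
pose d := e / (V + 1) / (m%:R + 1); have d0 : 0 < d by rewrite !divr_gt0.
have HP p : \forall t \near G, forall x, K p x -> `|local_end (F t - C : endo M) (chart_at p) x| < d.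
  have [cK Ki] := HK p.
  exact: (((endo_cvgP _ _ FG).1 FC _ _ cK Ki 0%N).1 d d0).
apply: filterS (near_all_seq s FG HP) => t Ht.
have E : trace_integral C - trace_integral (F t) = - trace_integral (F t - C).
  have := trace_integral_lin (-1) C (F t); rewrite scaleN1r [- C + _]addrC => ->.
  by rewrite mulN1r opprD opprK addrC.
rewrite E normrN (le_trans (trace_integral_le (d := e / (V + 1)) _)) //; last first.
  by rewrite -mulrAC ler_pdivrMr // ler_pM2l // lerDl.
move=> q; have [p ps Bq] := Hs q; have [iq Kq] := HBK _ _ Bq.
have uF : frame (chart_at p) (Defs.coord (chart_at p) q) \in unitmx by apply: frame_unit; exists q.
have -> : \tr ((F t - C : endo M) q) = \tr (local_end (F t - C : endo M) (chart_at p) (Defs.coord (chart_at p) q)).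
  by rewrite /local_end (Defs.coordK iq) [RHS]mxtrace_mulC mulmxA mulmxV // mul1mx.
rewrite (le_trans (trace_norm_le _)) //.
apply: (@le_trans _ _ (m%:R * d)); first by rewrite ler_wpM2l // ltW // Ht.
rewrite /d mulrCA ler_piMr //; first by apply/ltW/divr_gt0.
by rewrite ler_pdivrMr // mul1r lerDl.
Qed.

Lemma metric_gt0 (J : acs M) A : tangent J A -> A != 0 -> 0 < metric mu A A.
Proof.
move=> tA A0.
have [p Ap0] : exists p, A p != 0.
  apply: contrapT => H; have /eqP := A0; apply; apply: endo_eqP => p.
  by rewrite endo_val0; apply/eqP; apply: contraT => Ap; exfalso; apply: H; exists p.
rewrite /metric mulr_gt0 ?invr_gt0 //.
pose f q := \tr (A q *m A q); set c := f p.
have cf : continuous f by exact: (@trace_continuous _ _ _ (endo_mul A A)).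
have c0 : 0 < c := tangent_trace_gt0 tA Ap0.
pose U := [set q | c / 2 < f q].
have oU : open U by have /continuousP H := cf; exact: (H _ (@open_gt _ (c / 2))).
have Up : U p by rewrite /U /= ltr_pdivrMr // ltr_pMr // ltr1n.
have mU := liouville_open_gt0 hmu oU Up.
have mUm := open_measurable_carrier oU.
have f0 q : 0 <= f q := tangent_trace_ge0 q tA.
have i1 : mu.-integrable setT (EFin \o \1_U).
  apply: measurable_bounded_integrable => //; first exact: liouville_finite.
  exists 1; split; first exact: num_real.
  move=> e e1 q _; apply: le_trans (ltW e1).
  by rewrite /= indicE ger0_norm //; case: (q \in U).
have iU : mu.-integrable setT (EFin \o (fun q => c / 2 * \1_U q)).
  exact: (integrableZl measurableT (c / 2) i1).
apply: (@lt_le_trans _ _ (\int[mu]_q (c / 2 * \1_U q))); last first.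
  apply: (le_Rintegral measurableT iU (continuous_integrable cf)) => q _.
  rewrite indicE; case: (boolP (_ \in _)) => [/set_mem Uq|_].
    by rewrite mulr1 ltW.
  by rewrite mulr0 f0.
rewrite (RintegralZl _ measurableT i1) mulr_gt0 ?divr_gt0 // /Rintegral integral_indic // setIT.
apply: fine_gt0; rewrite mU /=; apply: le_lt_trans liouville_finite.
by apply: le_measure; rewrite ?inE.
Qed.

End LiouvilleIntegral.

Theorem corollary1p3p15 (R : realType) (n : nat) (M : compactKahlerManifold R n)
    (mu : {measure set (g_sigma_algebraType (@open M)) -> \bar R})
    (hmu : is_liouville mu)
    (nabla : field M -> field M -> field M) (hnabla : levi_civita mu nabla) :
  [/\ complex_structure_parallel nabla,
      curvature_parallel nabla
    & formally_symmetric_kahler mu nabla].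
Proof. exact: (kahler_symmetric (trace_integral_cts hmu) (@metric_gt0 _ _ _ _ hmu) hnabla). Qed.
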